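(* Let $\mathcal{H}(T,A,\mu)$ be a Cauchy--de Branges space with $A$ of finite order. Then an entire function $f$ belongs to $\mathcal{H}(T,A,\mu)$ if and only if the following three conditions hold: (i) $\sum_n\dfrac{|f(t_n)|^2}{|A'(t_n)|^2\mu_n}<\infty$; (ii) there exist a set $E\subset(0,\infty)$ of zero linear density and $N>0$ such that $|f(z)|\le|z|^N|A(z)|$ for all $z$ with $|z|\notin E$ (and $|z|$ sufficiently large); (iii) there exists a set $\Omega\subset\mathbb{C}$ of positive upper area density, i.e. $\limsup_{R\to\infty}R^{-2}m_2(\Omega\cap D(0,R))>0$, such that $|f(z)|=o(|A(z)|)$ as $|z|\to\infty$, $z\in\Omega$. Moreover, for $f\in\mathcal{H}(T,A,\mu)$, $\|f\|^2=\sum_n\frac{|f(t_n)|^2}{|A'(t_n)|^2\mu_n}$.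
   Context: $T=\{t_n\}\subset\mathbb{C}$ pairwise distinct, $0\notin T$, $|t_n|\to\infty$. $A$ is an entire function with simple zeros whose zero set is exactly $T$; $\mu_n>0$ with $\sum_n\mu_n/(|t_n|^2+1)<\infty$; $\mathcal{H}(T,A,\mu)=\{f(z)=A(z)\sum_n\frac{a_n\mu_n^{1/2}}{z-t_n}: a\in\ell^2\}$ with $\|f\|=\|a\|_{\ell^2}$. A set $E\subset(0,\infty)$ has zero linear density if $|E\cap(0,R)|=o(R)$, $R\to\infty$. $m_2$ is planar Lebesgue measure, $D(0,R)$ the disc of radius $R$ about $0$. *)

(* Defs.v *)
From Stdlib Require Import Reals Lra.
Open Scope R_scope.

Definition Cpx := (R * R)%type.
Definition C0 : Cpx := (0, 0).
Definition Cre (z : Cpx) : R := fst z.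
Definition Cim (z : Cpx) : R := snd z.
Definition Cadd (z w : Cpx) : Cpx := (fst z + fst w, snd z + snd w).
Definition Copp (z : Cpx) : Cpx := (- fst z, - snd z).
Definition Csub (z w : Cpx) : Cpx := Cadd z (Copp w).
Definition Cmul (z w : Cpx) : Cpx :=
  (fst z * fst w - snd z * snd w, fst z * snd w + snd z * fst w).
Definition RtoC (x : R) : Cpx := (x, 0).
Definition Cnorm (z : Cpx) : R := sqrt (fst z ^ 2 + snd z ^ 2).
Definition Cinv (z : Cpx) : Cpx :=
  (fst z / (fst z ^ 2 + snd z ^ 2), - snd z / (fst z ^ 2 + snd z ^ 2)).
Definition Cdiv (z w : Cpx) : Cpx := Cmul z (Cinv w).

Definition has_cderiv (f : Cpx -> Cpx) (z l : Cpx) : Prop :=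
  forall eps, 0 < eps -> exists delta, 0 < delta /\
    forall h, Cnorm h < delta ->
      Cnorm (Csub (Csub (f (Cadd z h)) (f z)) (Cmul l h)) <= eps * Cnorm h.

Definition entire (f : Cpx -> Cpx) : Prop := forall z, exists l, has_cderiv f z l.

(** Finite order: log log M(r) / log r bounded, i.e. |A(z)| <= exp(|z|^rho) for large |z| *)
Definition finite_order (A : Cpx -> Cpx) : Prop :=
  exists rho R0, 0 < rho /\ forall z, R0 < Cnorm z -> Cnorm (A z) <= exp (Rpower (Cnorm z) rho).

Fixpoint Cpartial (u : nat -> Cpx) (N : nat) : Cpx :=
  match N with O => C0 | S k => Cadd (Cpartial u k) (u k) end.
Definition Cseries_cv (u : nat -> Cpx) (s : Cpx) : Prop :=
  forall eps, 0 < eps -> exists N, forall n, (N <= n)%nat -> Cnorm (Csub (Cpartial u n) s) < eps.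

Definition l2 (a : nat -> Cpx) : Prop := exists l, infinite_sum (fun n => Cnorm (a n) ^ 2) l.

Definition H_rep (t : nat -> Cpx) (A : Cpx -> Cpx) (mu : nat -> R) (f : Cpx -> Cpx) (a : nat -> Cpx) : Prop :=
  entire f /\ l2 a /\
  forall z, (forall n, z <> t n) ->
    exists s, Cseries_cv (fun n => Cdiv (Cmul (a n) (RtoC (sqrt (mu n)))) (Csub z (t n))) s
              /\ f z = Cmul (A z) s.

Definition in_H (t : nat -> Cpx) (A : Cpx -> Cpx) (mu : nat -> R) (f : Cpx -> Cpx) : Prop :=
  exists a, H_rep t A mu f a.

(** Zero linear density, via Lebesgue outer measure on R:
    for every eps>0 and all large R, E ∩ (0,R) is covered by countably many
    intervals of total length <= eps R. *)
Definition zero_linear_density (E : R -> Prop) : Prop :=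
  forall eps, 0 < eps -> exists R0, forall Rr, R0 < Rr ->
    exists (a b : nat -> R) (l : R),
      (forall k, a k <= b k) /\
      (forall x, E x -> 0 < x < Rr -> exists k, a k < x < b k) /\
      infinite_sum (fun k => b k - a k) l /\ l <= eps * Rr.

(** v <= m2*(S) (planar Lebesgue outer measure via countable covers by rectangles) *)
Definition area_outer_ge (S : Cpx -> Prop) (v : R) : Prop :=
  forall (a b c d : nat -> R) (l : R),
    (forall k, a k <= b k /\ c k <= d k) ->
    (forall z, S z -> exists k, a k < Cre z < b k /\ c k < Cim z < d k) ->
    infinite_sum (fun k => (b k - a k) * (d k - c k)) l -> v <= l.

Definition positive_upper_area_density (Om : Cpx -> Prop) : Prop :=
  exists c, 0 < c /\ forall R0, exists Rr, R0 < Rr /\ 0 < Rr /\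
    area_outer_ge (fun z => Om z /\ Cnorm z < Rr) (c * Rr ^ 2).

Definition weight_sum_term (t : nat -> Cpx) (dA : Cpx -> Cpx) (mu : nat -> R) (f : Cpx -> Cpx) (n : nat) : R :=
  Cnorm (f (t n)) ^ 2 / (Cnorm (dA (t n)) ^ 2 * mu n).

(* Main.v *)
From Coquelicot Require Import Coquelicot.
From Stdlib Require Import Reals Lra Lia List FinFun Classical ClassicalEpsilon.
Require Import Defs.
Open Scope R_scope.

(** Complex analysis is built from pointwise differentiability.  Applied to [F (exp w)],
    Goursat's bisection shows that the mean of [F] over the circle [|z| = r] does not depend on [r],
    as long as [F] is continuous and the exceptional points have isolated moduli.  Applying this mean
    value property to [z (F z - F a) / (z - a)] gives the removable singularity theorem and a
    Liouville theorem, and applying it to [A] divided by its zeros shows that a finite order [A] has at most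
    polynomially many zeros in a disc.

    If [f = A * C] with [C z = sum_n b_n / (z - t_n)], then [C] grows at most polynomially off the
    radii within [(1 + |t_n|)^-M] of some [|t_n|], because there are polynomially many of them;
    and, since [sum_n |b_n| / (1 + |t_n|) < oo], Chebyshev's inequality for
    [sum_n |b_n| / |z - t_n|] shows that [{ |C| > eps }] has zero area density.

    Conversely, put [b_n = f (t_n) / A' (t_n)].  The function [S = f / A - C] extends continuously
    to the poles, is polynomially bounded on arbitrarily large circles, and is small at arbitrarily
    large points of [Om].  Each divided difference lowers the growth by one degree,
    so [S = 0]. *)

(* Condition (iii) is what excludes [f = A * p] with [p] a nonzero polynomial: such an [f] vanishes
   at every [t n] and satisfies (i) and (ii), but the norm formula would give it norm 0. So the
   converse has to combine polynomial growth with small values, and these are found where [Om], of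
   positive upper density, meets the set on which [C] is small, whose complement has zero density.

   Derivatives are given only pointwise, so a divided difference is known to be continuous at its
   base point but not differentiable there. This is why the mean value property is proved with
   exceptional points. Circles about the origin suffice: [z * (F z - F a) / (z - a)] takes the value
   0 at the origin, and that its mean vanishes is Cauchy's formula at [a].

   Areas are outer measures defined by countable covers with rectangles, so no additivity is at
   hand; lower bounds go through a covering lemma with weighted lengths, applied once in each
   coordinate. *)
Declare Scope cpx_scope.
Delimit Scope cpx_scope with cpx.
Bind Scope cpx_scope with Cpx.
Notation "z + w" := (Cadd z w) : cpx_scope.
Notation "z - w" := (Csub z w) : cpx_scope.
Notation "z * w" := (Cmul z w) : cpx_scope.
Notation "z / w" := (Cdiv z w) : cpx_scope.
Notation "- z" := (Copp z) : cpx_scope.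
Notation "0" := C0 : cpx_scope.

(** * Complex arithmetic and the modulus *)

Definition C1 : Cpx := (1, 0).
Notation "1" := C1 : cpx_scope.
Definition Cconj (z : Cpx) : Cpx := (fst z, - snd z).

Lemma Cpx_ext (z w : Cpx) : fst z = fst w -> snd z = snd w -> z = w.
Proof. destruct z, w; simpl; intros; subst; reflexivity. Qed.

Lemma Cpx_neq0 (z : Cpx) : z <> C0 -> 0 < fst z ^ 2 + snd z ^ 2.
Proof.
  intros H. destruct (Req_dec (fst z) 0) as [H1|H1].
  - destruct (Req_dec (snd z) 0) as [H2|H2].
    + exfalso; apply H, Cpx_ext; assumption.
    + pose proof (pow2_gt_0 _ H2). pose proof (pow2_ge_0 (fst z)). lra.
  - pose proof (pow2_gt_0 _ H1). pose proof (pow2_ge_0 (snd z)). lra.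
Qed.

Lemma Cpx_field_theory : field_theory C0 C1 Cadd Cmul Csub Copp Cdiv Cinv eq.
Proof.
  split.
  - split; intros; apply Cpx_ext; simpl; ring.
  - intros H. apply (f_equal fst) in H. simpl in H. lra.
  - reflexivity.
  - intros z Hz. apply Cpx_neq0 in Hz. apply Cpx_ext; simpl; field; simpl in *; lra.
Qed.

Add Field Cpx_field : Cpx_field_theory.

Lemma Cnorm_ge0 (z : Cpx) : 0 <= Cnorm z.
Proof. apply sqrt_pos. Qed.

(** [Cpx] and [Cnorm] are convertible to Coquelicot's [C] and [Cmod], whose norm lemmas therefore
    apply as they stand. *)
Lemma Cnorm_mul (z w : Cpx) : Cnorm (z * w) = Cnorm z * Cnorm w.
Proof. exact (Cmod_mult z w). Qed.

Lemma Cnorm_add (z w : Cpx) : Cnorm (z + w) <= Cnorm z + Cnorm w.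
Proof. exact (Cmod_triangle z w). Qed.

Lemma Cnorm_opp (z : Cpx) : Cnorm (- z) = Cnorm z.
Proof. exact (Cmod_opp z). Qed.

Lemma Cnorm_sub (z w : Cpx) : Cnorm (z - w) <= Cnorm z + Cnorm w.
Proof. unfold Csub. rewrite <- (Cnorm_opp w). apply Cnorm_add. Qed.

Lemma Csub_opp (z w : Cpx) : (z - w = - (w - z))%cpx.
Proof. ring. Qed.

Lemma Cnorm_sub_sym (z w : Cpx) : Cnorm (z - w) = Cnorm (w - z).
Proof. rewrite Csub_opp. apply Cnorm_opp. Qed.

Lemma Cnorm_sub_ge (z w : Cpx) : Cnorm z - Cnorm w <= Cnorm (z - w).
Proof.
  pose proof (Cnorm_add (z - w) w) as H.
  replace (z - w + w)%cpx with z in H by ring. lra.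
Qed.

Lemma Cnorm_tri (z y w : Cpx) : Cnorm (z - w) <= Cnorm (z - y) + Cnorm (y - w).
Proof. replace (z - w)%cpx with (z - y + (y - w))%cpx by ring. apply Cnorm_add. Qed.

Lemma Cnorm_C0 : Cnorm C0 = 0.
Proof. exact Cmod_0. Qed.

Lemma Cnorm_sub_diag (z : Cpx) : Cnorm (z - z) = 0.
Proof. replace (z - z)%cpx with C0 by ring. exact Cnorm_C0. Qed.

Lemma Cnorm_C1 : Cnorm C1 = 1.
Proof. exact Cmod_1. Qed.

Lemma Cnorm_eq0 (z : Cpx) : Cnorm z = 0 -> z = C0.
Proof. exact (Cmod_eq_0 z). Qed.

Lemma Cnorm_gt0 (z : Cpx) : z <> C0 -> 0 < Cnorm z.
Proof. exact (proj1 (Cmod_gt_0 z)). Qed.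

Lemma Cnorm_gt0_neq (z : Cpx) : 0 < Cnorm z -> z <> C0.
Proof. intros H ->. rewrite Cnorm_C0 in H. lra. Qed.

Lemma Csub_eq0 (z w : Cpx) : (z - w)%cpx = C0 -> z = w.
Proof. intros H. replace z with (z - w + w)%cpx by ring. rewrite H. ring. Qed.

Lemma Csub_neq0 (z w : Cpx) : z <> w -> (z - w)%cpx <> C0.
Proof. intros H E. apply H, Csub_eq0, E. Qed.

Lemma Cnorm_sub_gt0 (z w : Cpx) : z <> w -> 0 < Cnorm (z - w).
Proof. intros H. apply Cnorm_gt0, Csub_neq0, H. Qed.

Lemma Cnorm_inv (z : Cpx) : z <> C0 -> Cnorm (Cinv z) = / Cnorm z.
Proof.
  intros H. pose proof (Cnorm_gt0 z H) as H1.
  apply (Rmult_eq_reg_r (Cnorm z)); [|lra].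
  rewrite <- Cnorm_mul. replace (Cinv z * z)%cpx with C1 by (field; exact H).
  rewrite Cnorm_C1. field. lra.
Qed.

Lemma Cnorm_div (z w : Cpx) : w <> C0 -> Cnorm (z / w) = Cnorm z / Cnorm w.
Proof. intros H. unfold Cdiv. rewrite Cnorm_mul, Cnorm_inv by exact H. reflexivity. Qed.

Lemma Cmul_integral (z w : Cpx) : (z * w)%cpx = C0 -> z = C0 \/ w = C0.
Proof.
  intros H. apply (f_equal Cnorm) in H. rewrite Cnorm_mul, Cnorm_C0 in H.
  apply Rmult_integral in H. destruct H; [left|right]; apply Cnorm_eq0; assumption.
Qed.

Lemma Cmul_neq0 (z w : Cpx) : z <> C0 -> w <> C0 -> (z * w)%cpx <> C0.
Proof. intros H1 H2 H. destruct (Cmul_integral _ _ H); auto. Qed.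

Lemma Cnorm_RtoC (x : R) : Cnorm (RtoC x) = Rabs x.
Proof. exact (Cmod_R x). Qed.

Lemma Cnorm_fst (z : Cpx) : Rabs (fst z) <= Cnorm z.
Proof.
  apply Rle_trans with (Rmax (Rabs (fst z)) (Rabs (snd z))); [apply Rmax_l|exact (Rmax_Cmod z)].
Qed.

Lemma Cnorm_snd (z : Cpx) : Rabs (snd z) <= Cnorm z.
Proof.
  apply Rle_trans with (Rmax (Rabs (fst z)) (Rabs (snd z))); [apply Rmax_r|exact (Rmax_Cmod z)].
Qed.

Lemma Cnorm_le_abs (z : Cpx) : Cnorm z <= Rabs (fst z) + Rabs (snd z).
Proof.
  replace z with (Cadd (RtoC (fst z)) (Cmul (0, 1) (RtoC (snd z)))) at 1
    by (apply Cpx_ext; simpl; ring).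
  eapply Rle_trans; [apply Cnorm_add|].
  rewrite Cnorm_mul, !Cnorm_RtoC.
  replace (Cnorm (0, 1)) with 1; [lra|].
  unfold Cnorm; simpl. replace (_ + _) with 1 by ring. symmetry; apply sqrt_1.
Qed.

(** * Continuity and pointwise complex differentiability *)

Definition Ccont (f : Cpx -> Cpx) (z : Cpx) : Prop :=
  forall eps, 0 < eps -> exists delta, 0 < delta /\
    forall w, Cnorm (w - z) < delta -> Cnorm (f w - f z) < eps.

Definition cderivable (f : Cpx -> Cpx) (z : Cpx) : Prop := exists l, has_cderiv f z l.

(** The increment is written [w - z], so that estimates for several functions can be added at a
    common point [w]. *)
Definition cderiv_at (f : Cpx -> Cpx) (z l : Cpx) : Prop :=
  forall eps, 0 < eps -> exists delta, 0 < delta /\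
    forall w, Cnorm (w - z) < delta ->
      Cnorm (f w - f z - l * (w - z)) <= eps * Cnorm (w - z).

Lemma cderiv_atE (f : Cpx -> Cpx) (z l : Cpx) : has_cderiv f z l -> cderiv_at f z l.
Proof.
  intros H eps He. destruct (H eps He) as [d [Hd H1]]; exists d; split; auto.
  intros w Hw. specialize (H1 _ Hw).
  replace (z + (w - z))%cpx with w in H1 by ring. exact H1.
Qed.

Lemma cderiv_atI (f : Cpx -> Cpx) (z l : Cpx) : cderiv_at f z l -> has_cderiv f z l.
Proof.
  intros H eps He. destruct (H eps He) as [d [Hd H1]]; exists d; split; auto.
  intros h Hh. specialize (H1 (z + h)%cpx).
  replace (z + h - z)%cpx with h in H1 by ring. auto.
Qed.

Lemma Rmin3_lt (x a b c : R) : x < Rmin a (Rmin b c) -> x < a /\ x < b /\ x < c.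
Proof.
  intros H. pose proof (Rmin_l a (Rmin b c)). pose proof (Rmin_r a (Rmin b c)).
  pose proof (Rmin_l b c). pose proof (Rmin_r b c). lra.
Qed.

Ltac min_bounds a b := pose proof (Rmin_l a b); pose proof (Rmin_r a b).
Ltac max_bounds a b := pose proof (Rmax_l a b); pose proof (Rmax_r a b).

Lemma Rmin3_gt0 (a b c : R) : 0 < a -> 0 < b -> 0 < c -> 0 < Rmin a (Rmin b c).
Proof. intros; repeat apply Rmin_glb_lt; assumption. Qed.

Lemma has_cderiv_lip (f : Cpx -> Cpx) (z l : Cpx) :
  has_cderiv f z l -> exists delta, 0 < delta /\
    forall w, Cnorm (w - z) < delta -> Cnorm (f w - f z) <= (Cnorm l + 1) * Cnorm (w - z).
Proof.
  intros H. apply cderiv_atE in H. destruct (H 1 Rlt_0_1) as [d [Hd H1]].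
  exists d; split; auto. intros w Hw. specialize (H1 w Hw).
  replace (f w - f z)%cpx with ((f w - f z - l * (w - z)) + l * (w - z))%cpx by ring.
  eapply Rle_trans; [apply Cnorm_add|]. rewrite Cnorm_mul. lra.
Qed.

Lemma cderivable_cont (f : Cpx -> Cpx) (z : Cpx) : cderivable f z -> Ccont f z.
Proof.
  intros [l H]. destruct (has_cderiv_lip f z l H) as [d [Hd H1]].
  intros eps He. pose proof (Cnorm_ge0 l) as Hl.
  exists (Rmin d (eps / (Cnorm l + 1))). split.
  { apply Rmin_glb_lt; auto. apply Rdiv_lt_0_compat; lra. }
  intros w Hw. min_bounds d (eps / (Cnorm l + 1)).
  apply Rle_lt_trans with ((Cnorm l + 1) * Cnorm (w - z)); [apply H1; lra|].
  apply Rlt_le_trans with ((Cnorm l + 1) * (eps / (Cnorm l + 1))).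
  - apply Rmult_lt_compat_l; lra.
  - right; field; lra.
Qed.

Lemma Ccont_const (c z : Cpx) : Ccont (fun _ => c) z.
Proof.
  intros eps He. exists 1; split; [lra|]. intros.
  rewrite Cnorm_sub_diag; lra.
Qed.

Lemma Ccont_id (z : Cpx) : Ccont (fun w => w) z.
Proof. intros eps He. exists eps; auto. Qed.

Lemma Ccont_add (f g : Cpx -> Cpx) (z : Cpx) :
  Ccont f z -> Ccont g z -> Ccont (fun w => f w + g w)%cpx z.
Proof.
  intros Hf Hg eps He.
  destruct (Hf (eps / 2)) as [d1 [Hd1 H1]]; [lra|].
  destruct (Hg (eps / 2)) as [d2 [Hd2 H2]]; [lra|].
  exists (Rmin d1 d2); split; [apply Rmin_glb_lt; auto|]. intros w Hw.
  min_bounds d1 d2.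
  specialize (H1 w ltac:(lra)). specialize (H2 w ltac:(lra)).
  replace (f w + g w - (f z + g z))%cpx with ((f w - f z) + (g w - g z))%cpx by ring.
  eapply Rle_lt_trans; [apply Cnorm_add|]. lra.
Qed.

Lemma Ccont_mul (f g : Cpx -> Cpx) (z : Cpx) :
  Ccont f z -> Ccont g z -> Ccont (fun w => f w * g w)%cpx z.
Proof.
  intros Hf Hg eps He.
  pose proof (Cnorm_ge0 (f z)) as Hf0. pose proof (Cnorm_ge0 (g z)) as Hg0.
  set (K := Cnorm (f z) + Cnorm (g z) + 1).
  assert (HK : 0 < eps / (2 * K)) by (apply Rdiv_lt_0_compat; unfold K; lra).
  destruct (Hf _ HK) as [d1 [Hd1 H1]].
  destruct (Hg _ HK) as [d2 [Hd2 H2]].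
  destruct (Hg 1 Rlt_0_1) as [d3 [Hd3 H3]].
  exists (Rmin d1 (Rmin d2 d3)); split; [apply Rmin3_gt0; auto|]. intros w Hw.
  apply Rmin3_lt in Hw. destruct Hw as [Hw1 [Hw3 Hw4]].
  specialize (H1 w Hw1). specialize (H2 w Hw3). specialize (H3 w Hw4).
  replace (f w * g w - f z * g z)%cpx with
    ((f w - f z) * (g w - g z) + (f w - f z) * g z + f z * (g w - g z))%cpx by ring.
  eapply Rle_lt_trans; [apply Cnorm_add|].
  eapply Rle_lt_trans; [apply Rplus_le_compat_r, Cnorm_add|].
  rewrite !Cnorm_mul.
  set (e := eps / (2 * K)) in *.
  assert (He2 : eps = 2 * K * e) by (unfold e; field; unfold K; lra).
  pose proof (Cnorm_ge0 (f w - f z)). pose proof (Cnorm_ge0 (g w - g z)).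
  assert (Cnorm (f w - f z) * Cnorm (g w - g z) <= e * 1) by (apply Rmult_le_compat; lra).
  assert (Cnorm (f w - f z) * Cnorm (g z) <= e * Cnorm (g z)) by (apply Rmult_le_compat_r; lra).
  assert (Cnorm (f z) * Cnorm (g w - g z) <= Cnorm (f z) * e) by (apply Rmult_le_compat_l; lra).
  assert (K * e > 0) by (apply Rmult_lt_0_compat; unfold K; lra).
  unfold K in *. lra.
Qed.

Lemma Ccont_opp (f : Cpx -> Cpx) (z : Cpx) : Ccont f z -> Ccont (fun w => - f w)%cpx z.
Proof.
  intros Hf eps He. destruct (Hf eps He) as [d [Hd H]]. exists d; split; auto.
  intros w Hw. replace (- f w - - f z)%cpx with (- (f w - f z))%cpx by ring.
  rewrite Cnorm_opp; auto.
Qed.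

Lemma Ccont_sub (f g : Cpx -> Cpx) (z : Cpx) :
  Ccont f z -> Ccont g z -> Ccont (fun w => f w - g w)%cpx z.
Proof. intros. apply Ccont_add; auto. apply Ccont_opp; auto. Qed.

Lemma Ccont_local (f g : Cpx -> Cpx) (z : Cpx) (d : R) : 0 < d ->
  (forall w, Cnorm (w - z) < d -> f w = g w) -> Ccont f z -> Ccont g z.
Proof.
  intros Hd E Hf eps He. destruct (Hf eps He) as [d1 [Hd1 H]].
  exists (Rmin d d1); split; [apply Rmin_glb_lt; auto|]. intros w Hw.
  min_bounds d d1.
  rewrite <- !E; [apply H; lra| |lra].
  rewrite Cnorm_sub_diag; auto.
Qed.

Lemma has_cderiv_inv (z : Cpx) : z <> C0 -> has_cderiv Cinv z (- Cinv (z * z))%cpx.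
Proof.
  intros Hz. apply cderiv_atI. intros eps He.
  pose proof (Cnorm_gt0 z Hz) as Hn. set (r := Cnorm z) in *.
  assert (Hr3 : 0 < eps * (r * r * r) / 2).
  { assert (0 < r * r * r) by (repeat apply Rmult_lt_0_compat; auto).
    assert (0 < eps * (r * r * r)) by (apply Rmult_lt_0_compat; auto). lra. }
  exists (Rmin (r / 2) (eps * (r * r * r) / 2)). split.
  { apply Rmin_glb_lt; lra. }
  intros w Hw. min_bounds (r / 2) (eps * (r * r * r) / 2).
  assert (Hw2 : r / 2 < Cnorm w).
  { pose proof (Cnorm_sub_ge z w) as H1. rewrite Cnorm_sub_sym in H1. fold r in H1. lra. }
  assert (Hw0 : w <> C0) by (apply Cnorm_gt0_neq; lra).
  replace (Cinv w - Cinv z - - Cinv (z * z) * (w - z))%cpx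
    with ((w - z) * ((w - z) * Cinv (z * z * w)))%cpx by (field; auto).
  rewrite Cnorm_mul, Rmult_comm. apply Rmult_le_compat_r; [apply Cnorm_ge0|].
  rewrite Cnorm_mul, Cnorm_inv, !Cnorm_mul by (repeat apply Cmul_neq0; auto). fold r.
  assert (Hp : 0 < r * r * (r / 2)) by (repeat apply Rmult_lt_0_compat; lra).
  apply Rle_trans with (Cnorm (w - z) * / (r * r * (r / 2))).
  - apply Rmult_le_compat_l; [apply Cnorm_ge0|]. apply Rinv_le_contravar; auto.
    apply Rmult_le_compat_l; [|lra]. assert (0 < r * r) by (apply Rmult_lt_0_compat; auto). lra.
  - apply Rle_trans with (eps * (r * r * r) / 2 * / (r * r * (r / 2))).
    + apply Rmult_le_compat_r; [|lra]. left; apply Rinv_0_lt_compat; auto.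
    + right; field; lra.
Qed.

Lemma has_cderiv_comp (f g : Cpx -> Cpx) (z l m : Cpx) :
  has_cderiv g z m -> has_cderiv f (g z) l -> has_cderiv (fun w => f (g w)) z (l * m)%cpx.
Proof.
  intros Hg Hf. destruct (has_cderiv_lip g z m Hg) as [d0 [Hd0 H0]].
  assert (Cg : Ccont g z) by (apply cderivable_cont; exists m; auto).
  apply cderiv_atE in Hg. apply cderiv_atE in Hf.
  apply cderiv_atI. intros eps He.
  pose proof (Cnorm_ge0 m) as Hm. pose proof (Cnorm_ge0 l) as Hl.
  assert (He1 : 0 < eps / (2 * (Cnorm m + 1))) by (apply Rdiv_lt_0_compat; lra).
  assert (He2 : 0 < eps / (2 * (Cnorm l + 1))) by (apply Rdiv_lt_0_compat; lra).
  destruct (Hf _ He1) as [d1 [Hd1 H1]]. destruct (Hg _ He2) as [d2 [Hd2 H2]].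
  destruct (Cg d1 Hd1) as [d3 [Hd3 H3]].
  exists (Rmin d0 (Rmin d2 d3)); split; [apply Rmin3_gt0; auto|]. intros w Hw.
  apply Rmin3_lt in Hw. destruct Hw as [Hw1 [Hw3 Hw4]].
  specialize (H0 w Hw1). specialize (H2 w Hw3). specialize (H1 (g w) (H3 w Hw4)).
  replace (f (g w) - f (g z) - l * m * (w - z))%cpx with
    ((f (g w) - f (g z) - l * (g w - g z)) + l * (g w - g z - m * (w - z)))%cpx by ring.
  eapply Rle_trans; [apply Cnorm_add|]. rewrite Cnorm_mul.
  set (N := Cnorm (w - z)) in *. assert (0 <= N) by apply Cnorm_ge0.
  apply Rle_trans with (eps / (2 * (Cnorm m + 1)) * ((Cnorm m + 1) * N) +
     (Cnorm l + 1) * (eps / (2 * (Cnorm l + 1)) * N)).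
  - apply Rplus_le_compat.
    + eapply Rle_trans; [exact H1|]. apply Rmult_le_compat_l; lra.
    + apply Rmult_le_compat; try apply Cnorm_ge0; lra.
  - right; field; lra.
Qed.

Lemma has_cderiv_const (c z : Cpx) : has_cderiv (fun _ => c) z C0.
Proof.
  apply cderiv_atI. intros eps He. exists 1; split; [lra|]. intros w _.
  replace (c - c - C0 * (w - z))%cpx with C0 by ring. rewrite Cnorm_C0.
  apply Rmult_le_pos; [lra|apply Cnorm_ge0].
Qed.

Lemma has_cderiv_id (z : Cpx) : has_cderiv (fun w => w) z C1.
Proof.
  apply cderiv_atI. intros eps He. exists 1; split; [lra|]. intros w _.
  replace (w - z - C1 * (w - z))%cpx with C0 by ring. rewrite Cnorm_C0.
  apply Rmult_le_pos; [lra|apply Cnorm_ge0].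
Qed.

Lemma has_cderiv_add (f g : Cpx -> Cpx) (z l m : Cpx) :
  has_cderiv f z l -> has_cderiv g z m -> has_cderiv (fun w => f w + g w)%cpx z (l + m)%cpx.
Proof.
  intros Hf Hg. apply cderiv_atE in Hg. apply cderiv_atE in Hf.
  apply cderiv_atI. intros eps He.
  destruct (Hf (eps / 2)) as [d1 [Hd1 H1]]; [lra|].
  destruct (Hg (eps / 2)) as [d2 [Hd2 H2]]; [lra|].
  exists (Rmin d1 d2); split; [apply Rmin_glb_lt; auto|]. intros w Hw.
  min_bounds d1 d2.
  specialize (H1 w ltac:(lra)). specialize (H2 w ltac:(lra)).
  replace (f w + g w - (f z + g z) - (l + m) * (w - z))%cpx with
    ((f w - f z - l * (w - z)) + (g w - g z - m * (w - z)))%cpx by ring.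
  eapply Rle_trans; [apply Cnorm_add|]. lra.
Qed.

Lemma has_cderiv_mul (f g : Cpx -> Cpx) (z l m : Cpx) :
  has_cderiv f z l -> has_cderiv g z m ->
  has_cderiv (fun w => f w * g w)%cpx z (l * g z + f z * m)%cpx.
Proof.
  intros Hf Hg. assert (Cf : Ccont f z) by (apply cderivable_cont; exists l; auto).
  apply cderiv_atE in Hg. apply cderiv_atE in Hf.
  apply cderiv_atI. intros eps He.
  pose proof (Cnorm_ge0 m) as Hm. pose proof (Cnorm_ge0 (f z)) as Hfz. pose proof (Cnorm_ge0 (g z)) as Hgz.
  set (K := Cnorm m + Cnorm (f z) + Cnorm (g z) + 1).
  assert (He1 : 0 < eps / (4 * K)) by (apply Rdiv_lt_0_compat; unfold K; lra).
  destruct (Hf _ He1) as [d1 [Hd1 H1]]. destruct (Hg _ He1) as [d2 [Hd2 H2]].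
  assert (He3 : 0 < Rmin 1 (eps / (4 * K))) by (apply Rmin_glb_lt; lra).
  destruct (Cf _ He3) as [d3 [Hd3 H3]].
  exists (Rmin d1 (Rmin d2 d3)); split; [apply Rmin3_gt0; auto|]. intros w Hw.
  apply Rmin3_lt in Hw. destruct Hw as [Hw1 [Hw3 Hw4]].
  specialize (H1 w Hw1). specialize (H2 w Hw3). specialize (H3 w Hw4).
  min_bounds 1 (eps / (4 * K)).
  replace (f w * g w - f z * g z - (l * g z + f z * m) * (w - z))%cpx with
    ((f w - f z - l * (w - z)) * g z + f z * (g w - g z - m * (w - z)) +
     ((f w - f z) * (g w - g z - m * (w - z)) + (f w - f z) * m * (w - z)))%cpx by ring.
  eapply Rle_trans; [apply Cnorm_add|].
  eapply Rle_trans; [apply Rplus_le_compat; apply Cnorm_add|].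
  rewrite !Cnorm_mul. set (N := Cnorm (w - z)) in *. assert (HN : 0 <= N) by apply Cnorm_ge0.
  set (e := eps / (4 * K)) in *.
  assert (He2 : eps = 4 * K * e) by (unfold e; field; unfold K; lra).
  set (X := Cnorm (f w - f z)) in *. assert (HX : 0 <= X) by apply Cnorm_ge0.
  set (Y := Cnorm (g w - g z - m * (w - z))) in *. assert (HY : 0 <= Y) by apply Cnorm_ge0.
  assert (HeN : 0 <= e * N) by (apply Rmult_le_pos; lra).
  assert (B1 : Cnorm (f w - f z - l * (w - z)) * Cnorm (g z) <= (e * N) * K)
    by (apply Rmult_le_compat; try apply Cnorm_ge0; unfold K; lra).
  assert (B2 : Cnorm (f z) * Y <= K * (e * N)) by (apply Rmult_le_compat; unfold K; lra).
  assert (B3 : X * Y <= K * (e * N)) by (apply Rmult_le_compat; unfold K; lra).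
  assert (B4 : X * Cnorm m <= e * K) by (apply Rmult_le_compat; unfold K; lra).
  apply (Rmult_le_compat_r N) in B4; auto.
  rewrite He2. lra.
Qed.

Lemma cderivable_add (f g : Cpx -> Cpx) (z : Cpx) :
  cderivable f z -> cderivable g z -> cderivable (fun w => f w + g w)%cpx z.
Proof. intros [l Hl] [m Hm]. exists (l + m)%cpx. apply has_cderiv_add; auto. Qed.

Lemma cderivable_mul (f g : Cpx -> Cpx) (z : Cpx) :
  cderivable f z -> cderivable g z -> cderivable (fun w => f w * g w)%cpx z.
Proof. intros [l Hl] [m Hm]. eexists. apply has_cderiv_mul; eauto. Qed.

Lemma cderivable_const (c z : Cpx) : cderivable (fun _ => c) z.
Proof. eexists; apply has_cderiv_const. Qed.

Lemma cderivable_id (z : Cpx) : cderivable (fun w => w) z.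
Proof. eexists; apply has_cderiv_id. Qed.

Lemma cderivable_local (f g : Cpx -> Cpx) (z : Cpx) (d : R) : 0 < d ->
  (forall w, Cnorm (w - z) < d -> f w = g w) -> cderivable f z -> cderivable g z.
Proof.
  intros Hd E [l Hf]. exists l. apply cderiv_atE in Hf. apply cderiv_atI.
  intros eps He. destruct (Hf eps He) as [d1 [Hd1 H]].
  exists (Rmin d d1); split; [apply Rmin_glb_lt; auto|]. intros w Hw.
  min_bounds d d1.
  rewrite <- (E w), <- (E z); [apply H; lra| |lra].
  rewrite Cnorm_sub_diag; auto.
Qed.

Lemma cderivable_opp (f : Cpx -> Cpx) (z : Cpx) :
  cderivable f z -> cderivable (fun w => - f w)%cpx z.
Proof.
  intros Hf. apply (cderivable_local (fun w => (- C1) * f w)%cpx _ z 1); [lra|intros; ring|].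
  apply cderivable_mul; auto. apply cderivable_const.
Qed.

Lemma cderivable_sub (f g : Cpx -> Cpx) (z : Cpx) :
  cderivable f z -> cderivable g z -> cderivable (fun w => f w - g w)%cpx z.
Proof. intros. apply cderivable_add; auto. apply cderivable_opp; auto. Qed.

Lemma cderivable_inv (f : Cpx -> Cpx) (z : Cpx) :
  cderivable f z -> f z <> C0 -> cderivable (fun w => Cinv (f w)) z.
Proof. intros [l Hl] H0. eexists. eapply has_cderiv_comp; [exact Hl|]. apply has_cderiv_inv; auto. Qed.

Lemma cderivable_div (f g : Cpx -> Cpx) (z : Cpx) :
  cderivable f z -> cderivable g z -> g z <> C0 -> cderivable (fun w => f w / g w)%cpx z.
Proof. intros. apply cderivable_mul; auto. apply cderivable_inv; auto. Qed.

Lemma Ccont_comp (f g : Cpx -> Cpx) (z : Cpx) :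
  Ccont g z -> Ccont f (g z) -> Ccont (fun w => f (g w)) z.
Proof.
  intros Hg Hf eps He. destruct (Hf eps He) as [d [Hd H]].
  destruct (Hg d Hd) as [d1 [Hd1 H1]]. exists d1; split; auto.
Qed.

Lemma Ccont_div (f g : Cpx -> Cpx) (z : Cpx) :
  Ccont f z -> Ccont g z -> g z <> C0 -> Ccont (fun w => f w / g w)%cpx z.
Proof.
  intros. apply Ccont_mul; auto. apply (Ccont_comp Cinv); auto.
  apply cderivable_cont. eexists; apply has_cderiv_inv; auto.
Qed.

(** Serves both the nested rectangles of the bisection and the increasing radii behind the set [Om]:
    [Step] relates consecutive terms, and [Inv] keeps the next choice possible. *)
Lemma dependent_choice {T : Type} (Inv : nat -> T -> Prop) (Step : nat -> T -> T -> Prop) (a0 : T) :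
  Inv O a0 -> (forall n a, Inv n a -> exists a', Step n a a' /\ Inv (S n) a') ->
  exists s : nat -> T, s O = a0 /\ forall n, Inv n (s n) /\ Step n (s n) (s (S n)).
Proof.
  intros H0 HS.
  set (next := fun n a => epsilon (inhabits a0) (fun a' => Step n a a' /\ Inv (S n) a')).
  set (s := fix s n := match n with O => a0 | S k => next k (s k) end).
  exists s. split; auto.
  assert (HI : forall n, Inv n (s n)).
  { induction n; simpl; auto. apply (epsilon_spec (inhabits a0) (fun a' => Step n (s n) a' /\ Inv (S n) a')). apply HS, IHn. }
  intros n; split; auto. simpl. apply (epsilon_spec (inhabits a0) (fun a' => Step n (s n) a' /\ Inv (S n) a')). apply HS, HI.
Qed.

(** * Goursat's lemma *)

(** The left ends increase and the right ends decrease, so the supremum of the left ends lies in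
    every interval. *)
Lemma nested_halving_point (x : nat -> R) (w : R) : 0 <= w ->
  (forall n, x n <= x (S n) <= x n + w / 2 ^ S n) ->
  exists p, forall n, x n <= p <= x n + w / 2 ^ n.
Proof.
  intros Hw H.
  assert (H2 : forall n, w / 2 ^ S n + w / 2 ^ S n = w / 2 ^ n).
  { intros n. simpl. field. apply pow_nonzero; lra. }
  assert (Hinc : forall n k, x n <= x (n + k)%nat).
  { intros n; induction k; [rewrite Nat.add_0_r; lra|].
    rewrite Nat.add_succ_r. specialize (H (n + k)%nat). lra. }
  assert (Hdec : forall n k, x (n + k)%nat + w / 2 ^ (n + k) <= x n + w / 2 ^ n).
  { intros n; induction k; [rewrite Nat.add_0_r; lra|].
    rewrite Nat.add_succ_r. specialize (H (n + k)%nat). specialize (H2 (n + k)%nat). lra. }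
  assert (Hpos : forall n, 0 <= w / 2 ^ n).
  { intros n. apply Rmult_le_pos; auto. left. apply Rinv_0_lt_compat, pow_lt; lra. }
  assert (Hmn : forall m n, x m <= x n + w / 2 ^ n).
  { intros m n. destruct (Nat.le_ge_cases m n) as [L|L].
    - specialize (Hinc m (n - m)%nat). replace (m + (n - m))%nat with n in Hinc by lia.
      specialize (Hpos n). lra.
    - specialize (Hdec n (m - n)%nat). replace (n + (m - n))%nat with m in Hdec by lia.
      specialize (Hpos m). lra. }
  destruct (completeness (fun y => exists n, y = x n)) as [p [Hp1 Hp2]].
  - exists (x O + w / 2 ^ O). intros y [n ->]. apply Hmn.
  - exists (x O), O; auto.
  - exists p. intros n; split.
    + apply Hp1; exists n; auto.
    + apply Hp2. intros y [m ->]. apply Hmn.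
Qed.

Lemma RInt_near_const (f : R -> R) (a b c m : R) : a <= b -> ex_RInt f a b ->
  (forall x, a <= x <= b -> Rabs (f x - c) <= m) ->
  Rabs (RInt f a b - c * (b - a)) <= m * (b - a).
Proof.
  intros Hab Hex H.
  assert (E1 : RInt (fun _ => c - m) a b = (b - a) * (c - m)) by (rewrite RInt_const; reflexivity).
  assert (E2 : RInt (fun _ => c + m) a b = (b - a) * (c + m)) by (rewrite RInt_const; reflexivity).
  assert (B1 : RInt (fun _ => c - m) a b <= RInt f a b).
  { apply RInt_le; auto. apply ex_RInt_const. intros x Hx.
    specialize (H x ltac:(lra)). apply Rabs_le_between in H. lra. }
  assert (B2 : RInt f a b <= RInt (fun _ => c + m) a b).
  { apply RInt_le; auto. apply ex_RInt_const. intros x Hx.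
    specialize (H x ltac:(lra)). apply Rabs_le_between in H. lra. }
  rewrite E1 in B1. rewrite E2 in B2. apply Rabs_le_between. lra.
Qed.

Definition diff2 (f : R -> R -> R) (x0 y0 a b : R) : Prop :=
  forall eps, 0 < eps -> exists d, 0 < d /\
    forall x y, Rabs (x - x0) < d -> Rabs (y - y0) < d ->
      Rabs (f x y - f x0 y0 - a * (x - x0) - b * (y - y0)) <= eps * (Rabs (x - x0) + Rabs (y - y0)).

(* The counterclockwise integral of [P dx + Q dy] around [a, b] x [c, d]. *)
Definition circulation (P Q : R -> R -> R) (a b c d : R) : R :=
  (RInt (fun x => P x c) a b - RInt (fun x => P x d) a b)
  + (RInt (fun y => Q b y) c d - RInt (fun y => Q a y) c d).

Lemma ex_RInt_cont (f : R -> R) (a b : R) : (forall x, continuous f x) -> ex_RInt f a b.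
Proof. intros H. apply (ex_RInt_continuous (V := R_CompleteNormedModule)). auto. Qed.

Lemma circulation_quarter (P Q : R -> R -> R) (a m b c k d : R) :
  (forall x y, continuous (fun x => P x y) x) ->
  (forall x y, continuous (fun y => Q x y) y) ->
  circulation P Q a b c d =
    circulation P Q a m c k + circulation P Q m b c k
    + (circulation P Q a m k d + circulation P Q m b k d).
Proof.
  intros HP HQ. unfold circulation.
  assert (EP : forall y, RInt (fun x => P x y) a b
    = RInt (fun x => P x y) a m + RInt (fun x => P x y) m b).
  { intros y. symmetry. apply (RInt_Chasles (V := R_CompleteNormedModule));
      apply ex_RInt_cont; intros; apply HP. }
  assert (EQ : forall x, RInt (fun y => Q x y) c d
    = RInt (fun y => Q x y) c k + RInt (fun y => Q x y) k d).
  { intros x. symmetry. apply (RInt_Chasles (V := R_CompleteNormedModule));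
      apply ex_RInt_cont; intros; apply HQ. }
  rewrite !EP, !EQ. ring.
Qed.

(** The shared coefficient [be] is the closedness of [P dx + Q dy] at the point: the linear parts
    contribute [- be * k * h] and [be * h * k], which cancel. What remains is the error
    [eps * (h + k)] on each pair of opposite sides, times their length. *)
Lemma circulation_local (P Q : R -> R -> R) (p q al be ga : R) :
  (forall x y, continuous (fun x => P x y) x) ->
  (forall x y, continuous (fun y => Q x y) y) ->
  diff2 P p q al be -> diff2 Q p q be ga ->
  forall eps, 0 < eps -> exists dl, 0 < dl /\ forall x y h k,
    0 <= h < dl -> 0 <= k < dl -> x <= p <= x + h -> y <= q <= y + k ->
    Rabs (circulation P Q x (x + h) y (y + k)) <= eps * (h + k) ^ 2.
Proof.
  intros HP HQ DP DQ eps He.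
  destruct (DP (eps / 2) ltac:(lra)) as [d1 [Hd1 H1]].
  destruct (DQ (eps / 2) ltac:(lra)) as [d2 [Hd2 H2]].
  exists (Rmin d1 d2); split; [apply Rmin_glb_lt; auto|].
  intros x y h k Hh Hk Hx Hy. min_bounds d1 d2.
  assert (Near : forall (f : R -> R -> R) a b d, h < d -> k < d ->
    (forall u v, Rabs (u - p) < d -> Rabs (v - q) < d ->
      Rabs (f u v - f p q - a * (u - p) - b * (v - q)) <= eps / 2 * (Rabs (u - p) + Rabs (v - q))) ->
    forall u v, x <= u <= x + h -> y <= v <= y + k ->
      - (eps / 2 * (h + k)) <= f u v - f p q - a * (u - p) - b * (v - q) <= eps / 2 * (h + k)).
  { intros f a b d Hhd Hkd Hf u v Hu Hv. apply Rabs_le_between.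
    assert (Rabs (u - p) <= h) by (apply Rabs_le_between; lra).
    assert (Rabs (v - q) <= k) by (apply Rabs_le_between; lra).
    eapply Rle_trans; [apply Hf; lra|]. apply Rmult_le_compat_l; lra. }
  assert (BP : Rabs (RInt (fun u => P u y - P u (y + k)) x (x + h) - (- be * k) * (x + h - x))
     <= (eps * (h + k)) * (x + h - x)).
  { apply RInt_near_const; [lra| |].
    - apply ex_RInt_cont. intros u. apply (continuous_minus (V := R_NormedModule)); apply HP.
    - intros u Hu. apply Rabs_le_between.
      pose proof (Near P al be d1 ltac:(lra) ltac:(lra) H1 u y Hu ltac:(lra)).
      pose proof (Near P al be d1 ltac:(lra) ltac:(lra) H1 u (y + k) Hu ltac:(lra)). lra. }
  assert (BQ : Rabs (RInt (fun v => Q (x + h) v - Q x v) y (y + k) - (be * h) * (y + k - y))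
     <= (eps * (h + k)) * (y + k - y)).
  { apply RInt_near_const; [lra| |].
    - apply ex_RInt_cont. intros u. apply (continuous_minus (V := R_NormedModule)); apply HQ.
    - intros v Hv. apply Rabs_le_between.
      pose proof (Near Q be ga d2 ltac:(lra) ltac:(lra) H2 (x + h) v ltac:(lra) Hv).
      pose proof (Near Q be ga d2 ltac:(lra) ltac:(lra) H2 x v ltac:(lra) Hv). lra. }
  unfold circulation.
  assert (EP : RInt (fun u => P u y - P u (y + k)) x (x + h) =
     RInt (fun u => P u y) x (x + h) - RInt (fun u => P u (y + k)) x (x + h)).
  { apply (RInt_minus (V := R_CompleteNormedModule)); apply ex_RInt_cont; intros; apply HP. }
  assert (EQ : RInt (fun v => Q (x + h) v - Q x v) y (y + k) =
     RInt (fun v => Q (x + h) v) y (y + k) - RInt (fun v => Q x v) y (y + k)).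
  { apply (RInt_minus (V := R_CompleteNormedModule)); apply ex_RInt_cont; intros; apply HQ. }
  rewrite <- EP, <- EQ.
  apply Rabs_le_between. apply Rabs_le_between in BP. apply Rabs_le_between in BQ. lra.
Qed.

Lemma pow4_eq (n : nat) : 4 ^ n = 2 ^ n * 2 ^ n.
Proof. rewrite <- Rpow_mult_distr. f_equal; ring. Qed.

(* Goursat's bisection: only pointwise differentiability is assumed. *)
Lemma circulation_eq0 (P Q : R -> R -> R) (a b c d : R) : a < b -> c < d ->
  (forall x y, continuous (fun x => P x y) x) ->
  (forall x y, continuous (fun y => Q x y) y) ->
  (forall x y, a <= x <= b -> c <= y <= d ->
    exists al be ga, diff2 P x y al be /\ diff2 Q x y be ga) ->
  circulation P Q a b c d = 0.
Proof.
  intros Hab Hcd HP HQ HD.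
  destruct (Req_dec (circulation P Q a b c d) 0) as [E|NE]; auto. exfalso.
  set (eta := Rabs (circulation P Q a b c d)).
  assert (Heta : 0 < eta) by (apply Rabs_pos_lt; auto).
  set (w := b - a). set (v := d - c).
  assert (H2n : forall n, 0 < 2 ^ n) by (intros; apply pow_lt; lra).
  destruct (dependent_choice
    (fun n (z : R * R) => a <= fst z /\ fst z + w / 2 ^ n <= b /\ c <= snd z /\ snd z + v / 2 ^ n <= d /\
       eta / 4 ^ n <= Rabs (circulation P Q (fst z) (fst z + w / 2 ^ n) (snd z) (snd z + v / 2 ^ n)))
    (fun n z z' => fst z <= fst z' <= fst z + w / 2 ^ S n /\ snd z <= snd z' <= snd z + v / 2 ^ S n)
    (a, c)) as [s [Hs0 Hs]].
  - simpl. replace (a + w / 1) with b by (unfold w; field). replace (c + v / 1) with d by (unfold v; field).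
    fold eta. repeat split; lra.
  - intros n [x y]; simpl fst; simpl snd. intros [I1 [I2 [I3 [I4 I5]]]].
    set (h := w / 2 ^ S n). set (k := v / 2 ^ S n).
    assert (Hh : 0 < h) by (apply Rdiv_lt_0_compat; [unfold w; lra|apply H2n]).
    assert (Hk : 0 < k) by (apply Rdiv_lt_0_compat; [unfold v; lra|apply H2n]).
    assert (Eh : w / 2 ^ n = h + h) by (unfold h; simpl; field; specialize (H2n n); lra).
    assert (Ek : v / 2 ^ n = k + k) by (unfold k; simpl; field; specialize (H2n n); lra).
    assert (Ee : eta / 4 ^ n = 4 * (eta / 4 ^ S n)) by (simpl; field; apply pow_nonzero; lra).
    rewrite Eh, Ek in *. rewrite Ee in I5. set (e := eta / 4 ^ S n) in *.
    rewrite (circulation_quarter P Q x (x + h) _ y (y + k)) in I5 by auto.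
    replace (x + (h + h)) with (x + h + h) in * by ring.
    replace (y + (k + k)) with (y + k + k) in * by ring.
    destruct (Rle_lt_dec e (Rabs (circulation P Q x (x + h) y (y + k)))) as [G|G1].
    { exists (x, y); simpl fst; simpl snd; repeat split; auto; lra. }
    destruct (Rle_lt_dec e (Rabs (circulation P Q (x + h) (x + h + h) y (y + k)))) as [G|G2].
    { exists (x + h, y); simpl fst; simpl snd; repeat split; auto; lra. }
    destruct (Rle_lt_dec e (Rabs (circulation P Q x (x + h) (y + k) (y + k + k)))) as [G|G3].
    { exists (x, y + k); simpl fst; simpl snd; repeat split; auto; lra. }
    destruct (Rle_lt_dec e (Rabs (circulation P Q (x + h) (x + h + h) (y + k) (y + k + k)))) as [G|G4].
    { exists (x + h, y + k); simpl fst; simpl snd; repeat split; auto; lra. }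
    exfalso. apply (Rle_not_lt _ _ I5).
    eapply Rle_lt_trans; [apply Rabs_triang|].
    eapply Rle_lt_trans; [apply Rplus_le_compat; apply Rabs_triang|]. lra.
  - destruct (nested_halving_point (fun n => fst (s n)) w) as [p Hp]; [unfold w; lra|apply Hs|].
    destruct (nested_halving_point (fun n => snd (s n)) v) as [q Hq]; [unfold v; lra|apply Hs|].
    destruct (HD p q) as [al [be [ga [DP DQ]]]].
    { specialize (Hp O). destruct (Hs O) as [[? [? _]] _]. lra. }
    { specialize (Hq O). destruct (Hs O) as [[_ [_ [? [? _]]]] _]. lra. }
    assert (Hwv : 0 < (w + v) ^ 2) by (apply pow_lt; unfold w, v; lra).
    (* This tolerance turns the local estimate into [eta / 4 ^ n / 2], half of the lower bound that
       the bisection keeps. *)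
    destruct (circulation_local P Q p q al be ga HP HQ DP DQ (eta / (2 * (w + v) ^ 2))) as [dl [Hdl Hloc]].
    { apply Rdiv_lt_0_compat; lra. }
    destruct (pow_lt_1_zero (/ 2) ltac:(rewrite Rabs_pos_eq; lra) (dl / (w + v))) as [n Hn].
    { apply Rdiv_lt_0_compat; unfold w, v; lra. }
    specialize (Hn n ltac:(lia)). specialize (Hp n). specialize (Hq n).
    rewrite Rabs_pos_eq in Hn by (apply pow_le; lra).
    rewrite pow_inv in Hn by lra.
    specialize (H2n n).
    assert (Hi : 0 < / 2 ^ n) by (apply Rinv_0_lt_compat; auto).
    assert (Hb : (w + v) * / 2 ^ n < dl).
    { apply Rlt_le_trans with ((w + v) * (dl / (w + v))); [apply Rmult_lt_compat_l; unfold w, v in *; lra|].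
      right; field; unfold w, v; lra. }
    assert (0 < w * / 2 ^ n) by (apply Rmult_lt_0_compat; unfold w; lra).
    assert (0 < v * / 2 ^ n) by (apply Rmult_lt_0_compat; unfold v; lra).
    specialize (Hloc (fst (s n)) (snd (s n)) (w / 2 ^ n) (v / 2 ^ n)
      ltac:(unfold Rdiv; lra) ltac:(unfold Rdiv; lra) Hp Hq).
    destruct (Hs n) as [[_ [_ [_ [_ I5]]]] _].
    pose proof (Rle_trans _ _ _ I5 Hloc) as F.
    replace (eta / (2 * (w + v) ^ 2) * (w / 2 ^ n + v / 2 ^ n) ^ 2) with (eta / 4 ^ n / 2) in F
      by (rewrite pow4_eq; field; unfold w, v; lra).
    assert (0 < eta / 4 ^ n) by (apply Rdiv_lt_0_compat; auto; apply pow_lt; lra). lra.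
Qed.

(** * Mean values over circles *)

Definition polar (r th : R) : Cpx := (r * cos th, r * sin th).
Definition cexp (w : Cpx) : Cpx := polar (exp (fst w)) (snd w).

Lemma Cnorm_polar (r th : R) : 0 <= r -> Cnorm (polar r th) = r.
Proof.
  intros Hr. unfold Cnorm, polar; simpl fst; simpl snd.
  replace ((r * cos th) ^ 2 + (r * sin th) ^ 2) with (r ^ 2 * (Rsqr (sin th) + Rsqr (cos th)))
    by (unfold Rsqr; ring).
  rewrite sin2_cos2, Rmult_1_r. apply sqrt_pow2; auto.
Qed.

Lemma derivable_pt_lim_eps (f : R -> R) (l : R) (eps : R) : 0 < eps -> derivable_pt_lim f 0 l ->
  exists d, 0 < d /\ forall h, Rabs h < d -> Rabs (f h - f 0 - l * h) <= eps * Rabs h.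
Proof.
  intros He H. destruct (H eps He) as [d Hd]. exists d; split; [apply cond_pos|].
  intros h Hh. destruct (Req_dec h 0) as [->|Hn].
  - rewrite Rabs_R0, !Rmult_0_r. replace (f 0 - f 0 - 0) with 0 by ring. rewrite Rabs_R0; lra.
  - specialize (Hd h Hn Hh). rewrite Rplus_0_l in Hd.
    replace (f h - f 0 - l * h) with (((f h - f 0) / h - l) * h) by (field; auto).
    rewrite Rabs_mult. apply Rmult_le_compat_r; [apply Rabs_pos|lra].
Qed.

Lemma cexp_add (z w : Cpx) : cexp (z + w) = (cexp z * cexp w)%cpx.
Proof.
  destruct z as [x y], w as [u v]. unfold cexp, polar; simpl.
  rewrite exp_plus, cos_plus, sin_plus. apply Cpx_ext; simpl; ring.
Qed.

Lemma has_cderiv_cexp0 : has_cderiv cexp C0 C1.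
Proof.
  intros eps He.
  (* The errors below add up to [9 * (e * N)], which 16 accommodates; the minimum with 1 keeps
     [exp x] below 3. *)
  destruct (derivable_pt_lim_eps exp 1 (Rmin 1 (eps / 16))) as [d1 [Hd1 H1]].
  { apply Rmin_glb_lt; lra. } { pose proof (derivable_pt_lim_exp 0). rewrite exp_0 in H. auto. }
  destruct (derivable_pt_lim_eps cos 0 (Rmin 1 (eps / 16))) as [d2 [Hd2 H2]].
  { apply Rmin_glb_lt; lra. } { pose proof (derivable_pt_lim_cos 0). rewrite sin_0, Ropp_0 in H. auto. }
  destruct (derivable_pt_lim_eps sin 1 (Rmin 1 (eps / 16))) as [d3 [Hd3 H3]].
  { apply Rmin_glb_lt; lra. } { pose proof (derivable_pt_lim_sin 0). rewrite cos_0 in H. auto. }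
  assert (He2 : 0 < Rmin 1 (eps / 16)) by (apply Rmin_glb_lt; lra).
  exists (Rmin (Rmin d1 (Rmin d2 d3)) (Rmin 1 (eps / 16))).
  split; [apply Rmin_glb_lt; auto; apply Rmin3_gt0; auto|].
  intros [x y] Hh. set (N := Cnorm (x, y)) in *.
  pose proof (Cnorm_fst (x, y)) as Hx. pose proof (Cnorm_snd (x, y)) as Hy. simpl in Hx, Hy. fold N in Hx, Hy.
  min_bounds (Rmin d1 (Rmin d2 d3)) (Rmin 1 (eps / 16)).
  min_bounds d1 (Rmin d2 d3).
  min_bounds d2 d3.
  min_bounds 1 (eps / 16).
  set (e := Rmin 1 (eps / 16)) in *.
  specialize (H1 x ltac:(lra)). specialize (H2 y ltac:(lra)). specialize (H3 y ltac:(lra)).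
  rewrite exp_0 in H1. rewrite cos_0 in H2. rewrite sin_0 in H3.
  assert (HN : 0 <= N) by apply Cnorm_ge0.
  assert (HeN : 0 <= e * N) by (apply Rmult_le_pos; lra).
  assert (G1 : Rabs (exp x - 1 - 1 * x) <= e * N) by (eapply Rle_trans; [exact H1|]; apply Rmult_le_compat_l; lra).
  assert (G2 : Rabs (cos y - 1 - 0 * y) <= e * N) by (eapply Rle_trans; [exact H2|]; apply Rmult_le_compat_l; lra).
  assert (G3 : Rabs (sin y - 0 - 1 * y) <= e * N) by (eapply Rle_trans; [exact H3|]; apply Rmult_le_compat_l; lra).
  assert (Hex : Rabs (exp x) <= 3).
  { replace (exp x) with ((exp x - 1 - 1 * x) + 1 + x) by ring.
    eapply Rle_trans; [apply Rabs_triang|].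
    eapply Rle_trans; [apply Rplus_le_compat_r, Rabs_triang|]. rewrite Rabs_R1.
    assert (e * N <= 1 * 1) by (apply Rmult_le_compat; lra). lra. }
  eapply Rle_trans; [apply Cnorm_le_abs|]. unfold cexp, polar, C0, C1; simpl.
  rewrite !Rplus_0_l, exp_0, cos_0, sin_0.
  replace (exp x * cos y + - (1 * 1) + - (1 * x - 0 * y)) with
    (exp x * (cos y - 1 - 0 * y) + (exp x - 1 - 1 * x)) by ring.
  replace (exp x * sin y + - (1 * 0) + - (1 * y + 0 * x)) with
    (exp x * (sin y - 0 - 1 * y) + ((exp x - 1 - 1 * x) + x) * y) by ring.
  assert (B1 : Rabs (exp x * (cos y - 1 - 0 * y)) <= 3 * (e * N))
    by (rewrite Rabs_mult; apply Rmult_le_compat; auto; apply Rabs_pos).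
  assert (B2 : Rabs (exp x * (sin y - 0 - 1 * y)) <= 3 * (e * N))
    by (rewrite Rabs_mult; apply Rmult_le_compat; auto; apply Rabs_pos).
  assert (B3 : Rabs ((exp x - 1 - 1 * x + x) * y) <= (2 * e) * N).
  { rewrite Rabs_mult; apply Rmult_le_compat; try apply Rabs_pos; auto.
    eapply Rle_trans; [apply Rabs_triang|].
    assert (e * N <= e * 1) by (apply Rmult_le_compat_l; lra). lra. }
  assert (B4 : Rabs (exp x * (cos y - 1 - 0 * y) + (exp x - 1 - 1 * x)) <= 4 * (e * N)).
  { eapply Rle_trans; [apply Rabs_triang|]. lra. }
  assert (B5 : Rabs (exp x * (sin y - 0 - 1 * y) + (exp x - 1 - 1 * x + x) * y) <= 5 * (e * N)).
  { eapply Rle_trans; [apply Rabs_triang|]. lra. }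
  assert (e * N <= eps / 16 * N) by (apply Rmult_le_compat_r; lra).
  assert (0 <= eps * N) by (apply Rmult_le_pos; lra). lra.
Qed.

Lemma has_cderiv_cexp (z : Cpx) : has_cderiv cexp z (cexp z).
Proof.
  pose proof has_cderiv_cexp0 as H. intros eps He.
  destruct (H (eps / (Cnorm (cexp z) + 1))) as [d [Hd H1]].
  { pose proof (Cnorm_ge0 (cexp z)). apply Rdiv_lt_0_compat; lra. }
  exists d; split; auto. intros h Hh. specialize (H1 h Hh).
  replace (C0 + h)%cpx with h in H1 by ring.
  assert (E0 : cexp C0 = C1) by (unfold cexp, polar; simpl; rewrite exp_0, cos_0, sin_0; apply Cpx_ext; simpl; ring).
  rewrite E0 in H1. rewrite cexp_add.
  replace (cexp z * cexp h - cexp z - cexp z * h)%cpx with (cexp z * (cexp h - C1 - C1 * h))%cpx by ring.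
  rewrite Cnorm_mul. pose proof (Cnorm_ge0 (cexp z)) as Hz. pose proof (Cnorm_ge0 h) as Hh0.
  apply Rle_trans with ((Cnorm (cexp z) + 1) * (eps / (Cnorm (cexp z) + 1) * Cnorm h)).
  - apply Rmult_le_compat; auto; try apply Cnorm_ge0; lra.
  - right; field; lra.
Qed.

(** The Cauchy-Riemann equations: multiplication by [l] is a real linear map with rows
    [(fst l, - snd l)] and [(snd l, fst l)]. *)
Lemma has_cderiv_diff2 (G : Cpx -> Cpx) (x y : R) (l : Cpx) : has_cderiv G (x, y) l ->
  diff2 (fun x y => fst (G (x, y))) x y (fst l) (- snd l) /\
  diff2 (fun x y => snd (G (x, y))) x y (snd l) (fst l).
Proof.
  intros H. apply cderiv_atE in H.
  assert (Main : forall eps, 0 < eps -> exists d, 0 < d /\ forall u v,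
     Rabs (u - x) < d -> Rabs (v - y) < d ->
     Cnorm (G (u, v) - G (x, y) - l * ((u, v) - (x, y))) <= eps * (Rabs (u - x) + Rabs (v - y))).
  { intros eps He. destruct (H eps He) as [d [Hd H1]]. exists (d / 2); split; [lra|].
    intros u v Hu Hv. pose proof (Cnorm_le_abs ((u, v) - (x, y))) as B. simpl in B.
    change (u + - x) with (u - x) in B. change (v + - y) with (v - y) in B.
    eapply Rle_trans; [apply H1; lra|]. apply Rmult_le_compat_l; lra. }
  split; intros eps He; destruct (Main eps He) as [d [Hd H1]]; exists d; split; auto;
    intros u v Hu Hv; specialize (H1 u v Hu Hv).
  - eapply Rle_trans; [|exact H1]. eapply Rle_trans; [|apply Cnorm_fst].
    right; f_equal; simpl; ring.
  - eapply Rle_trans; [|exact H1]. eapply Rle_trans; [|apply Cnorm_snd].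
    right; f_equal; simpl; ring.
Qed.

Lemma Rcontinuous_eps (f : R -> R) (x : R) :
  (forall eps, 0 < eps -> exists d, 0 < d /\ forall y, Rabs (y - x) < d -> Rabs (f y - f x) < eps) ->
  continuous f x.
Proof.
  intros H. apply continuity_pt_filterlim. intros eps He. destruct (H eps He) as [d [Hd H1]].
  exists d; split; auto. intros y [_ Hy]. apply H1, Hy.
Qed.

Definition path_cont (phi : R -> Cpx) : Prop :=
  (forall th, continuous (fun th => fst (phi th)) th) /\ (forall th, continuous (fun th => snd (phi th)) th).

Lemma path_cont_comp (F : Cpx -> Cpx) (g : R -> Cpx) :
  path_cont g -> (forall th, Ccont F (g th)) -> path_cont (fun th => F (g th)).
Proof.
  intros [G1 G2] HF.
  assert (Main : forall th eps, 0 < eps -> exists d, 0 < d /\ forall u, Rabs (u - th) < d ->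
    Cnorm (F (g u) - F (g th)) < eps).
  { intros th eps He. destruct (HF th eps He) as [d [Hd H]].
    pose proof (G1 th) as A1. pose proof (G2 th) as A2.
    apply continuity_pt_filterlim in A1. apply continuity_pt_filterlim in A2.
    destruct (A1 (d / 2)) as [e1 [He1 B1]]; [lra|]. destruct (A2 (d / 2)) as [e2 [He2 B2]]; [lra|].
    exists (Rmin e1 e2); split; [apply Rmin_glb_lt; auto|]. intros u Hu. apply H.
    destruct (Req_dec u th) as [->|Hn].
    { rewrite Cnorm_sub_diag; auto. }
    min_bounds e1 e2.
    specialize (B1 u). specialize (B2 u). simpl in B1, B2. unfold Rdist, D_x, no_cond in B1, B2.
    eapply Rle_lt_trans; [apply Cnorm_le_abs|]. simpl.
    assert (Rabs (fst (g u) - fst (g th)) < d / 2) by (apply B1; repeat split; auto; lra).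
    assert (Rabs (snd (g u) - snd (g th)) < d / 2) by (apply B2; repeat split; auto; lra).
    unfold Rminus in *. lra. }
  split; intros th; apply Rcontinuous_eps; intros eps He; destruct (Main th eps He) as [d [Hd H]];
    exists d; split; auto; intros u Hu; eapply Rle_lt_trans; [|apply (H u Hu)| |apply (H u Hu)].
  - apply (Cnorm_fst (F (g u) - F (g th))).
  - apply (Cnorm_snd (F (g u) - F (g th))).
Qed.

Lemma path_cont_polar (r : R) : path_cont (polar r).
Proof.
  split; intros th; simpl; apply continuity_pt_filterlim;
    apply derivable_continuous_pt; reg.
Qed.

Definition cmean (phi : R -> Cpx) : Cpx :=
  (RInt (fun th => fst (phi th)) 0 (2 * PI) / (2 * PI),
   RInt (fun th => snd (phi th)) 0 (2 * PI) / (2 * PI)).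

(** Goursat's lemma is applied to the imaginary part of [G dz] and to minus its real part on the
    rectangle of height [2 * PI]. Its horizontal sides cancel by periodicity, which leaves the two
    vertical ones. *)
Lemma cmean_vertical_const (G : Cpx -> Cpx) (x1 x2 : R) : x1 < x2 ->
  (forall z, Ccont G z) -> (forall x, G (x, 0) = G (x, 2 * PI)) ->
  (forall x y, x1 <= x <= x2 -> cderivable G (x, y)) ->
  cmean (fun y => G (x1, y)) = cmean (fun y => G (x2, y)).
Proof.
  intros Hx HC Hper HD. pose proof PI_RGT_0 as Hpi.
  assert (Py : forall x, path_cont (fun y => G (x, y))).
  { intros x. apply path_cont_comp; auto. split; intros th; simpl.
    - apply continuous_const. - apply continuous_id. }
  assert (Px : forall y, path_cont (fun x => G (x, y))).
  { intros x. apply path_cont_comp; auto. split; intros th; simpl.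
    - apply continuous_id. - apply continuous_const. }
  assert (E1 : circulation (fun x y => snd (G (x, y))) (fun x y => fst (G (x, y))) x1 x2 0 (2 * PI) = 0).
  { apply circulation_eq0; auto; [lra| | |].
    - intros x y; apply (Px y). - intros x y; apply (Py x).
    - intros x y Hxx _. destruct (HD x y Hxx) as [l Hl]. apply has_cderiv_diff2 in Hl.
      exists (snd l), (fst l), (- snd l). tauto. }
  assert (E2 : circulation (fun x y => - fst (G (x, y))) (fun x y => snd (G (x, y))) x1 x2 0 (2 * PI) = 0).
  { apply circulation_eq0; auto; [lra| | |].
    - intros x y. apply (continuous_opp (V := R_NormedModule)). apply (Px y).
    - intros x y; apply (Py x).
    - intros x y Hxx _. destruct (HD x y Hxx) as [l Hl]. apply has_cderiv_diff2 in Hl.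
      exists (- fst l), (snd l), (fst l). split; [|tauto]. destruct Hl as [Hl _].
      intros eps He. destruct (Hl eps He) as [d [Hd H]]. exists d; split; auto.
      intros u v Hu Hv. eapply Rle_trans; [|apply (H u v Hu Hv)].
      rewrite <- Rabs_Ropp. right; f_equal; ring. }
  unfold circulation in E1, E2.
  rewrite (RInt_ext (fun x => snd (G (x, 0))) (fun x => snd (G (x, 2 * PI)))) in E1
    by (intros; rewrite Hper; auto).
  rewrite (RInt_ext (fun x => - fst (G (x, 0))) (fun x => - fst (G (x, 2 * PI)))) in E2
    by (intros; rewrite Hper; auto).
  unfold cmean. apply Cpx_ext; simpl; f_equal; lra.
Qed.

(** Rests on uniform continuity over the compact range of angles. It allows circles through
    exceptional points, and the degenerate radius 0, to be treated as limits. *)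
Lemma cmean_radius_cont (F : Cpx -> Cpx) (r0 : R) : (forall z, Ccont F z) ->
  forall eps, 0 < eps -> exists d, 0 < d /\ forall r, Rabs (r - r0) < d ->
    Cnorm (cmean (fun th => F (polar r th)) - cmean (fun th => F (polar r0 th))) <= eps.
Proof.
  intros HF eps He. pose proof PI_RGT_0 as Hpi.
  assert (Main : forall pr : Cpx -> R, (forall z w, Rabs (pr z - pr w) <= Cnorm (z - w)) ->
    (forall r th, continuous (fun th => pr (F (polar r th))) th) ->
    exists d, 0 < d /\ forall r, Rabs (r - r0) < d ->
      Rabs (RInt (fun th => pr (F (polar r th))) 0 (2 * PI) / (2 * PI)
          - RInt (fun th => pr (F (polar r0 th))) 0 (2 * PI) / (2 * PI)) <= eps / 2).
  { intros pr Hpr Hc.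
    assert (C2 : forall th, 0 <= th <= 2 * PI ->
      continuity_2d_pt (fun r th => pr (F (polar r th))) r0 th).
    { intros th _ e. destruct (HF (polar r0 th) e (cond_pos e)) as [d [Hd H]].
      assert (Cp : continuity_2d_pt (fun r th => r * cos th) r0 th).
      { apply continuity_2d_pt_mult; [apply continuity_2d_pt_id1|].
        apply (continuity_1d_2d_pt_comp cos (fun r th => th)); [apply continuity_cos|apply continuity_2d_pt_id2]. }
      assert (Sp : continuity_2d_pt (fun r th => r * sin th) r0 th).
      { apply continuity_2d_pt_mult; [apply continuity_2d_pt_id1|].
        apply (continuity_1d_2d_pt_comp sin (fun r th => th)); [apply continuity_sin|apply continuity_2d_pt_id2]. }
      assert (Hd2 : 0 < d / 2) by lra.
      generalize (locally_2d_and _ _ _ _ (Cp (mkposreal _ Hd2)) (Sp (mkposreal _ Hd2))).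
      apply locally_2d_impl. apply locally_2d_forall. intros u v [A1 A2]. simpl in A1, A2.
      eapply Rle_lt_trans; [apply Hpr|]. apply H.
      eapply Rle_lt_trans; [apply Cnorm_le_abs|]. simpl. unfold Rminus in *. lra. }
    assert (He4 : 0 < eps / 2) by lra.
    destruct (uniform_continuity_2d_1d' (fun r th => pr (F (polar r th))) 0 (2 * PI) r0 C2 (mkposreal _ He4)) as [d H].
    exists d; split; [apply cond_pos|]. intros r Hr.
    assert (B : Rabs (RInt (fun th => pr (F (polar r th)) - pr (F (polar r0 th))) 0 (2 * PI) - 0 * (2 * PI - 0))
      <= (eps / 2) * (2 * PI - 0)).
    { apply RInt_near_const; [lra| |].
      - apply ex_RInt_cont. intros th. apply (continuous_minus (V := R_NormedModule)); apply Hc.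
      - intros th Hth. rewrite Rminus_0_r. left.
        pose proof (cond_pos d). apply Rabs_lt_between in Hr.
        apply (H th r0 th r); auto; try lra.
        replace (th - th) with 0 by ring. rewrite Rabs_R0; auto. }
    rewrite (RInt_minus (V := R_CompleteNormedModule)) in B by (apply ex_RInt_cont; intros; apply Hc).
    set (a := RInt (fun th => pr (F (polar r th))) 0 (2 * PI)) in *.
    set (b := RInt (fun th => pr (F (polar r0 th))) 0 (2 * PI)) in *.
    change (minus a b) with (a - b) in B.
    replace (a / (2 * PI) - b / (2 * PI)) with ((a - b - 0 * (2 * PI - 0)) / (2 * PI)) by (field; lra).
    unfold Rdiv at 1. rewrite Rabs_mult, (Rabs_pos_eq (/ (2 * PI))) by (left; apply Rinv_0_lt_compat; lra).
    apply (Rmult_le_reg_r (2 * PI)); [lra|]. rewrite Rmult_assoc, Rinv_l by lra. lra. }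
  assert (Pc : forall r, path_cont (fun th => F (polar r th))).
  { intros r. apply path_cont_comp; auto. apply path_cont_polar. }
  destruct (Main fst) as [d1 [Hd1 H1]].
  { intros z w. apply (Cnorm_fst (z - w)). } { intros r; apply (Pc r). }
  destruct (Main snd) as [d2 [Hd2 H2]].
  { intros z w. apply (Cnorm_snd (z - w)). } { intros r; apply (Pc r). }
  exists (Rmin d1 d2); split; [apply Rmin_glb_lt; auto|]. intros r Hr.
  min_bounds d1 d2.
  specialize (H1 r ltac:(lra)). specialize (H2 r ltac:(lra)).
  eapply Rle_trans; [apply Cnorm_le_abs|]. unfold cmean; simpl. unfold Rminus in *. lra.
Qed.

(** On [T] only continuity is recorded, which is what is known of a divided difference at its base
    point. *)
Definition holo_off (F : Cpx -> Cpx) (T : Cpx -> Prop) : Prop :=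
  (forall z, Ccont F z) /\ (forall z, ~ T z -> cderivable F z).

(** Isolation is asked of the moduli because circles about the origin have to avoid [T]; several
    points may share one modulus. *)
Definition discrete_moduli (T : Cpx -> Prop) : Prop :=
  forall r, 0 < r -> exists d, 0 < d /\
    forall z, T z -> Rabs (Cnorm z - r) < d -> Cnorm z = r.

Lemma Cpx_eq_eps (z w : Cpx) : (forall eps, 0 < eps -> Cnorm (z - w) <= eps) -> z = w.
Proof.
  intros H. apply Csub_eq0, Cnorm_eq0.
  destruct (Rle_lt_or_eq_dec _ _ (Cnorm_ge0 (z - w))) as [L|E]; auto.
  specialize (H (Cnorm (z - w) / 2) ltac:(lra)). lra.
Qed.

Lemma exp_le_mono (x y : R) : x <= y -> exp x <= exp y.
Proof. intros [L|E]; [left; apply exp_increasing; auto|right; f_equal; auto]. Qed.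

Lemma cmean_annulus_const (F : Cpx -> Cpx) (T : Cpx -> Prop) (r1 r2 : R) : holo_off F T -> 0 < r1 < r2 ->
  (forall z, T z -> ~ (r1 <= Cnorm z <= r2)) ->
  cmean (fun th => F (polar r1 th)) = cmean (fun th => F (polar r2 th)).
Proof.
  intros [HC HD] Hr HT.
  pose proof (cmean_vertical_const (fun w => F (cexp w)) (ln r1) (ln r2)) as H.
  unfold cexp in H. simpl in H. rewrite !exp_ln in H by lra. apply H.
  - apply ln_increasing; lra.
  - intros z. apply (Ccont_comp F cexp); auto. apply cderivable_cont. eexists; apply has_cderiv_cexp.
  - intros x. unfold polar. rewrite cos_2PI, sin_2PI, cos_0, sin_0. reflexivity.
  - intros x y Hx.
    assert (E1 : exp (ln r1) <= exp x) by (apply exp_le_mono; lra).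
    assert (E2 : exp x <= exp (ln r2)) by (apply exp_le_mono; lra).
    rewrite exp_ln in E1, E2 by lra.
    destruct (HD (cexp (x, y))) as [l Hl].
    { intros Hc. apply (HT _ Hc). unfold cexp; simpl. rewrite Cnorm_polar by (left; apply exp_pos). lra. }
    eexists. apply (has_cderiv_comp F cexp (x, y) l _ (has_cderiv_cexp (x, y)) Hl).
Qed.

(** The circle of radius [r0] may meet [T], so the radius [r] is compared with some [r'] strictly
    between the two and as close to [r0] as desired; continuity in the radius does the rest. *)
Lemma cmean_local_const (F : Cpx -> Cpx) (T : Cpx -> Prop) (r0 : R) :
  holo_off F T -> discrete_moduli T -> 0 < r0 ->
  exists d, 0 < d /\ forall r, Rabs (r - r0) < d ->
    cmean (fun th => F (polar r th)) = cmean (fun th => F (polar r0 th)).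
Proof.
  intros HF HT Hr0. destruct (HT r0 Hr0) as [d [Hd H]].
  exists (Rmin d r0); split; [apply Rmin_glb_lt; auto|]. intros r Hr.
  min_bounds d r0. apply Rabs_lt_between in Hr.
  destruct (Req_dec r r0) as [->|Hne]; auto.
  apply Cpx_eq_eps. intros eps He.
  destruct (cmean_radius_cont F r0 (proj1 HF) eps He) as [e [He1 Hm]].
  assert (Hex : exists r', Rabs (r' - r0) < e /\
    ((r0 < r' < r) \/ (r < r' < r0))).
  { destruct (Rtotal_order r r0) as [L|[L|L]]; [|lra|].
    - exists (r0 - Rmin (e / 2) ((r0 - r) / 2)).
      min_bounds (e / 2) ((r0 - r) / 2).
      assert (0 < Rmin (e / 2) ((r0 - r) / 2)) by (apply Rmin_glb_lt; lra).
      split; [apply Rabs_lt_between; lra|right; lra].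
    - exists (r0 + Rmin (e / 2) ((r - r0) / 2)).
      min_bounds (e / 2) ((r - r0) / 2).
      assert (0 < Rmin (e / 2) ((r - r0) / 2)) by (apply Rmin_glb_lt; lra).
      split; [apply Rabs_lt_between; lra|left; lra]. }
  destruct Hex as [r' [Hr' Hc]]. specialize (Hm r' Hr').
  assert (E : cmean (fun th => F (polar r' th)) = cmean (fun th => F (polar r th))).
  { destruct Hc as [Hc|Hc]; [|symmetry]; apply (cmean_annulus_const F T); auto; try lra;
      intros z Hz Hz2; specialize (H z Hz); rewrite H in Hz2; try lra; apply Rabs_lt_between; lra. }
  rewrite <- E. exact Hm.
Qed.

(* Circles through exceptional points are allowed: the mean is continuous in the
   radius and locally constant away from isolated radii. *)
Theorem mean_value (F : Cpx -> Cpx) (T : Cpx -> Prop) (r : R) :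
  holo_off F T -> discrete_moduli T -> 0 < r -> cmean (fun th => F (polar r th)) = F C0.
Proof.
  intros HF HT Hr. pose proof PI_RGT_0 as Hpi.
  assert (E0 : cmean (fun th => F (polar 0 th)) = F C0).
  { assert (Ep : forall th, polar 0 th = C0) by (intros; apply Cpx_ext; simpl; ring).
    unfold cmean. apply Cpx_ext; simpl.
    - rewrite (RInt_ext _ (fun _ => fst (F C0))) by (intros; rewrite Ep; reflexivity).
      rewrite RInt_const. unfold scal; simpl. unfold mult; simpl. field; lra.
    - rewrite (RInt_ext _ (fun _ => snd (F C0))) by (intros; rewrite Ep; reflexivity).
      rewrite RInt_const. unfold scal; simpl. unfold mult; simpl. field; lra. }
  assert (Const : forall r1 r2, 0 < r1 < r2 ->
    cmean (fun th => F (polar r1 th)) = cmean (fun th => F (polar r2 th))).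
  { intros r1 r2 H12.
    assert (Main : forall pr : Cpx -> R,
       pr (cmean (fun th => F (polar r1 th))) = pr (cmean (fun th => F (polar r2 th)))).
    { intros pr.
      (* A locally constant function has derivative 0, so the real mean value theorem yields
         constancy without a covering argument. *)
      destruct (MVT_gen (fun r => pr (cmean (fun th => F (polar r th)))) r1 r2 (fun _ => 0)) as [c [_ Hc]].
      - intros x Hx. rewrite Rmin_left, Rmax_right in Hx by lra.
        destruct (cmean_local_const F T x HF HT ltac:(lra)) as [d [Hd H]].
        apply (is_derive_ext_loc (fun _ => pr (cmean (fun th => F (polar x th))))).
        + exists (mkposreal d Hd). intros y Hy. rewrite (H y Hy); reflexivity.
        + apply (is_derive_const (V := R_NormedModule)).
      - intros x Hx. rewrite Rmin_left, Rmax_right in Hx by lra.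
        destruct (cmean_local_const F T x HF HT ltac:(lra)) as [d [Hd H]].
        intros e He. exists d; split; auto. intros y [_ Hy]. simpl in Hy. unfold Rdist in *. simpl.
        unfold Rdist. rewrite (H y Hy), Rminus_diag, Rabs_R0; auto.
      - lra. }
    apply Cpx_ext; apply Main. }
  rewrite <- E0. apply Cpx_eq_eps. intros eps He.
  destruct (cmean_radius_cont F 0 (proj1 HF) eps He) as [d [Hd H]].
  assert (Hm : 0 < Rmin (d / 2) (r / 2)) by (apply Rmin_glb_lt; lra).
  min_bounds (d / 2) (r / 2).
  rewrite <- (Const (Rmin (d / 2) (r / 2)) r) by lra.
  apply H. rewrite Rminus_0_r, Rabs_pos_eq; lra.
Qed.

(** * Linearity and bounds for circle means *)

Lemma cmean_ext (phi psi : R -> Cpx) : (forall th, phi th = psi th) -> cmean phi = cmean psi.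
Proof. intros H. unfold cmean. f_equal; f_equal; apply RInt_ext; intros; rewrite H; auto. Qed.

Lemma path_cont_const (c : Cpx) : path_cont (fun _ => c).
Proof. split; intros; apply continuous_const. Qed.

Lemma path_cont_add (phi psi : R -> Cpx) : path_cont phi -> path_cont psi ->
  path_cont (fun th => phi th + psi th)%cpx.
Proof. intros [H1 H2] [H3 H4]. split; intros; apply (continuous_plus (V := R_NormedModule)); auto. Qed.

Lemma path_cont_mul (phi psi : R -> Cpx) : path_cont phi -> path_cont psi ->
  path_cont (fun th => phi th * psi th)%cpx.
Proof.
  intros [H1 H2] [H3 H4]. split; intros; simpl.
  - apply (continuous_minus (V := R_NormedModule)); apply (continuous_mult (K := R_AbsRing)); auto.
  - apply (continuous_plus (V := R_NormedModule)); apply (continuous_mult (K := R_AbsRing)); auto.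
Qed.

Lemma cmean_add (phi psi : R -> Cpx) : path_cont phi -> path_cont psi ->
  cmean (fun th => phi th + psi th)%cpx = (cmean phi + cmean psi)%cpx.
Proof.
  intros [H1 H2] [H3 H4]. pose proof PI_RGT_0. unfold cmean. apply Cpx_ext; simpl.
  - rewrite (RInt_plus (V := R_CompleteNormedModule)) by (apply ex_RInt_cont; auto).
    unfold plus; simpl. field; lra.
  - rewrite (RInt_plus (V := R_CompleteNormedModule)) by (apply ex_RInt_cont; auto).
    unfold plus; simpl. field; lra.
Qed.

Lemma cmean_scal (c : Cpx) (phi : R -> Cpx) : path_cont phi ->
  cmean (fun th => c * phi th)%cpx = (c * cmean phi)%cpx.
Proof.
  intros [H1 H2]. pose proof PI_RGT_0.
  assert (S : forall (k : R) (f : R -> R), (forall th, continuous f th) -> forall th, continuous (fun th => k * f th) th).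
  { intros k f Hf th. apply (continuous_scal_r (V := R_NormedModule)). auto. }
  assert (I : forall (k : R) (f : R -> R), (forall th, continuous f th) ->
    RInt (fun th => k * f th) 0 (2 * PI) = k * RInt f 0 (2 * PI)).
  { intros k f Hf. apply (RInt_scal (V := R_CompleteNormedModule)). apply ex_RInt_cont; auto. }
  unfold cmean. apply Cpx_ext; simpl.
  - rewrite (RInt_minus (V := R_CompleteNormedModule)) by (apply ex_RInt_cont; apply S; auto).
    rewrite !I by auto. unfold minus, plus, opp; simpl. field; lra.
  - rewrite (RInt_plus (V := R_CompleteNormedModule)) by (apply ex_RInt_cont; apply S; auto).
    rewrite !I by auto. unfold plus; simpl. field; lra.
Qed.

Lemma cmean_const (c : Cpx) : cmean (fun _ => c) = c.
Proof.
  pose proof PI_RGT_0. unfold cmean. apply Cpx_ext; simpl; rewrite RInt_const;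
    unfold scal; simpl; unfold mult; simpl; field; lra.
Qed.

Lemma cmean_conj (phi : R -> Cpx) : path_cont phi ->
  cmean (fun th => Cconj (phi th)) = Cconj (cmean phi).
Proof.
  intros [H1 H2]. pose proof PI_RGT_0. unfold cmean. apply Cpx_ext; simpl; auto.
  rewrite (RInt_opp (V := R_CompleteNormedModule)) by (apply ex_RInt_cont; auto).
  unfold opp; simpl. field; lra.
Qed.

(** The factor 2 is the price of bounding the real and imaginary parts separately. *)
Lemma cmean_bound (phi : R -> Cpx) (M : R) : path_cont phi ->
  (forall th, 0 <= th <= 2 * PI -> Cnorm (phi th) <= M) -> Cnorm (cmean phi) <= 2 * M.
Proof.
  intros [H1 H2] HM. pose proof PI_RGT_0.
  assert (B : forall f : R -> R, (forall th, continuous f th) -> (forall th, 0 <= th <= 2 * PI -> Rabs (f th) <= M) ->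
    Rabs (RInt f 0 (2 * PI) / (2 * PI)) <= M).
  { intros f Hf Hb.
    assert (Hc : Rabs (RInt f 0 (2 * PI) - 0 * (2 * PI - 0)) <= M * (2 * PI - 0)).
    { apply RInt_near_const; [lra|apply ex_RInt_cont; auto|].
      intros; rewrite Rminus_0_r; auto. }
    rewrite Rmult_0_l, Rminus_0_r in Hc. unfold Rdiv.
    rewrite Rabs_mult, (Rabs_pos_eq (/ _)) by (left; apply Rinv_0_lt_compat; lra).
    apply (Rmult_le_reg_r (2 * PI)); [lra|]. rewrite Rmult_assoc, Rinv_l by lra. lra. }
  eapply Rle_trans; [apply Cnorm_le_abs|]. unfold cmean; simpl.
  assert (Rabs (RInt (fun th => fst (phi th)) 0 (2 * PI) / (2 * PI)) <= M).
  { apply B; auto. intros th Hth. eapply Rle_trans; [apply Cnorm_fst|auto]. }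
  assert (Rabs (RInt (fun th => snd (phi th)) 0 (2 * PI) / (2 * PI)) <= M).
  { apply B; auto. intros th Hth. eapply Rle_trans; [apply Cnorm_snd|auto]. }
  lra.
Qed.

Lemma path_bounded (phi : R -> Cpx) : path_cont phi ->
  exists M, 0 <= M /\ forall th, 0 <= th <= 2 * PI -> Cnorm (phi th) <= M.
Proof.
  intros [H1 H2]. pose proof PI_RGT_0.
  assert (Hc : forall th, continuity_pt (fun th => Rabs (fst (phi th)) + Rabs (snd (phi th))) th).
  { intros th. apply continuity_pt_plus.
    - apply (continuity_pt_comp (fun th => fst (phi th)) Rabs); [apply continuity_pt_filterlim, H1|apply Rcontinuity_abs].
    - apply (continuity_pt_comp (fun th => snd (phi th)) Rabs); [apply continuity_pt_filterlim, H2|apply Rcontinuity_abs]. }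
  destruct (continuity_ab_maj _ 0 (2 * PI) ltac:(lra) (fun th _ => Hc th)) as [m [Hm _]].
  - exists (Rabs (fst (phi m)) + Rabs (snd (phi m))). split.
    + pose proof (Rabs_pos (fst (phi m))). pose proof (Rabs_pos (snd (phi m))). lra.
    + intros th Hth. eapply Rle_trans; [apply Cnorm_le_abs|]. apply Hm; auto.
Qed.

Lemma discrete_moduli_point (b : Cpx) : discrete_moduli (fun z => z = b).
Proof.
  intros r Hr. destruct (Req_dec (Cnorm b) r) as [E|N].
  - exists 1; split; [lra|]. intros z -> _; auto.
  - exists (Rabs (Cnorm b - r)). split; [apply Rabs_pos_lt; lra|]. intros z -> H. lra.
Qed.

Lemma discrete_moduli_union (S T : Cpx -> Prop) : discrete_moduli S -> discrete_moduli T ->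
  discrete_moduli (fun z => S z \/ T z).
Proof.
  intros HS HT r Hr. destruct (HS r Hr) as [d1 [Hd1 H1]]. destruct (HT r Hr) as [d2 [Hd2 H2]].
  exists (Rmin d1 d2); split; [apply Rmin_glb_lt; auto|].
  min_bounds d1 d2.
  intros z [Hz|Hz] Hn; [apply H1|apply H2]; auto; lra.
Qed.

Lemma holo_off_sub (F : Cpx -> Cpx) (S T : Cpx -> Prop) :
  (forall z, S z -> T z) -> holo_off F S -> holo_off F T.
Proof. intros H [H1 H2]. split; auto. Qed.

Lemma holo_off_mul (F G : Cpx -> Cpx) (T : Cpx -> Prop) : holo_off F T -> holo_off G T -> holo_off (fun z => F z * G z)%cpx T.
Proof. intros [H1 H2] [H3 H4]. split; intros; [apply Ccont_mul|apply cderivable_mul]; auto. Qed.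

Lemma holo_off_entire (F : Cpx -> Cpx) (T : Cpx -> Prop) : entire F -> holo_off F T.
Proof. intros H; split; intros; [apply cderivable_cont|]; apply H. Qed.

Lemma entire_const (c : Cpx) : entire (fun _ => c).
Proof. intros z; apply cderivable_const. Qed.

Lemma entire_id : entire (fun z => z).
Proof. intros z; apply cderivable_id. Qed.

(** * Removable singularities, Liouville, and counting of zeros *)

(** The value [l] at [b] makes the quotient continuous there by the definition of the derivative;
    differentiability at [b] stays open, so [b] joins the exceptional set. *)
Lemma divided_difference (F : Cpx -> Cpx) (T : Cpx -> Prop) (b l : Cpx) : holo_off F T -> has_cderiv F b l ->
  exists G, holo_off G (fun z => T z \/ z = b) /\ (forall z, F z = F b + (z - b) * G z)%cpx /\ G b = l.
Proof.
  intros [HC HD] Hl.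
  set (G := fun z => if excluded_middle_informative (z = b) then l else ((F z - F b) / (z - b))%cpx).
  assert (Gb : G b = l) by (unfold G; destruct (excluded_middle_informative (b = b)); congruence).
  assert (Gz : forall z, z <> b -> G z = ((F z - F b) / (z - b))%cpx)
    by (intros z Hz; unfold G; destruct (excluded_middle_informative (z = b)); congruence).
  assert (Loc : forall z, z <> b -> forall w, Cnorm (w - z) < Cnorm (z - b) ->
     ((F w - F b) / (w - b))%cpx = G w).
  { intros z Hz w Hw. symmetry; apply Gz. intros ->. rewrite Cnorm_sub_sym in Hw. lra. }
  exists G. split; [split|split].
  - intros z. destruct (classic (z = b)) as [->|Hz].
    + apply cderiv_atE in Hl. intros eps He. destruct (Hl (eps / 2)) as [d [Hd H]]; [lra|].
      exists d; split; auto. intros w Hw. rewrite Gb.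
      destruct (classic (w = b)) as [->|Hwb].
      { rewrite Gb. rewrite Cnorm_sub_diag; auto. }
      rewrite (Gz w Hwb). pose proof (Cnorm_sub_gt0 w b Hwb) as Hp. specialize (H w Hw).
      replace ((F w - F b) / (w - b) - l)%cpx with ((F w - F b - l * (w - b)) / (w - b))%cpx
        by (field; apply Csub_neq0; auto).
      rewrite Cnorm_div by (apply Csub_neq0; auto).
      apply Rlt_div_l; auto.
      eapply Rle_lt_trans; [exact H|]. apply Rmult_lt_compat_r; lra.
    + apply (Ccont_local (fun w => (F w - F b) / (w - b))%cpx G z (Cnorm (z - b))).
      * apply Cnorm_sub_gt0; auto. * apply Loc; auto.
      * apply Ccont_div; [apply Ccont_sub; auto; apply Ccont_const
          |apply Ccont_sub; [apply Ccont_id|apply Ccont_const]|apply Csub_neq0; auto].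
  - intros z Hz. assert (HzT : ~ T z) by tauto. assert (Hzb : z <> b) by tauto.
    apply (cderivable_local (fun w => (F w - F b) / (w - b))%cpx G z (Cnorm (z - b))).
    + apply Cnorm_sub_gt0; auto. + apply Loc; auto.
    + apply cderivable_div; [apply cderivable_sub; auto; apply cderivable_const
        |apply cderivable_sub; [apply cderivable_id|apply cderivable_const]|apply Csub_neq0; auto].
  - intros z. destruct (classic (z = b)) as [->|Hz]; [ring|].
    rewrite (Gz z Hz). field. apply Csub_neq0; auto.
  - exact Gb.
Qed.

(** On the unit circle the inverse is the conjugate, and the identity function has mean 0. *)
Lemma cmean_inv_polar : cmean (fun th => Cinv (polar 1 th)) = C0.
Proof.
  rewrite (cmean_ext _ (fun th => Cconj (polar 1 th))).
  - rewrite cmean_conj by apply path_cont_polar.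
    assert (E : cmean (polar 1) = C0).
    { apply (mean_value (fun z => z) (fun _ => False) 1); [apply holo_off_entire, entire_id| |lra].
      intros r Hr. exists 1; split; [lra|tauto]. }
    rewrite E. apply Cpx_ext; simpl; ring.
  - intros th. unfold polar. pose proof (sin2_cos2 th) as E. unfold Rsqr in E.
    assert (E2 : (1 * cos th) ^ 2 + (1 * sin th) ^ 2 = 1) by (simpl; lra).
    apply Cpx_ext; unfold Cinv, Cconj; cbn [fst snd]; rewrite E2; field.
Qed.

Lemma path_cont_div (phi psi : R -> Cpx) : path_cont phi -> path_cont psi ->
  (forall th, psi th <> C0) -> path_cont (fun th => phi th / psi th)%cpx.
Proof.
  intros H1 H2 H0. apply path_cont_mul; auto. apply (path_cont_comp Cinv); auto.
  intros th. apply cderivable_cont. eexists; apply has_cderiv_inv; auto.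
Qed.

(* Expand the kernel [u / (u - h)] to second order on the unit circle. *)
Lemma removable_singularity0 (F : Cpx -> Cpx) : holo_off F (fun z => z = C0) -> cderivable F C0.
Proof.
  intros HF. set (u := polar 1).
  assert (Hu : forall th, Cnorm (u th) = 1) by (intros; apply Cnorm_polar; lra).
  assert (Hu0 : forall th, u th <> C0) by (intros th; apply Cnorm_gt0_neq; rewrite Hu; lra).
  assert (Pu : path_cont u) by apply path_cont_polar.
  assert (PF : path_cont (fun th => F (u th))) by (apply path_cont_comp; auto; intros; apply HF).
  assert (PFu : path_cont (fun th => F (u th) / u th)%cpx) by (apply path_cont_div; auto).
  assert (Piu : path_cont (fun th => Cinv (u th))).
  { apply (path_cont_comp Cinv); auto. intros th. apply cderivable_cont. eexists; apply has_cderiv_inv; auto. }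
  destruct (path_bounded _ PF) as [M [HM0 HM]].
  destruct (proj1 HF C0 1 Rlt_0_1) as [d0 [Hd0 H0]].
  set (c1 := cmean (fun th => F (u th) / u th)%cpx).
  (* Bounds [R1 - F h * R2] below: [|u - h| >= 1 / 2] gives [|q| <= 2], [cmean_bound] doubles this,
     and [d0] keeps [|F h|] below [|F 0| + 1]. *)
  set (K := 4 * M + 4 * (Cnorm (F C0) + 1)).
  assert (HK : 0 < K) by (unfold K; pose proof (Cnorm_ge0 (F C0)); lra).
  assert (Main : forall h, h <> C0 -> Cnorm h < 1 / 2 -> Cnorm h < d0 ->
    Cnorm (F h - F C0 - c1 * h) <= K * (Cnorm h * Cnorm h)).
  { intros h Hh Hh2 Hh3.
    assert (Huh : forall th, 1 / 2 <= Cnorm (u th - h)).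
    { intros th. pose proof (Cnorm_sub_ge (u th) h). rewrite Hu in H. lra. }
    assert (Huh0 : forall th, (u th - h)%cpx <> C0).
    { intros th. apply Cnorm_gt0_neq. specialize (Huh th). lra. }
    destruct (proj2 HF h Hh) as [l Hl].
    destruct (divided_difference F _ h l HF Hl) as [G [HG [EG _]]].
    assert (MZ : cmean (fun th => u th * G (u th))%cpx = C0).
    { unfold u. rewrite (mean_value (fun z => z * G z)%cpx _ 1 (holo_off_mul (fun z => z) G _ (holo_off_entire _ _ entire_id) HG)).
      - ring.
      - apply discrete_moduli_union; apply discrete_moduli_point.
      - lra. }
    set (q := fun th => Cinv (u th * (u th - h))).
    assert (Pq : path_cont q).
    { apply (path_cont_comp Cinv (fun th => u th * (u th - h))%cpx).
      - apply path_cont_mul; auto. apply (path_cont_add u (fun _ => - h)%cpx); auto. apply path_cont_const.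
      - intros th. apply cderivable_cont. eexists; apply has_cderiv_inv. apply Cmul_neq0; auto. }
    assert (Pconst : path_cont (fun _ => C1)) by apply path_cont_const.
    assert (Pk : path_cont (fun th => C1 + (h * Cinv (u th) + h * h * q th))%cpx).
    { apply path_cont_add; auto. apply path_cont_add; apply path_cont_mul; auto; apply path_cont_const. }
    assert (Nq : forall th, Cnorm (q th) <= 2).
    { intros th. unfold q. rewrite Cnorm_inv, Cnorm_mul, Hu by (apply Cmul_neq0; auto).
      replace 2 with (/ (1 / 2)) by field. apply Rinv_le_contravar; [lra|]. specialize (Huh th). lra. }
    set (R1 := cmean (fun th => F (u th) * q th)%cpx). set (R2 := cmean q).
    assert (BR1 : Cnorm R1 <= 4 * M).
    { replace (4 * M) with (2 * (M * 2)) by ring. apply cmean_bound; [apply path_cont_mul; auto|].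
      intros th Hth. rewrite Cnorm_mul. apply Rmult_le_compat; auto; apply Cnorm_ge0. }
    assert (BR2 : Cnorm R2 <= 4).
    { replace 4 with (2 * 2) by ring. apply cmean_bound; auto. }
    (* Means are taken in [u * G u = (F u - F h) * (1 + h / u + h^2 * q)]. Since [1 / u] has mean 0,
       the only term of first order in [h] is [c1], which is thereby the derivative. *)
    assert (E : (F C0 + (h * c1 + h * h * R1) + (- F h) * (C1 + (h * C0 + h * h * R2)))%cpx = C0).
    { transitivity (cmean (fun th => u th * G (u th))%cpx); [|exact MZ].
      rewrite (cmean_ext (fun th => u th * G (u th))%cpx
        (fun th => (F (u th) + (h * (F (u th) / u th) + h * h * (F (u th) * q th)))
                   + (- F h) * (C1 + (h * Cinv (u th) + h * h * q th)))%cpx).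
      - assert (P1 : path_cont (fun th => h * (F (u th) / u th) + h * h * (F (u th) * q th))%cpx).
        { apply path_cont_add; apply path_cont_mul; auto; try apply path_cont_const; apply path_cont_mul; auto. }
        assert (P2 : path_cont (fun th => h * Cinv (u th) + h * h * q th)%cpx).
        { apply path_cont_add; apply path_cont_mul; auto; apply path_cont_const. }
        assert (PFq : path_cont (fun th => F (u th) * q th)%cpx) by (apply path_cont_mul; auto).
        rewrite cmean_add; [|apply path_cont_add; auto|apply path_cont_mul; auto; apply path_cont_const].
        rewrite (cmean_add (fun th => F (u th))); auto.
        rewrite (cmean_scal (- F h)) by auto.
        rewrite (cmean_add (fun _ => C1)) by auto.
        rewrite (cmean_add (fun th => h * (F (u th) / u th))%cpx); [|apply path_cont_mul; auto; apply path_cont_const..].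
        rewrite (cmean_add (fun th => h * Cinv (u th))%cpx); [|apply path_cont_mul; auto; apply path_cont_const..].
        rewrite !cmean_scal, cmean_const by auto.
        assert (EM : cmean (fun th => F (u th)) = F C0).
        { apply (mean_value F _ 1 HF); [apply discrete_moduli_point|lra]. }
        rewrite EM. unfold u. rewrite cmean_inv_polar. reflexivity.
      - intros th. specialize (EG (u th)).
        assert (EG2 : G (u th) = ((F (u th) - F h) / (u th - h))%cpx).
        { rewrite EG. field. auto. }
        rewrite EG2. unfold q. field. split; auto. }
    assert (E3 : (F h - F C0 - c1 * h)%cpx = (h * h * (R1 - F h * R2))%cpx).
    { replace (h * h * (R1 - F h * R2))%cpx with
        ((F C0 + (h * c1 + h * h * R1) + (- F h) * (C1 + (h * C0 + h * h * R2))) + (F h - F C0 - c1 * h))%cpx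
        by ring. rewrite E. ring. }
    rewrite E3, !Cnorm_mul, Rmult_comm. apply Rmult_le_compat_r.
    { apply Rmult_le_pos; apply Cnorm_ge0. }
    eapply Rle_trans; [apply Cnorm_sub|]. rewrite Cnorm_mul.
    assert (BF : Cnorm (F h) <= Cnorm (F C0) + 1).
    { specialize (H0 h). replace (h - C0)%cpx with h in H0 by ring. specialize (H0 Hh3).
      pose proof (Cnorm_sub_ge (F h) (F C0)). lra. }
    assert (Cnorm (F h) * Cnorm R2 <= (Cnorm (F C0) + 1) * 4) by (apply Rmult_le_compat; auto; apply Cnorm_ge0).
    unfold K. lra. }
  exists c1. apply cderiv_atI. intros eps He.
  exists (Rmin (eps / K) (Rmin (1 / 2) d0)). split.
  { apply Rmin3_gt0; auto; [apply Rdiv_lt_0_compat; auto|lra]. }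
  intros h Hh. replace (h - C0)%cpx with h in * by ring.
  apply Rmin3_lt in Hh. destruct Hh as [A1 [A3 A4]].
  destruct (classic (h = C0)) as [->|Hn].
  { replace (F C0 - F C0 - c1 * C0)%cpx with C0 by ring. rewrite Cnorm_C0. lra. }
  eapply Rle_trans; [apply Main; auto|]. rewrite <- Rmult_assoc.
  apply Rmult_le_compat_r; [apply Cnorm_ge0|].
  apply Rle_trans with (K * (eps / K)); [apply Rmult_le_compat_l; lra|right; field; lra].
Qed.

Lemma removable_singularity (F : Cpx -> Cpx) (b : Cpx) : holo_off F (fun z => z = b) -> entire F.
Proof.
  intros [HC HD] z. destruct (classic (z = b)) as [->|Hz]; [|apply HD; auto].
  assert (T : forall w, has_cderiv (fun v => v + b)%cpx w C1).
  { intros w eps He. exists 1; split; [lra|]. intros h _.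
    replace (w + h + b - (w + b) - C1 * h)%cpx with C0 by ring. rewrite Cnorm_C0.
    apply Rmult_le_pos; [lra|apply Cnorm_ge0]. }
  destruct (removable_singularity0 (fun w => F (w + b))%cpx) as [l Hl].
  - split.
    + intros w. apply (Ccont_comp F (fun v => v + b)%cpx); auto. apply cderivable_cont; eexists; apply T.
    + intros w Hw. destruct (HD (w + b)%cpx) as [m Hm].
      { intros E. apply Hw. replace w with (w + b - b)%cpx by ring. rewrite E. ring. }
      eexists. apply (has_cderiv_comp F (fun v => v + b)%cpx w m C1 (T w) Hm).
  - exists l. apply cderiv_atE in Hl. apply cderiv_atI. intros eps He.
    destruct (Hl eps He) as [d [Hd H]]. exists d; split; auto. intros w Hw.
    specialize (H (w - b)%cpx). simpl in H. replace (w - b - C0)%cpx with (w - b)%cpx in H by ring.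
    replace (w - b + b)%cpx with w in H by ring. replace (C0 + b)%cpx with b in H by ring. auto.
Qed.

Lemma holo_off_mul_id (G : Cpx -> Cpx) (T : Cpx -> Prop) : holo_off G T -> holo_off (fun z => z * G z)%cpx T.
Proof. intros H. apply (holo_off_mul (fun z => z)); auto. apply holo_off_entire, entire_id. Qed.

(** Cauchy's formula at [a] shows [F a] as the mean of [z / (z - a) * F z - a / (z - a) * F a]. For
    [r > 9 |a|] the two kernels are at most [9 / 8] and [1 / 8], so even after the factor 2 of
    [cmean_bound] the last term is absorbed on the left. *)
Lemma decay_on_circles (F : Cpx -> Cpx) (T : Cpx -> Prop) : holo_off F T -> discrete_moduli T ->
  (forall eps rho, 0 < eps -> exists r, rho < r /\ forall z, Cnorm z = r -> Cnorm (F z) <= eps) ->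
  forall a, ~ T a -> F a = C0.
Proof.
  intros HF HT Hdec a Ha. destruct (proj2 HF a Ha) as [l Hl].
  destruct (divided_difference F T a l HF Hl) as [G [HG [EG _]]].
  assert (Small : forall eps, 0 < eps -> Cnorm (F a) <= 3 * eps).
  { intros eps He. destruct (Hdec eps (9 * Cnorm a + 1) He) as [r [Hr Hc]].
    pose proof (Cnorm_ge0 a) as Ha0.
    assert (Pc : path_cont (polar r)) by apply path_cont_polar.
    assert (HzG := holo_off_mul_id G _ HG).
    assert (MZ : cmean (fun th => polar r th * G (polar r th))%cpx = C0).
    { rewrite (mean_value (fun z => z * G z)%cpx _ r HzG).
      - ring. - apply discrete_moduli_union; auto; apply discrete_moduli_point. - lra. }
    assert (PzG : path_cont (fun th => polar r th * G (polar r th))%cpx).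
    { apply (path_cont_comp (fun z => z * G z)%cpx); auto. intros; apply HzG. }
    assert (E : F a = cmean (fun th => polar r th * G (polar r th) + F a)%cpx).
    { rewrite cmean_add, MZ, cmean_const; auto; [ring|apply path_cont_const]. }
    assert (B : Cnorm (F a) <= 2 * (9 / 8 * eps + Cnorm (F a) / 8)).
    { rewrite E at 1. apply cmean_bound; [apply path_cont_add; auto; apply path_cont_const|].
      intros th _. set (z := polar r th).
      assert (Hz : Cnorm z = r) by (apply Cnorm_polar; lra).
      assert (Hza : 8 / 9 * r <= Cnorm (z - a)).
      { pose proof (Cnorm_sub_ge z a). lra. }
      assert (Hza0 : (z - a)%cpx <> C0) by (apply Cnorm_gt0_neq; lra).
      assert (EG2 : G z = ((F z - F a) / (z - a))%cpx) by (rewrite (EG z); field; auto).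
      rewrite EG2.
      replace (z * ((F z - F a) / (z - a)) + F a)%cpx with
        (z / (z - a) * F z - a / (z - a) * F a)%cpx by (field; auto).
      eapply Rle_trans; [apply Cnorm_sub|]. rewrite !Cnorm_mul, !Cnorm_div, Hz by auto.
      apply Rplus_le_compat.
      - apply Rmult_le_compat; auto; try apply Cnorm_ge0.
        + apply Rmult_le_pos; [lra|]. left; apply Rinv_0_lt_compat; lra.
        + apply Rle_div_l; lra.
      - rewrite (Rmult_comm (Cnorm a / _)). unfold Rdiv at 2. apply Rmult_le_compat_l; [apply Cnorm_ge0|].
        apply Rle_div_l; lra. }
    lra. }
  apply Cpx_eq_eps. intros eps He. replace (F a - C0)%cpx with (F a) by ring.
  specialize (Small (eps / 3) ltac:(lra)). lra.
Qed.

(* Liouville: dividing out (z - b) lowers the growth exponent by one and keeps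
   the values tending to 0 along some sequence. *)
Lemma polynomial_growth_small_values (N : nat) : forall (F : Cpx -> Cpx) (T : Cpx -> Prop) (C : R),
  holo_off F T -> discrete_moduli T ->
  (forall rho, exists r, rho < r /\ forall z, Cnorm z = r -> Cnorm (F z) * r <= C * r ^ N) ->
  (forall eps rho, 0 < eps -> exists z, rho < Cnorm z /\ ~ T z /\ Cnorm (F z) <= eps) ->
  forall a, ~ T a -> F a = C0.
Proof.
  induction N; intros F T C HF HT HC HS.
  (* The extra factor [r] in the growth hypothesis makes [N = 0] mean decay like [1 / r]. *)
  - apply decay_on_circles; auto. intros eps rho He.
    destruct (HC (Rmax rho (Rabs C / eps + 1))) as [r [Hr H]].
    max_bounds rho (Rabs C / eps + 1).
    assert (0 <= Rabs C / eps) by (apply Rdiv_le_0_compat; [apply Rabs_pos|auto]).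
    exists r; split; [lra|]. intros z Hz. specialize (H z Hz). simpl in H. rewrite Rmult_1_r in H.
    apply (Rmult_le_reg_r r); [lra|].
    assert (Rabs C <= eps * r).
    { apply Rle_trans with (eps * (Rabs C / eps)); [right; field; lra|apply Rmult_le_compat_l; lra]. }
    pose proof (Rle_abs C). lra.
  - intros b Hb. destruct (proj2 HF b Hb) as [l Hl].
    destruct (divided_difference F T b l HF Hl) as [G [HG [EG _]]].
    pose proof (Cnorm_ge0 b) as Hb0. pose proof (Cnorm_ge0 (F b)) as HFb0.
    assert (EG2 : forall z, z <> b -> G z = ((F z - F b) / (z - b))%cpx).
    { intros z Hz. rewrite (EG z). field. apply Csub_neq0; auto. }
    assert (G0 : forall z, ~ (T z \/ z = b) -> G z = C0).
    { apply (IHN G _ (2 * Rabs C + 2 * Cnorm (F b))); auto.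
      - apply discrete_moduli_union; auto; apply discrete_moduli_point.
      - intros rho. destruct (HC (Rmax rho (2 * Cnorm b + 1))) as [r [Hr H]].
        max_bounds rho (2 * Cnorm b + 1).
        exists r; split; [lra|]. intros z Hz. specialize (H z Hz).
        assert (HrN : 1 <= r ^ N) by (apply pow_R1_Rle; lra).
        assert (Hzb : r / 2 <= Cnorm (z - b)) by (pose proof (Cnorm_sub_ge z b); lra).
        assert (Hzb0 : z <> b).
        { intros ->. rewrite Cnorm_sub_diag in Hzb. lra. }
        rewrite EG2, Cnorm_div by (auto; apply Csub_neq0; auto).
        assert (HFz : Cnorm (F z) <= Rabs C * r ^ N).
        { apply (Rmult_le_reg_r r); [lra|]. eapply Rle_trans; [exact H|]. simpl.
          rewrite Rmult_assoc, (Rmult_comm (r ^ N)). apply Rmult_le_compat_r.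
          - apply Rmult_le_pos; lra. - apply Rle_abs. }
        pose proof (Cnorm_sub (F z) (F b)) as Hs.
        apply (Rmult_le_reg_r (Cnorm (z - b))); [lra|].
        replace (Cnorm (F z - F b) / Cnorm (z - b) * r * Cnorm (z - b)) with (Cnorm (F z - F b) * r) by (field; lra).
        set (X := (2 * Rabs C + 2 * Cnorm (F b)) * r ^ N).
        assert (HX : 2 * Cnorm (F z - F b) <= X).
        { unfold X. assert (Cnorm (F b) * 1 <= Cnorm (F b) * r ^ N) by (apply Rmult_le_compat_l; lra). lra. }
        pose proof (Cnorm_ge0 (F z - F b)).
        apply Rle_trans with (X * (r / 2)); [|apply Rmult_le_compat_l; lra].
        apply (Rmult_le_compat_r (r / 2)) in HX; lra.
      - intros eps rho He.
        assert (0 <= (1 + Cnorm (F b)) / eps) by (apply Rdiv_le_0_compat; [lra|auto]).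
        destruct (HS 1 (Rmax rho (Cnorm b + (1 + Cnorm (F b)) / eps)) ltac:(lra)) as [z [Hz [HzT H1]]].
        max_bounds rho (Cnorm b + (1 + Cnorm (F b)) / eps).
        assert (Hzb : z <> b) by (intros ->; lra).
        exists z; split; [lra|]. split; [tauto|].
        pose proof (Cnorm_sub_ge z b). pose proof (Cnorm_sub (F z) (F b)).
        rewrite EG2, Cnorm_div by (auto; apply Csub_neq0; auto).
        apply Rle_div_l; [apply Cnorm_sub_gt0; auto|].
        apply Rle_trans with (eps * ((1 + Cnorm (F b)) / eps)).
        + replace (eps * ((1 + Cnorm (F b)) / eps)) with (1 + Cnorm (F b)) by (field; lra). lra.
        + apply Rmult_le_compat_l; lra. }
    (* [G] vanishes off the exceptional points, so [F] equals the constant [F b] there, and its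
       small values far out force that constant to be 0. *)
    apply Cpx_eq_eps. intros eps He. replace (F b - C0)%cpx with (F b) by ring.
    destruct (HS eps (Cnorm b) He) as [z [Hz [HzT H1]]].
    assert (Hzb : z <> b) by (intros ->; lra).
    rewrite (EG z), G0 in H1 by tauto. replace (F b + (z - b) * C0)%cpx with (F b) in H1 by ring. auto.
Qed.

(** * Counting zeros by the mean value at the origin *)

Fixpoint linear_factors (l : list Cpx) (z : Cpx) : Cpx :=
  match l with nil => C1 | s :: l' => (C1 - z / s) * linear_factors l' z end%cpx.

(** Zeros are removed one at a time: since the points are distinct, the factors already split off do
    not vanish at [s], so the cofactor does. The constant [- s] comes from
    [z - s = - s * (1 - z / s)]. *)
Lemma divide_out_zeros (A : Cpx -> Cpx) (l : list Cpx) : entire A -> NoDup l ->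
  (forall s, In s l -> A s = C0 /\ s <> C0) ->
  exists B, holo_off B (fun z => In z l) /\ forall z, A z = (B z * linear_factors l z)%cpx.
Proof.
  intros HA. induction l as [|s l IH]; intros Hnd Hz.
  - exists A. split; [apply holo_off_entire; auto|]. intros z; simpl; ring.
  - inversion Hnd as [|? ? Hs Hnd']; subst.
    destruct IH as [B [HB EB]]; auto. { intros; apply Hz; right; auto. }
    destruct (Hz s (or_introl eq_refl)) as [As s0].
    assert (LF : forall m, ~ In s m -> (forall x, In x m -> x <> C0) -> linear_factors m s <> C0).
    { induction m as [|x m IHm]; intros Hm Hm0; simpl.
      - apply Cnorm_gt0_neq; rewrite Cnorm_C1; lra.
      - apply Cmul_neq0.
        + intros E. apply Hm; left. assert (x <> C0) by (apply Hm0; left; auto).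
          apply Csub_eq0. replace (x - s)%cpx with (x * (C1 - s / x))%cpx by (field; auto). rewrite E; ring.
        + apply IHm; [intros H; apply Hm; right; auto|intros; apply Hm0; right; auto]. }
    assert (Bs : B s = C0).
    { rewrite EB in As. apply Cmul_integral in As. destruct As as [E|E]; auto.
      exfalso. revert E. apply LF; auto. intros x Hx. apply Hz; right; auto. }
    destruct (proj2 HB s Hs) as [m Hm].
    destruct (divided_difference B _ s m HB Hm) as [G [HG [EG _]]].
    exists (fun z => (- s) * G z)%cpx. split.
    + apply holo_off_mul; [apply holo_off_entire, entire_const|].
      eapply holo_off_sub; [|exact HG]. simpl. intros z [H|H]; auto.
    + intros z. rewrite EB, (EG z), Bs. simpl. field. auto.
Qed.

(** A weak form of Jensen's inequality. On the circle of radius [5 * r] each factor [1 - z / s] has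
    modulus at least 4, while at the origin it equals 1; so the quotient keeps the value [A 0] but
    is smaller than [A] by [4 ^ length l] on the circle. *)
Lemma zero_count_bound (A : Cpx -> Cpx) (l : list Cpx) (r M : R) : entire A -> NoDup l -> 0 < r ->
  (forall s, In s l -> A s = C0 /\ s <> C0 /\ Cnorm s <= r) ->
  (forall z, Cnorm z = 5 * r -> Cnorm (A z) <= M) ->
  Cnorm (A C0) * 4 ^ length l <= 2 * M.
Proof.
  intros HA Hnd Hr Hl HM.
  destruct (divide_out_zeros A l HA Hnd) as [B [HB EB]]; [intros s Hs; destruct (Hl s Hs); tauto|].
  assert (L0 : forall m, linear_factors m C0 = C1).
  { induction m; simpl; auto. rewrite IHm. unfold Cdiv. ring. }
  assert (LB : forall z, Cnorm z = 5 * r -> 4 ^ length l <= Cnorm (linear_factors l z)).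
  { intros z Hz. clear - Hl Hr Hz. induction l as [|s l IH]; simpl.
    - rewrite Cnorm_C1; lra.
    - destruct (Hl s (or_introl eq_refl)) as [_ [s0 Hs]].
      rewrite Cnorm_mul. apply Rmult_le_compat; [lra|apply pow_le; lra| |apply IH; intros; apply Hl; right; auto].
      pose proof (Cnorm_gt0 s s0) as Hp.
      rewrite Cnorm_sub_sym. pose proof (Cnorm_sub_ge (z / s) C1) as H. rewrite Cnorm_C1, Cnorm_div, Hz in H by auto.
      assert (5 <= 5 * r / Cnorm s); [|lra].
      apply Rle_div_r; auto. lra. }
  assert (H4 : 0 < 4 ^ length l) by (apply pow_lt; lra).
  assert (DM : discrete_moduli (fun z => In z l)).
  { clear. induction l as [|s l IH].
    - intros r Hr; exists 1; split; [lra|]. intros z [].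
    - simpl. pose proof (discrete_moduli_union _ _ (discrete_moduli_point s) IH) as H.
      intros r Hr. destruct (H r Hr) as [d [Hd H1]]. exists d; split; auto.
      intros z [E|Hz]; apply H1; auto. }
  assert (E0 : A C0 = B C0) by (rewrite EB, L0; ring).
  rewrite E0, <- (mean_value B _ (5 * r) HB DM) by lra.
  apply (Rmult_le_reg_r (/ 4 ^ length l)); [apply Rinv_0_lt_compat; auto|].
  rewrite Rmult_assoc, Rinv_r, Rmult_1_r, Rmult_assoc by lra.
  apply cmean_bound.
  - apply path_cont_comp; [apply path_cont_polar|intros; apply HB].
  - intros th _. set (z := polar (5 * r) th). assert (Hz : Cnorm z = 5 * r) by (apply Cnorm_polar; lra).
    specialize (HM z Hz). specialize (LB z Hz). rewrite EB, Cnorm_mul in HM.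
    apply (Rmult_le_reg_r (4 ^ length l)); auto. rewrite Rmult_assoc, Rinv_l, Rmult_1_r by lra.
    eapply Rle_trans; [|exact HM]. apply Rmult_le_compat_l; auto. apply Cnorm_ge0.
Qed.

(** * Covers by intervals and rectangles *)

(** The upper end is excluded, unlike in [sum_f_R0], so the empty sum is available as a base
    case. *)
Fixpoint psum (f : nat -> R) (n : nat) : R :=
  match n with O => 0 | S k => psum f k + f k end.

Lemma psum_sum_f_R0 (f : nat -> R) (n : nat) : sum_f_R0 f n = psum f (S n).
Proof. induction n; simpl in *; lra. Qed.

Lemma psum_le (f g : nat -> R) (n : nat) : (forall k, (k < n)%nat -> f k <= g k) -> psum f n <= psum g n.
Proof. intros H. induction n; simpl; [lra|]. pose proof (H n ltac:(lia)). assert (psum f n <= psum g n) by (apply IHn; intros; apply H; lia). lra. Qed.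

Lemma psum_ext (f g : nat -> R) (n : nat) : (forall k, f k = g k) -> psum f n = psum g n.
Proof. intros H. induction n; simpl; [|rewrite IHn, H]; lra. Qed.

Lemma psum_plus (f g : nat -> R) (n : nat) : psum (fun k => f k + g k) n = psum f n + psum g n.
Proof. induction n; simpl; lra. Qed.

Lemma psum_scal (c : R) (f : nat -> R) (n : nat) : psum (fun k => c * f k) n = c * psum f n.
Proof. induction n; simpl; lra. Qed.

Lemma psum_mono (f : nat -> R) (m n : nat) : (forall k, 0 <= f k) -> (m <= n)%nat -> psum f m <= psum f n.
Proof. intros H L. induction L; simpl; [lra|]. specialize (H m0). lra. Qed.

Lemma psum_ge0 (f : nat -> R) (n : nat) : (forall k, 0 <= f k) -> 0 <= psum f n.
Proof. intros H. apply (psum_mono f 0 n H). lia. Qed.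

Lemma infinite_sum_psum (f : nat -> R) (l : R) :
  infinite_sum f l <-> forall eps, 0 < eps -> exists N, forall n, (N <= n)%nat -> Rabs (psum f n - l) < eps.
Proof.
  split; intros H eps He; destruct (H eps He) as [N HN].
  - exists (S N). intros [|n] Hn; [lia|]. rewrite <- psum_sum_f_R0. apply HN. lia.
  - exists N. intros n Hn. rewrite psum_sum_f_R0. apply HN. lia.
Qed.

Lemma psum_le_sum (f : nat -> R) (l : R) (n : nat) : (forall k, 0 <= f k) -> infinite_sum f l -> psum f n <= l.
Proof.
  intros Hp H. destruct (Rle_lt_dec (psum f n) l) as [L|L]; auto. exfalso.
  destruct (proj1 (infinite_sum_psum f l) H (psum f n - l)) as [N HN]; [lra|].
  specialize (HN (max n N) ltac:(lia)). pose proof (psum_mono f n (max n N) Hp ltac:(lia)).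
  apply Rabs_lt_between in HN. lra.
Qed.

Lemma infinite_sum_bounded (f : nat -> R) (M : R) : (forall k, 0 <= f k) -> (forall n, psum f n <= M) ->
  exists l, infinite_sum f l /\ l <= M.
Proof.
  intros Hp HM. destruct (completeness (fun y => exists n, y = psum f n)) as [l [H1 H2]].
  - exists M. intros y [n ->]; auto.
  - exists 0, O; auto.
  - exists l. split.
    + apply infinite_sum_psum. intros eps He.
      assert (Hn : exists N, l - eps < psum f N).
      { apply NNPP; intros Hn. assert (l <= l - eps); [|lra]. apply H2. intros y [n ->].
        apply Rnot_lt_le. intros HH; apply Hn; exists n; auto. }
      destruct Hn as [N HN]. exists N. intros n Hn.
      pose proof (psum_mono f N n Hp Hn). assert (psum f n <= l) by (apply H1; exists n; auto).
      apply Rabs_lt_between. lra.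
    + apply H2. intros y [n ->]; auto.
Qed.

Fixpoint lsum {T : Type} (f : T -> R) (l : list T) : R :=
  match l with nil => 0 | x :: l' => f x + lsum f l' end.

Lemma lsum_app {T : Type} (f : T -> R) (l l' : list T) : lsum f (l ++ l') = lsum f l + lsum f l'.
Proof. induction l; simpl; lra. Qed.

Lemma lsum_le {T : Type} (f g : T -> R) (l : list T) : (forall x, In x l -> f x <= g x) -> lsum f l <= lsum g l.
Proof.
  induction l; intros H; simpl; [lra|]. pose proof (H a (or_introl eq_refl)).
  assert (lsum f l <= lsum g l) by (apply IHl; intros; apply H; right; auto). lra.
Qed.

Lemma lsum_ext {T : Type} (f g : T -> R) (l : list T) : (forall x, In x l -> f x = g x) -> lsum f l = lsum g l.
Proof. intros H. apply Rle_antisym; apply lsum_le; intros; right; [|symmetry]; auto. Qed.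

Lemma lsum_scal {T : Type} (c : R) (f : T -> R) (l : list T) : lsum (fun x => c * f x) l = c * lsum f l.
Proof. induction l; simpl; lra. Qed.

Lemma lsum_ge0 {T : Type} (f : T -> R) (l : list T) : (forall x, In x l -> 0 <= f x) -> 0 <= lsum f l.
Proof.
  intros H. replace 0 with (lsum (fun _ : T => 0) l) by (induction l; simpl; [auto|rewrite IHl; [lra|intros; apply H; right; auto]]).
  apply lsum_le; auto.
Qed.

(** Pads a finite cover with degenerate members of size 0, to match the sequences in the definitions
    of density. *)
Lemma infinite_sum_list {T : Type} (f : T -> R) (d : T) (l : list T) : f d = 0 ->
  infinite_sum (fun k => f (nth k l d)) (lsum f l).
Proof.
  intros Hd.
  assert (E : forall n, (length l <= n)%nat -> psum (fun k => f (nth k l d)) n = lsum f l).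
  { assert (S0 : forall (g : nat -> R) n, psum g (S n) = g O + psum (fun k => g (S k)) n).
    { intros g n; induction n; simpl in *; lra. }
    induction l as [|x l IH]; intros n Hn.
    - simpl. induction n; simpl; auto. destruct n; rewrite IHn by (simpl; lia); simpl; lra.
    - destruct n as [|n]; [simpl in Hn; lia|]. rewrite S0. simpl. rewrite IH by (simpl in Hn; lia). lra. }
  apply infinite_sum_psum. intros eps He. exists (length l). intros n Hn.
  rewrite E by auto. rewrite Rminus_diag, Rabs_R0; auto.
Qed.

(** Merges two countable covers into one. *)
Definition interleave {T : Type} (u v : nat -> T) (k : nat) : T :=
  if Nat.even k then u (Nat.div2 k) else v (Nat.div2 k).

Lemma interleave_even {T : Type} (u v : nat -> T) (k : nat) : interleave u v (2 * k) = u k.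
Proof. unfold interleave. rewrite Nat.even_mul, Nat.div2_double. reflexivity. Qed.

Lemma interleave_odd {T : Type} (u v : nat -> T) (k : nat) : interleave u v (S (2 * k)) = v k.
Proof.
  unfold interleave. rewrite Nat.even_succ, Nat.odd_mul. simpl Nat.odd. cbn [andb].
  rewrite Nat.div2_succ_double. reflexivity.
Qed.

Lemma psum_interleave {T : Type} (f : T -> R) (u v : nat -> T) (n : nat) :
  psum (fun k => f (interleave u v k)) (2 * n) = psum (fun k => f (u k)) n + psum (fun k => f (v k)) n.
Proof.
  induction n; [simpl; lra|]. replace (2 * S n)%nat with (S (S (2 * n))) by lia.
  cbn [psum]. rewrite interleave_odd, interleave_even, IHn. lra.
Qed.

Lemma psum_interleave_le {T : Type} (f : T -> R) (u v : nat -> T) (L1 L2 : R) : (forall x, 0 <= f x) ->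
  (forall n, psum (fun k => f (u k)) n <= L1) -> (forall n, psum (fun k => f (v k)) n <= L2) ->
  forall n, psum (fun k => f (interleave u v k)) n <= L1 + L2.
Proof.
  intros Hf H1 H2 n. apply Rle_trans with (psum (fun k => f (interleave u v k)) (2 * n)).
  - apply psum_mono; [auto|lia].
  - rewrite psum_interleave. specialize (H1 n). specialize (H2 n). lra.
Qed.

Definition in_interval (a b x : R) : R :=
  if Rlt_dec a x then if Rlt_dec x b then 1 else 0 else 0.

Lemma in_interval_1 (a b x : R) : a < x < b -> in_interval a b x = 1.
Proof. intros. unfold in_interval. destruct (Rlt_dec a x); [|lra]. destruct (Rlt_dec x b); lra. Qed.

Lemma in_interval_ge0 (a b x : R) : 0 <= in_interval a b x.
Proof. unfold in_interval. destruct (Rlt_dec a x); [destruct (Rlt_dec x b)|]; lra. Qed.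

(** The length of the intersection of [(a, b)] with [(p, y)]. *)
Definition clipped_length (a b p y : R) : R := Rmax 0 (Rmin b y - Rmax a p).

Lemma clipped_length_mono (a b p y y' : R) : y <= y' -> clipped_length a b p y <= clipped_length a b p y'.
Proof. intros. unfold clipped_length, Rmax, Rmin. repeat destruct (Rle_dec _ _); lra. Qed.

Lemma clipped_length_step (a b p y y' : R) : p <= y <= y' -> a <= y -> y' <= b ->
  clipped_length a b p y + (y' - y) <= clipped_length a b p y'.
Proof. intros. unfold clipped_length, Rmax, Rmin. repeat destruct (Rle_dec _ _); lra. Qed.

Lemma clipped_length_le (a b p y : R) : a <= b -> clipped_length a b p y <= b - a.
Proof. intros. unfold clipped_length, Rmax, Rmin. repeat destruct (Rle_dec _ _); lra. Qed.

(* Real induction on the right end point replaces compactness and integration. *)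
Lemma weighted_interval_cover (c a b : nat -> R) (p q m : R) : p <= q -> 0 <= m ->
  (forall k, 0 <= c k) -> (forall k, a k <= b k) ->
  (forall x, p <= x <= q -> exists K, m < psum (fun k => c k * in_interval (a k) (b k) x) K) ->
  exists K, m * (q - p) <= psum (fun k => c k * (b k - a k)) K.
Proof.
  intros Hpq Hm Hc Hab H.
  set (len := fun y k => c k * clipped_length (a k) (b k) p y).
  assert (Hlen : forall y k, 0 <= len y k).
  { intros y k. apply Rmult_le_pos; auto. apply Rmax_l. }
  assert (Open : forall x K, exists h, 0 < h /\ forall k, (k < K)%nat ->
     a k < x < b k -> a k < x - h /\ x + h < b k).
  { intros x K; induction K as [|K [h [Hh IH]]]; [exists 1; split; [lra|lia]|].
    destruct (classic (a K < x < b K)) as [G|G].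
    - exists (Rmin h (Rmin ((x - a K) / 2) ((b K - x) / 2))).
      min_bounds h (Rmin ((x - a K) / 2) ((b K - x) / 2)).
      min_bounds ((x - a K) / 2) ((b K - x) / 2).
      split; [apply Rmin3_gt0; lra|]. intros k Hk Hx. destruct (Nat.eq_dec k K) as [->|Hne]; [lra|].
      destruct (IH k ltac:(lia) Hx). lra.
    - exists h; split; auto. intros k Hk Hx. destruct (Nat.eq_dec k K) as [->|Hne]; [tauto|].
      apply IH; auto; lia. }
  set (S := fun y => p <= y <= q /\ exists K, m * (y - p) <= psum (len y) K).
  assert (Sp : S p).
  { split; [lra|]. exists O. simpl. lra. }
  destruct (completeness S) as [s [Hs1 Hs2]].
  { exists q. intros y [Hy _]; lra. } { exists p; auto. }
  assert (Hsp : p <= s) by (apply Hs1; auto).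
  assert (Hsq : s <= q) by (apply Hs2; intros y [Hy _]; lra).
  destruct (H s ltac:(lra)) as [K0 HK0]. destruct (Open s K0) as [h [Hh HO]].
  assert (Hy : exists y, S y /\ s - h < y).
  { apply NNPP; intros Hn. assert (s <= s - h); [|lra]. apply Hs2. intros y Hy.
    apply Rnot_lt_le; intros HH; apply Hn; exists y; auto. }
  destruct Hy as [y [[Hyq [K HK]] Hyh]].
  assert (Hys : y <= s) by (apply Hs1; split; [lra|exists K; auto]).
  set (y' := Rmin q (s + h / 2)).
  assert (Hy' : y <= y' /\ y' <= q /\ y' <= s + h / 2) by (unfold y', Rmin; destruct (Rle_dec _ _); lra).
  assert (Sy' : exists K, m * (y' - p) <= psum (len y') K).
  { exists (max K K0).
    (* The intervals of index below [K0] that contain [s] contain all of [[y, y']], so each gains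
       the full length [y' - y]; together their weights exceed [m]. *)
    assert (D : psum (len y) (max K K0) + (y' - y) * psum (fun k => c k * in_interval (a k) (b k) s) K0
       <= psum (len y') (max K K0)).
    { set (del := fun k => len y' k - len y k).
      assert (Hdel : forall k, 0 <= del k).
      { intros k. unfold del, len. rewrite <- Rmult_minus_distr_l. apply Rmult_le_pos; auto.
        pose proof (clipped_length_mono (a k) (b k) p y y'). lra. }
      assert (E : psum (len y') (max K K0) = psum (len y) (max K K0) + psum del (max K K0)).
      { rewrite <- psum_plus. apply psum_ext. intros k; unfold del; lra. }
      rewrite E. apply Rplus_le_compat_l.
      apply Rle_trans with (psum del K0); [|apply psum_mono; auto; lia].
      rewrite <- psum_scal. apply psum_le. intros k Hk. unfold del, len, in_interval.
      assert (Z : (y' - y) * (c k * 0) <= del k) by (specialize (Hdel k); lra). unfold del, len in Z.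
      destruct (Rlt_dec (a k) s) as [A1|A1]; [destruct (Rlt_dec s (b k)) as [A2|A2]|]; auto.
      destruct (HO k Hk (conj A1 A2)) as [B1 B2].
      pose proof (clipped_length_step (a k) (b k) p y y' ltac:(lra) ltac:(lra) ltac:(lra)) as G.
      apply (Rmult_le_compat_l (c k)) in G; auto. lra. }
    pose proof (psum_mono (len y) K (max K K0) (Hlen y) ltac:(lia)).
    assert ((y' - y) * m <= (y' - y) * psum (fun k => c k * in_interval (a k) (b k) s) K0)
      by (apply Rmult_le_compat_l; lra).
    lra. }
  assert (Eq : y' = q).
  { unfold y', Rmin. destruct (Rle_dec q (s + h / 2)) as [G|G]; auto. exfalso.
    assert (y' <= s); [apply Hs1; split; auto; lra|]. unfold y', Rmin in *. destruct (Rle_dec q (s + h / 2)); lra. }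
  rewrite Eq in Sy'. destruct Sy' as [K1 HK1]. exists K1.
  eapply Rle_trans; [exact HK1|]. apply psum_le. intros k _. unfold len.
  apply Rmult_le_compat_l; auto. apply clipped_length_le; auto.
Qed.

Lemma psum_pick (f : nat -> R) (k : nat) : (forall j, 0 <= f j) -> f k <= psum f (S k).
Proof. intros H. simpl. pose proof (psum_ge0 f k H). lra. Qed.

(** The weighted lemma asks for a multiplicity strictly above [m], so it is used with every
    [m < 1]. *)
Lemma interval_cover_length (a b : nat -> R) (p q L : R) : p <= q -> (forall k, a k <= b k) ->
  (forall x, p <= x <= q -> exists k, a k < x < b k) ->
  (forall K, psum (fun k => b k - a k) K <= L) -> q - p <= L.
Proof.
  intros Hpq Hab Hcov HL.
  assert (G : forall m, 0 <= m < 1 -> m * (q - p) <= L).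
  { intros m Hm. destruct (weighted_interval_cover (fun _ => 1) a b p q m) as [K HK]; auto; try lra.
    - intros; lra.
    - intros x Hx. destruct (Hcov x Hx) as [k Hk]. exists (S k).
      assert (P : forall j, 0 <= 1 * in_interval (a j) (b j) x) by (intros; pose proof (in_interval_ge0 (a j) (b j) x); lra).
      pose proof (psum_pick _ k P) as H. cbv beta in H. rewrite (in_interval_1 (a k)) in H by auto. lra.
    - rewrite psum_scal in HK. specialize (HL K). lra. }
  destruct (Rle_lt_dec (q - p) L) as [|C]; auto. exfalso.
  assert (L0 : 0 <= L) by (specialize (HL O); simpl in HL; lra).
  specialize (G ((L / (q - p) + 1) / 2)).
  assert (0 <= L / (q - p) < 1).
  { split; [apply Rdiv_le_0_compat; lra|].
    apply Rlt_div_l; lra. }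
  replace ((L / (q - p) + 1) / 2 * (q - p)) with ((L + (q - p)) / 2) in G by (field; lra).
  specialize (G ltac:(lra)). lra.
Qed.

(** * Rectangles and planar covers *)

Record rect := Rect { rx1 : R; rx2 : R; ry1 : R; ry2 : R }.
Definition rect_ok (Q : rect) : Prop := rx1 Q <= rx2 Q /\ ry1 Q <= ry2 Q.
Definition rect_area (Q : rect) : R := (rx2 Q - rx1 Q) * (ry2 Q - ry1 Q).
Definition in_rect (Q : rect) (z : Cpx) : Prop := rx1 Q < fst z < rx2 Q /\ ry1 Q < snd z < ry2 Q.

Lemma rect_area_ge0 (Q : rect) : rect_ok Q -> 0 <= rect_area Q.
Proof. intros [H1 H2]. apply Rmult_le_pos; lra. Qed.

(** Fubini by covering: at a fixed height [y], the rectangles that meet this height have widths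
    adding up to more than any [m < q - p]; these widths are then the weights for the cover of
    [[r, s]] by the vertical sides. *)
Lemma rect_cover_area (Q : nat -> rect) (p q r s L : R) : p <= q -> r <= s -> (forall k, rect_ok (Q k)) ->
  (forall z, p <= fst z <= q -> r <= snd z <= s -> exists k, in_rect (Q k) z) ->
  (forall K, psum (fun k => rect_area (Q k)) K <= L) -> (q - p) * (s - r) <= L.
Proof.
  intros Hpq Hrs Hok Hcov HL.
  set (ix := fun k x => in_interval (rx1 (Q k)) (rx2 (Q k)) x).
  set (iy := fun k y => in_interval (ry1 (Q k)) (ry2 (Q k)) y).
  assert (L0 : 0 <= L) by (specialize (HL O); simpl in HL; lra).
  assert (G : forall m, 0 <= m < q - p -> m * (s - r) <= L).
  { intros m Hm.
    destruct (weighted_interval_cover (fun k => rx2 (Q k) - rx1 (Q k)) (fun k => ry1 (Q k)) (fun k => ry2 (Q k)) r s m)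
      as [K HK]; auto; try lra.
    - intros k. destruct (Hok k). lra.
    - intros k. apply Hok.
    (* The midpoint gives [m' < 1] and [m < m' * (q - p)], both strict, as the inner and the outer
       application require. *)
    - intros y Hy. set (m' := (m / (q - p) + 1) / 2).
      assert (Hmq : m / (q - p) < 1).
      { apply Rlt_div_l; lra. }
      assert (0 <= m / (q - p)) by (apply Rdiv_le_0_compat; [lra|lra]).
      destruct (weighted_interval_cover (fun k => iy k y) (fun k => rx1 (Q k)) (fun k => rx2 (Q k)) p q m')
        as [K HK]; auto.
      + unfold m'; lra.
      + intros k; apply in_interval_ge0.
      + intros k; apply Hok.
      + intros x Hx. destruct (Hcov (x, y) Hx Hy) as [k [Hk1 Hk2]]. exists (S k).
        assert (P : forall j, 0 <= iy j y * in_interval (rx1 (Q j)) (rx2 (Q j)) x)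
          by (intros; apply Rmult_le_pos; apply in_interval_ge0).
        apply Rlt_le_trans with 1; [unfold m'; lra|].
        eapply Rle_trans; [|apply (psum_pick _ k P)]. unfold iy. rewrite !in_interval_1 by auto. lra.
      + exists K. apply Rlt_le_trans with (m' * (q - p)).
        * unfold m'. replace ((m / (q - p) + 1) / 2 * (q - p)) with ((m + (q - p)) / 2) by (field; lra). lra.
        * eapply Rle_trans; [exact HK|]. apply psum_le. intros k _. unfold iy. lra.
    - specialize (HL K). unfold rect_area in HL. lra. }
  destruct (Rle_lt_dec ((q - p) * (s - r)) L) as [|C]; auto. exfalso.
  assert (Hsr : 0 < s - r).
  { destruct (Rle_lt_or_eq_dec r s Hrs) as [|E]; [lra|]. subst. rewrite Rminus_diag, Rmult_0_r in C. lra. }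
  assert (Hq : L / (s - r) < q - p).
  { apply Rlt_div_l; lra. }
  assert (0 <= L / (s - r)) by (apply Rdiv_le_0_compat; auto).
  specialize (G ((L / (s - r) + (q - p)) / 2) ltac:(lra)).
  replace ((L / (s - r) + (q - p)) / 2 * (s - r)) with ((L + (q - p) * (s - r)) / 2) in G by (field; lra). lra.
Qed.

(** Supplies circles that avoid both exceptional sets. Below [4 * M] each set has a cover of length
    at most [M / 2], too little for the interval [[2 * M, 7 / 2 * M]]. *)
Lemma zero_density_union_escape (E1 E2 : R -> Prop) : zero_linear_density E1 -> zero_linear_density E2 ->
  forall rho, exists r, rho < r /\ 0 < r /\ ~ E1 r /\ ~ E2 r.
Proof.
  intros H1 H2 rho.
  destruct (H1 (1 / 8) ltac:(lra)) as [R1 HR1]. destruct (H2 (1 / 8) ltac:(lra)) as [R2 HR2].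
  set (M := Rmax rho (Rmax R1 (Rmax R2 1))).
  assert (HM : rho <= M /\ R1 <= M /\ R2 <= M /\ 1 <= M).
  { unfold M, Rmax. repeat destruct (Rle_dec _ _); lra. }
  set (Rr := 4 * M).
  destruct (HR1 Rr ltac:(unfold Rr; lra)) as [a1 [b1 [l1 [B1 [C1' [S1 L1]]]]]].
  destruct (HR2 Rr ltac:(unfold Rr; lra)) as [a2 [b2 [l2 [B2 [C2 [S2 L2]]]]]].
  apply NNPP. intros Hn.
  set (u := interleave (fun k => (a1 k, b1 k)) (fun k => (a2 k, b2 k))).
  assert (Hok : forall k, fst (u k) <= snd (u k)).
  { intros k. unfold u, interleave. destruct (Nat.even k); simpl; auto. }
  assert (Habs : 7 / 2 * M - 2 * M <= l1 + l2).
  { apply (interval_cover_length (fun k => fst (u k)) (fun k => snd (u k))); auto; [lra| |].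
    - intros x Hx. destruct (classic (E1 x)) as [G|G].
      + destruct (C1' x G ltac:(unfold Rr; lra)) as [k Hk]. exists (2 * k)%nat. unfold u. rewrite interleave_even. auto.
      + destruct (classic (E2 x)) as [G'|G'].
        * destruct (C2 x G' ltac:(unfold Rr; lra)) as [k Hk]. exists (S (2 * k))%nat. unfold u. rewrite interleave_odd. auto.
        * exfalso. apply Hn. exists x. repeat split; auto; lra.
    (* The maximum with 0 makes [f] nonnegative on every pair, as [psum_interleave_le] requires. *)
    - set (f := fun v : R * R => Rmax 0 (snd v - fst v)).
      assert (Len : forall a b l, (forall k, a k <= b k) -> infinite_sum (fun k => b k - a k) l ->
        forall n, psum (fun k => f (a k, b k)) n <= l).
      { intros a b l Hab Hl n. rewrite (psum_ext _ (fun k => b k - a k)).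
        - apply psum_le_sum; auto. intros k; specialize (Hab k); lra.
        - intros k. unfold f; simpl. specialize (Hab k). rewrite Rmax_right; lra. }
      assert (HI : forall K, psum (fun k => f (u k)) K <= l1 + l2).
      { apply psum_interleave_le.
        - intros; apply Rmax_l.
        - apply Len; auto.
        - apply Len; auto. }
      intros K. eapply Rle_trans; [|apply (HI K)]. apply psum_le. intros k _. apply Rmax_r. }
  unfold Rr in *. lra.
Qed.

(** Upper bounds for areas always come from finite covers here, for which a union is a concatenation
    of lists. *)
Definition covered (S : Cpx -> Prop) (v : R) : Prop :=
  exists l : list rect, (forall Q, In Q l -> rect_ok Q) /\
    (forall z, S z -> exists Q, In Q l /\ in_rect Q z) /\ lsum rect_area l <= v.

Lemma covered_sub (S S' : Cpx -> Prop) (v v' : R) : (forall z, S z -> S' z) -> v' <= v ->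
  covered S' v' -> covered S v.
Proof. intros HS Hv [l [H1 [H2 H3]]]. exists l. repeat split; auto; [apply H1; auto..|lra]. Qed.

Lemma covered_union (S S' : Cpx -> Prop) (v v' : R) : covered S v -> covered S' v' ->
  covered (fun z => S z \/ S' z) (v + v').
Proof.
  intros [l [H1 [H2 H3]]] [l' [H1' [H2' H3']]]. exists (l ++ l'). split; [|split].
  - intros Q HQ. apply in_app_or in HQ. destruct HQ; auto.
  - intros z [Hz|Hz]; [destruct (H2 z Hz) as [Q [HQ G]]|destruct (H2' z Hz) as [Q [HQ G]]];
      exists Q; split; auto; apply in_or_app; auto.
  - rewrite lsum_app. lra.
Qed.

Lemma covered_rect (S : Cpx -> Prop) (Q : rect) : rect_ok Q -> (forall z, S z -> in_rect Q z) ->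
  covered S (rect_area Q).
Proof.
  intros HQ HS. exists (Q :: nil). split; [|split]; simpl.
  - intros Q' [<-|[]]; auto. - intros z Hz; exists Q; auto. - lra.
Qed.

Lemma covered_disc (r : R) : 0 <= r -> covered (fun z => Cnorm z < r) (4 * (r * r)).
Proof.
  intros Hr. eapply covered_sub; [| |apply (covered_rect (fun z => Cnorm z < r) (Rect (- r) r (- r) r))].
  - auto.
  - unfold rect_area; simpl; lra.
  - split; simpl; lra.
  - intros z Hz. pose proof (Cnorm_fst z) as F1. pose proof (Cnorm_snd z) as F2.
    apply Rabs_le_between in F1. apply Rabs_le_between in F2. split; simpl; lra.
Qed.

Lemma covered_empty (S : Cpx -> Prop) (v : R) : 0 <= v -> (forall z, ~ S z) -> covered S v.
Proof.
  intros Hv H. exists nil. split; [|split]; simpl; auto; [intros Q []|intros z Hz; destruct (H z Hz)].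
Qed.

Lemma covered_psum (S : nat -> Cpx -> Prop) (v : nat -> R) (m : nat) :
  (forall k, (k < m)%nat -> covered (S k) (v k)) ->
  covered (fun z => exists k, (k < m)%nat /\ S k z) (psum v m).
Proof.
  induction m; intros H.
  - apply covered_empty; simpl; [lra|]. intros z [k [Hk _]]. lia.
  - simpl. eapply covered_sub; [| |apply covered_union; [apply IHm; intros; apply H; lia|apply (H m); lia]].
    + intros z [k [Hk Hz]]. destruct (Nat.eq_dec k m) as [->|Hne]; [right; auto|left; exists k; split; auto; lia].
    + lra.
Qed.

Lemma covered_list {T : Type} (S : T -> Cpx -> Prop) (v : T -> R) (l : list T) :
  (forall x, In x l -> covered (S x) (v x)) ->
  covered (fun z => exists x, In x l /\ S x z) (lsum v l).
Proof.
  induction l; intros H.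
  - apply covered_empty; simpl; [lra|]. intros z [k [[] _]].
  - simpl. eapply covered_sub; [| |apply covered_union; [apply (H a); left; auto|apply IHl; intros; apply H; right; auto]].
    + intros z [k [[->|Hk] Hz]]; [left; auto|right; exists k; auto].
    + lra.
Qed.

Definition rect0 : rect := Rect 0 0 0 0.

Lemma area_outer_ge_covered (X S : Cpx -> Prop) (v w : R) : area_outer_ge X v ->
  (forall z, X z -> S z) -> covered S w -> v <= w.
Proof.
  intros HX HS [l [H1 [H2 H3]]]. eapply Rle_trans; [|exact H3].
  set (Q := fun k => nth k l rect0).
  assert (Hok : forall k, rect_ok (Q k)).
  { intros k. unfold Q. destruct (nth_in_or_default k l rect0) as [H| -> ]; auto. split; simpl; lra. }
  apply (HX (fun k => rx1 (Q k)) (fun k => rx2 (Q k)) (fun k => ry1 (Q k)) (fun k => ry2 (Q k))).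
  - intros k; apply Hok.
  - intros z Hz. destruct (H2 z (HS z Hz)) as [Q0 [HQ Hin]].
    destruct (In_nth l Q0 rect0 HQ) as [k [_ Hk]]. exists k. unfold Q. rewrite Hk. exact Hin.
  - apply (infinite_sum_list rect_area rect0 l). unfold rect_area; simpl; ring.
Qed.

(** A cover of [X] merged with the given cover of [Y] covers the closed rectangle, so its total area
    is at least that of the rectangle. *)
Lemma area_outer_ge_complement (X Y : Cpx -> Prop) (p q r s w : R) : p <= q -> r <= s ->
  (forall z, p <= fst z <= q -> r <= snd z <= s -> X z \/ Y z) -> covered Y w ->
  area_outer_ge X ((q - p) * (s - r) - w).
Proof.
  intros Hpq Hrs HXS [l [H1 [H2 H3]]] a b c d L Hab Hcov Hsum.
  set (Q := fun k => Rect (a k) (b k) (c k) (d k)). set (Q' := fun k => nth k l rect0).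
  assert (Hok : forall k, rect_ok (Q k)) by (intros k; apply Hab).
  assert (Hok' : forall k, rect_ok (Q' k)).
  { intros k. unfold Q'. destruct (nth_in_or_default k l rect0) as [H| -> ]; auto. split; simpl; lra. }
  assert (HI : forall k, rect_ok (interleave Q Q' k)).
  { intros k. unfold interleave. destruct (Nat.even k); auto. }
  set (f := fun Q => Rmax 0 (rect_area Q)).
  assert (Ef : forall Q, rect_ok Q -> f Q = rect_area Q) by (intros; apply Rmax_right, rect_area_ge0; auto).
  assert ((q - p) * (s - r) <= L + lsum rect_area l); [|lra].
  apply (rect_cover_area (interleave Q Q')); auto.
  - intros z Hx Hy. destruct (HXS z Hx Hy) as [Hz|Hz].
    + destruct (Hcov z Hz) as [k Hk]. exists (2 * k)%nat. rewrite interleave_even. exact Hk.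
    + destruct (H2 z Hz) as [Q0 [HQ Hin]]. destruct (In_nth l Q0 rect0 HQ) as [k [_ Hk]].
      exists (S (2 * k))%nat. rewrite interleave_odd. unfold Q'. rewrite Hk. exact Hin.
  - intros K. rewrite (psum_ext _ (fun k => f (interleave Q Q' k))) by (intros; rewrite Ef; auto).
    apply psum_interleave_le.
    + intros; apply Rmax_l.
    + intros n. rewrite (psum_ext _ (fun k => rect_area (Q k))) by (intros; auto).
      apply psum_le_sum; auto. intros; apply rect_area_ge0; auto.
    + intros n. rewrite (psum_ext _ (fun k => rect_area (Q' k))) by (intros; auto).
      apply psum_le_sum; [intros; apply rect_area_ge0; auto|].
      apply (infinite_sum_list rect_area rect0 l). unfold rect_area; simpl; ring.
Qed.

(** * Superlevel sets of potentials *)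

Lemma grid_cell (x0 s x : R) (m : nat) : (0 < m)%nat -> x0 <= x <= x0 + INR m * s ->
  exists i, (i < m)%nat /\ x0 + INR i * s <= x <= x0 + INR (S i) * s.
Proof.
  induction m as [|m IH]; intros Hm Hx; [lia|].
  destruct (Rle_lt_dec (x0 + INR m * s) x) as [G|G].
  - exists m. split; [lia|lra].
  - destruct m as [|m].
    + simpl in *. lra.
    + destruct IH as [i [Hi H]]; [lia|lra|]. exists i; split; [lia|auto].
Qed.

(** Comes from [sqrt u - sqrt (u - s) = s / (sqrt u + sqrt (u - s))]. *)
Lemma sqrt_step (u s : R) : 0 < s <= u -> s / sqrt u <= 2 * (sqrt u - sqrt (u - s)).
Proof.
  intros H. assert (Hu : 0 < sqrt u) by (apply sqrt_lt_R0; lra).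
  assert (Hus : sqrt (u - s) <= sqrt u) by (apply sqrt_le_1_alt; lra).
  assert (E1 : sqrt u * sqrt u = u) by (apply sqrt_sqrt; lra).
  assert (E2 : sqrt (u - s) * sqrt (u - s) = u - s) by (apply sqrt_sqrt; lra).
  pose proof (sqrt_pos (u - s)).
  apply Rle_div_l; auto.
  assert ((sqrt u - sqrt (u - s)) * sqrt (u - s) <= (sqrt u - sqrt (u - s)) * sqrt u)
    by (apply Rmult_le_compat_l; lra).
  lra.
Qed.

(* A telescoping majorant of the integral of |x - p|^(-1/2) over the i-th cell;
   [sqrt] of a negative number is 0. *)
Definition cell_weight (x0 s p : R) (i : nat) : R :=
  2 * (sqrt (x0 + INR i * s - p) - sqrt (x0 + INR i * s - p - s))
  + 2 * (sqrt (p - (x0 + INR (S i) * s)) - sqrt (p - (x0 + INR (S i) * s) - s)).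

Lemma cell_weight_ge0 (x0 s p : R) (i : nat) : 0 < s -> 0 <= cell_weight x0 s p i.
Proof.
  intros Hs. unfold cell_weight.
  assert (sqrt (x0 + INR i * s - p - s) <= sqrt (x0 + INR i * s - p)) by (apply sqrt_le_1_alt; lra).
  assert (sqrt (p - (x0 + INR (S i) * s) - s) <= sqrt (p - (x0 + INR (S i) * s))) by (apply sqrt_le_1_alt; lra).
  lra.
Qed.

(** Distance at least [2 * s] from [p] puts the whole cell on one side, with its near edge at
    distance at least [s], so [sqrt_step] applies at that edge. The first summand of the weight
    serves cells to the right of [p], the second those to the left. *)
Lemma cell_weight_bound (x0 s p x : R) (i : nat) : 0 < s ->
  x0 + INR i * s <= x <= x0 + INR (S i) * s -> 2 * s <= Rabs (x - p) ->
  s / sqrt (Rabs (x - p)) <= cell_weight x0 s p i.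
Proof.
  intros Hs Hx Hd. unfold cell_weight.
  assert (sqrt (x0 + INR i * s - p - s) <= sqrt (x0 + INR i * s - p)) by (apply sqrt_le_1_alt; lra).
  assert (sqrt (p - (x0 + INR (S i) * s) - s) <= sqrt (p - (x0 + INR (S i) * s))) by (apply sqrt_le_1_alt; lra).
  rewrite S_INR in *.
  assert (Mono : forall u v, 0 < u <= v -> s / sqrt v <= s / sqrt u).
  { intros u v Huv. apply Rmult_le_compat_l; [lra|]. apply Rinv_le_contravar; [apply sqrt_lt_R0; lra|apply sqrt_le_1_alt; lra]. }
  unfold Rabs in *. destruct (Rcase_abs (x - p)).
  - pose proof (sqrt_step (p - (x0 + (INR i + 1) * s)) s ltac:(lra)).
    pose proof (Mono (p - (x0 + (INR i + 1) * s)) (- (x - p)) ltac:(lra)). lra.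
  - pose proof (sqrt_step (x0 + INR i * s - p) s ltac:(lra)).
    pose proof (Mono (x0 + INR i * s - p) (x - p) ltac:(lra)). lra.
Qed.

Lemma cell_weight_sum (x0 s p : R) (m : nat) : 0 < s ->
  psum (cell_weight x0 s p) m <= 2 * sqrt (x0 + INR m * s - p) + 2 * sqrt (p - x0).
Proof.
  intros Hs.
  assert (E : psum (cell_weight x0 s p) m =
    2 * (sqrt (x0 + INR m * s - p - s) - sqrt (x0 - p - s))
    + 2 * (sqrt (p - x0 - s) - sqrt (p - (x0 + INR (S m) * s)))).
  { induction m; simpl psum.
    - simpl INR. replace (x0 + 0 * s - p - s) with (x0 - p - s) by ring.
      replace (p - (x0 + 1 * s)) with (p - x0 - s) by ring. ring.
    - rewrite IHm. unfold cell_weight. rewrite !S_INR.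
      replace (x0 + (INR m + 1) * s - p - s) with (x0 + INR m * s - p) by ring.
      replace (p - (x0 + (INR m + 1) * s) - s) with (p - (x0 + (INR m + 1 + 1) * s)) by ring. ring. }
  rewrite E. pose proof (sqrt_pos (x0 - p - s)). pose proof (sqrt_pos (p - (x0 + INR (S m) * s))).
  assert (sqrt (x0 + INR m * s - p - s) <= sqrt (x0 + INR m * s - p)) by (apply sqrt_le_1_alt; lra).
  assert (sqrt (p - x0 - s) <= sqrt (p - x0)) by (apply sqrt_le_1_alt; lra). lra.
Qed.

Lemma psum_lsum_swap {T : Type} (F : nat -> T -> R) (l : list T) (m : nat) :
  psum (fun i => lsum (F i) l) m = lsum (fun x => psum (fun i => F i x) m) l.
Proof.
  induction l; simpl.
  - induction m; simpl; lra.
  - rewrite <- IHl, <- psum_plus. reflexivity.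
Qed.

Definition potential (L : list (R * Cpx)) (z : Cpx) : R :=
  lsum (fun x : R * Cpx => fst x / Cnorm (z - snd x)) L.

(** The modulus dominates both coordinates, hence their geometric mean. This separates the
    variables, so that a sum over grid cells becomes a product of two one-dimensional sums. *)
Lemma inv_norm_le_split (z : Cpx) : fst z <> 0 -> snd z <> 0 ->
  / Cnorm z <= / sqrt (Rabs (fst z)) * / sqrt (Rabs (snd z)).
Proof.
  intros H1 H2. apply Rabs_pos_lt in H1, H2.
  pose proof (sqrt_lt_R0 _ H1) as S1. pose proof (sqrt_lt_R0 _ H2) as S2.
  rewrite <- Rinv_mult. apply Rinv_le_contravar; [apply Rmult_lt_0_compat; auto|].
  rewrite <- (sqrt_pow2 (Cnorm z)), <- sqrt_mult_alt by (try apply Cnorm_ge0; lra).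
  apply sqrt_le_1_alt. replace (Cnorm z ^ 2) with (Cnorm z * Cnorm z) by ring.
  apply Rmult_le_compat; try lra; [apply Cnorm_fst|apply Cnorm_snd].
Qed.

(* Chebyshev's inequality for the potential, on a grid fine enough that the strips
   of width 4s around the coordinates of the poles have negligible area. *)
Lemma potential_cover (L : list (R * Cpx)) (Rr lam kap : R) : 0 < Rr -> 0 < lam -> 0 < kap ->
  (forall x, In x L -> 0 <= fst x /\ Cnorm (snd x) <= 2 * Rr) ->
  covered (fun z => Rabs (fst z) <= Rr /\ Rabs (snd z) <= Rr /\
      ((exists x, In x L /\ z = snd x) \/ lam < potential L z))
    (432 * Rr * lsum fst L / lam + kap).
Proof.
  intros HR Hl Hk HL.
  set (NL := lsum (fun _ : R * Cpx => 1) L).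
  assert (HNL : 0 <= NL) by (apply lsum_ge0; intros; lra).
  (* With [s = 2 * Rr / INR m], such an [m] makes the strips around all poles, of area
     [16 * s * (Rr + 1)] per pole, fit into [kap]. *)
  destruct (INR_unbounded (1 + 32 * NL * Rr * (Rr + 1) / kap)) as [m Hm].
  assert (Hq : 0 <= 32 * NL * Rr * (Rr + 1) / kap).
  { apply Rdiv_le_0_compat; [repeat apply Rmult_le_pos; lra|auto]. }
  assert (HmI : 1 < INR m) by lra.
  assert (Hm0 : (0 < m)%nat) by (apply INR_lt; simpl; lra).
  set (s := 2 * Rr / INR m).
  assert (Hs : 0 < s) by (apply Rdiv_lt_0_compat; lra).
  assert (Ems : INR m * s = 2 * Rr) by (unfold s; field; lra).
  assert (Hstrip : NL * (16 * s * (Rr + 1)) <= kap).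
  { apply (Rmult_le_reg_r (INR m)); [lra|].
    replace (NL * (16 * s * (Rr + 1)) * INR m) with (32 * NL * Rr * (Rr + 1) / kap * kap)
      by (unfold s; field; lra).
    rewrite (Rmult_comm kap). apply Rmult_le_compat_r; lra. }
  set (x_ := fun i => - Rr + INR i * s).
  set (strip := fun (x : R * Cpx) (z : Cpx) => Rabs (fst z) <= Rr /\ Rabs (snd z) <= Rr /\
     (Rabs (fst z - fst (snd x)) < 2 * s \/ Rabs (snd z - snd (snd x)) < 2 * s)).
  assert (Cstrip : covered (fun z => exists x, In x L /\ strip x z) (lsum (fun _ => 16 * s * (Rr + 1)) L)).
  { apply covered_list. intros [w t] _. unfold strip; simpl.
    assert (V : covered (fun z => Rabs (fst z - fst t) < 2 * s /\ Rabs (snd z) <= Rr)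
      (rect_area (Rect (fst t - 2 * s) (fst t + 2 * s) (- Rr - 1) (Rr + 1)))).
    { apply covered_rect; [split; simpl; lra|]. intros z [H1 H2].
      apply Rabs_lt_between in H1. apply Rabs_le_between in H2. split; simpl; lra. }
    assert (H : covered (fun z => Rabs (snd z - snd t) < 2 * s /\ Rabs (fst z) <= Rr)
      (rect_area (Rect (- Rr - 1) (Rr + 1) (snd t - 2 * s) (snd t + 2 * s)))).
    { apply covered_rect; [split; simpl; lra|]. intros z [H1 H2].
      apply Rabs_lt_between in H1. apply Rabs_le_between in H2. split; simpl; lra. }
    eapply covered_sub; [| |apply (covered_union _ _ _ _ V H)].
    - intros z. simpl. tauto.
    - unfold rect_area; simpl. lra. }
  set (heavy := fun i j (z : Cpx) => x_ i <= fst z <= x_ (S i) /\ x_ j <= snd z <= x_ (S j) /\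
     (forall x, In x L -> 2 * s <= Rabs (fst z - fst (snd x)) /\ 2 * s <= Rabs (snd z - snd (snd x))) /\
     lam < potential L z).
  (* One heavy point in a cell already bounds [s^2 * lam] by the sum of mass times both cell
     weights. Since [in_rect] is strict, the cell is covered by its enlargement by [s] on each side,
     of area [9 * s^2]; hence [9 / lam]. *)
  set (h := fun i j => lsum (fun x : R * Cpx => 9 / lam * fst x *
     (cell_weight (- Rr) s (fst (snd x)) i * cell_weight (- Rr) s (snd (snd x)) j)) L).
  assert (Hterm : forall i j x, In x L -> 0 <= 9 / lam * fst x *
     (cell_weight (- Rr) s (fst (snd x)) i * cell_weight (- Rr) s (snd (snd x)) j)).
  { intros i j x Hx. apply Rmult_le_pos.
    - apply Rmult_le_pos; [left; apply Rdiv_lt_0_compat; lra|apply HL; auto].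
    - apply Rmult_le_pos; apply cell_weight_ge0; auto. }
  assert (Cheavy : forall i j, covered (heavy i j) (h i j)).
  { intros i j. destruct (classic (exists z, heavy i j z)) as [[z Hz]|Hn].
    - eapply covered_sub; [intros z' Hz'; exact Hz'| |
        apply (covered_rect _ (Rect (x_ i - s) (x_ (S i) + s) (x_ j - s) (x_ (S j) + s)))].
      + destruct Hz as [Hx [Hy [Hfar Hpot]]].
        assert (B : s * s * potential L z <= lam / 9 * h i j).
        { unfold potential, h. rewrite <- !lsum_scal. apply lsum_le. intros x Hx'. cbv beta.
          destruct (Hfar x Hx') as [F1 F2]. destruct (HL x Hx') as [W _].
          pose proof (cell_weight_bound (- Rr) s _ _ i Hs Hx F1) as B1.
          pose proof (cell_weight_bound (- Rr) s _ _ j Hs Hy F2) as B2.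
          set (ca := cell_weight (- Rr) s (fst (snd x)) i) in *.
          set (cb := cell_weight (- Rr) s (snd (snd x)) j) in *.
          pose proof (inv_norm_le_split (z - snd x)) as Hi.
          change (fst (z - snd x)%cpx) with (fst z - fst (snd x)) in Hi.
          change (snd (z - snd x)%cpx) with (snd z - snd (snd x)) in Hi.
          assert (N1 : fst z - fst (snd x) <> 0) by (intros E; rewrite E, Rabs_R0 in F1; lra).
          assert (N2 : snd z - snd (snd x) <> 0) by (intros E; rewrite E, Rabs_R0 in F2; lra).
          specialize (Hi N1 N2).
          set (u := sqrt (Rabs (fst z - fst (snd x)))) in *.
          set (v := sqrt (Rabs (snd z - snd (snd x)))) in *.
          assert (Hu : 0 < u) by (apply sqrt_lt_R0; lra). assert (Hv : 0 < v) by (apply sqrt_lt_R0; lra).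
          replace (lam / 9 * (9 / lam * fst x * (ca * cb))) with (fst x * (ca * cb)) by (field; lra).
          replace (s * s * (fst x / Cnorm (z - snd x))) with (fst x * (s * s * / Cnorm (z - snd x)))
            by (unfold Rdiv; ring).
          apply Rmult_le_compat_l; auto.
          apply Rle_trans with (s * s * (/ u * / v)).
          - apply Rmult_le_compat_l; auto. apply Rmult_le_pos; lra.
          - replace (s * s * (/ u * / v)) with ((s / u) * (s / v)) by (unfold Rdiv; ring).
            apply Rmult_le_compat; auto; left; apply Rdiv_lt_0_compat; auto. }
        assert (B2 : s * s * lam <= s * s * potential L z).
        { apply Rmult_le_compat_l; [apply Rmult_le_pos; lra|lra]. }
        unfold rect_area, x_; cbn [rx1 rx2 ry1 ry2]. rewrite !S_INR.
        replace ((- Rr + (INR i + 1) * s + s - (- Rr + INR i * s - s)) *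
           (- Rr + (INR j + 1) * s + s - (- Rr + INR j * s - s))) with (9 * (s * s)) by ring.
        apply (Rmult_le_reg_l (lam / 9)); [lra|].
        replace (lam / 9 * (9 * (s * s))) with (s * s * lam) by field. lra.
      + split; cbn [rx1 rx2 ry1 ry2]; unfold x_; rewrite S_INR; lra.
      + intros z' [Hx' [Hy' _]]. split; simpl; lra.
    - apply covered_empty.
      + apply lsum_ge0. auto.
      + intros z Hz; apply Hn; exists z; auto. }
  assert (Call : covered (fun z => exists i, (i < m)%nat /\ exists j, (j < m)%nat /\ heavy i j z)
     (psum (fun i => psum (h i) m) m)).
  { apply covered_psum. intros i _. apply covered_psum. auto. }
  eapply covered_sub; [| |apply (covered_union _ _ _ _ Call Cstrip)].
  - intros z [Hx [Hy Hz]]. apply Rabs_le_between in Hx as Hx'. apply Rabs_le_between in Hy as Hy'.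
    destruct (classic (exists x, In x L /\ strip x z)) as [G|G]; [right; auto|left].
    assert (Hfar : forall x, In x L -> 2 * s <= Rabs (fst z - fst (snd x)) /\ 2 * s <= Rabs (snd z - snd (snd x))).
    { intros x Hx0. apply NNPP. intros Hn. apply G. exists x; split; auto. unfold strip. repeat split; auto.
      destruct (Rlt_le_dec (Rabs (fst z - fst (snd x))) (2 * s)); auto.
      destruct (Rlt_le_dec (Rabs (snd z - snd (snd x))) (2 * s)); auto. exfalso; auto. }
    destruct (grid_cell (- Rr) s (fst z) m Hm0) as [i [Hi Hxi]]; [lra|].
    destruct (grid_cell (- Rr) s (snd z) m Hm0) as [j [Hj Hyj]]; [lra|].
    exists i; split; auto. exists j; split; auto. repeat split; try apply Hxi; try apply Hyj; try apply Hfar; auto.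
    destruct Hz as [[x [Hx0 ->]]|Hz]; auto. exfalso.
    destruct (Hfar x Hx0) as [F _]. rewrite Rminus_diag, Rabs_R0 in F. lra.
  - assert (E1 : lsum (fun _ : R * Cpx => 16 * s * (Rr + 1)) L = NL * (16 * s * (Rr + 1))).
    { unfold NL. rewrite (Rmult_comm (lsum _ L)), <- lsum_scal. apply lsum_ext; intros; ring. }
    rewrite E1. apply Rplus_le_compat; [|exact Hstrip].
    assert (E2 : psum (fun i => psum (h i) m) m = lsum (fun x : R * Cpx => 9 / lam * fst x *
      (psum (cell_weight (- Rr) s (fst (snd x))) m * psum (cell_weight (- Rr) s (snd (snd x))) m)) L).
    { rewrite (psum_ext _ (fun i => lsum (fun x : R * Cpx => 9 / lam * fst x *
        psum (cell_weight (- Rr) s (snd (snd x))) m * cell_weight (- Rr) s (fst (snd x)) i) L)).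
      - rewrite psum_lsum_swap. apply lsum_ext; intros; rewrite psum_scal; ring.
      - intros i. unfold h. rewrite psum_lsum_swap.
        apply lsum_ext. intros x _.
        rewrite (psum_ext _ (fun j => (9 / lam * fst x * cell_weight (- Rr) s (fst (snd x)) i) *
            cell_weight (- Rr) s (snd (snd x)) j)) by (intros; ring). rewrite psum_scal; ring. }
    rewrite E2. replace (432 * Rr * lsum fst L / lam) with (432 * Rr / lam * lsum fst L) by (field; lra).
    rewrite <- lsum_scal. apply lsum_le. intros x Hx. destruct (HL x Hx) as [W Ht].
    (* The coordinates of a pole are within [3 * Rr] of both ends of the grid. The product of the
       two sums is at most [16 * 3 * Rr], which with the factor 9 gives 432. *)
    assert (SB : forall p, Rabs p <= 2 * Rr -> psum (cell_weight (- Rr) s p) m <= 4 * sqrt (3 * Rr)).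
    { intros p Hp. apply Rabs_le_between in Hp. pose proof (cell_weight_sum (- Rr) s p m Hs) as B.
      assert (sqrt (- Rr + INR m * s - p) <= sqrt (3 * Rr)) by (apply sqrt_le_1_alt; lra).
      assert (sqrt (p - - Rr) <= sqrt (3 * Rr)) by (apply sqrt_le_1_alt; lra). lra. }
    pose proof (SB (fst (snd x)) ltac:(eapply Rle_trans; [apply Cnorm_fst|auto])) as B1.
    pose proof (SB (snd (snd x)) ltac:(eapply Rle_trans; [apply Cnorm_snd|auto])) as B2.
    assert (P1 : 0 <= psum (cell_weight (- Rr) s (fst (snd x))) m) by (apply psum_ge0; intros; apply cell_weight_ge0; auto).
    assert (P2 : 0 <= psum (cell_weight (- Rr) s (snd (snd x))) m) by (apply psum_ge0; intros; apply cell_weight_ge0; auto).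
    pose proof (Rmult_le_compat _ _ _ _ P1 P2 B1 B2) as B3.
    replace (4 * sqrt (3 * Rr) * (4 * sqrt (3 * Rr))) with (16 * (sqrt (3 * Rr) * sqrt (3 * Rr))) in B3 by ring.
    rewrite sqrt_sqrt in B3 by lra.
    assert (0 <= 9 / lam * fst x) by (apply Rmult_le_pos; auto; left; apply Rdiv_lt_0_compat; lra).
    apply (Rmult_le_compat_l (9 / lam * fst x)) in B3; auto.
    eapply Rle_trans; [exact B3|]. right. field. lra.
Qed.

(** * Cauchy transforms of discrete measures *)

Lemma Cpartial_fst (u : nat -> Cpx) (n : nat) : fst (Cpartial u n) = psum (fun k => fst (u k)) n.
Proof. induction n; simpl; [auto|rewrite IHn; auto]. Qed.

Lemma Cpartial_snd (u : nat -> Cpx) (n : nat) : snd (Cpartial u n) = psum (fun k => snd (u k)) n.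
Proof. induction n; simpl; [auto|rewrite IHn; auto]. Qed.

Lemma Cpartial_norm (u : nat -> Cpx) (n : nat) : Cnorm (Cpartial u n) <= psum (fun k => Cnorm (u k)) n.
Proof.
  induction n; simpl; [rewrite Cnorm_C0; lra|].
  eapply Rle_trans; [apply Cnorm_add|]. lra.
Qed.

Lemma Cseries_cv_abs (u : nat -> Cpx) (M : R) : (forall n, psum (fun k => Cnorm (u k)) n <= M) ->
  exists s, Cseries_cv u s.
Proof.
  intros HM.
  destruct (infinite_sum_bounded (fun k => Cnorm (u k)) M) as [l [Hl _]]; auto.
  { intros; apply Cnorm_ge0. }
  apply is_series_Reals in Hl.
  assert (E : forall v : nat -> R, (forall k, Rabs (v k) <= Cnorm (u k)) -> exists x, infinite_sum v x).
  { intros v Hv. destruct (ex_series_le (K := R_AbsRing) (V := R_CompleteNormedModule) v (fun k => Cnorm (u k))) as [x Hx].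
    - exact Hv. - exists l; auto. - exists x. apply is_series_Reals; auto. }
  destruct (E (fun k => fst (u k))) as [x Hx]; [intros; apply Cnorm_fst|].
  destruct (E (fun k => snd (u k))) as [y Hy]; [intros; apply Cnorm_snd|].
  exists (x, y). intros eps He.
  destruct (proj1 (infinite_sum_psum _ _) Hx (eps / 2)) as [N1 H1]; [lra|].
  destruct (proj1 (infinite_sum_psum _ _) Hy (eps / 2)) as [N2 H2]; [lra|].
  exists (max N1 N2). intros n Hn. eapply Rle_lt_trans; [apply Cnorm_le_abs|].
  simpl. rewrite Cpartial_fst, Cpartial_snd.
  specialize (H1 n ltac:(lia)). specialize (H2 n ltac:(lia)). unfold Rminus in *. lra.
Qed.

Lemma Cseries_cv_unique (u : nat -> Cpx) (s s' : Cpx) : Cseries_cv u s -> Cseries_cv u s' -> s = s'.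
Proof.
  intros H H'. apply Cpx_eq_eps. intros eps He.
  destruct (H (eps / 2)) as [N1 H1]; [lra|]. destruct (H' (eps / 2)) as [N2 H2]; [lra|].
  specialize (H1 (max N1 N2) ltac:(lia)). specialize (H2 (max N1 N2) ltac:(lia)).
  pose proof (Cnorm_tri s (Cpartial u (max N1 N2)) s'). rewrite (Cnorm_sub_sym s (Cpartial _ _)) in H0. lra.
Qed.

Lemma Cseries_cv_norm (u : nat -> Cpx) (s : Cpx) (B : R) (N : nat) : Cseries_cv u s ->
  (forall n, (N <= n)%nat -> Cnorm (Cpartial u n) <= B) -> Cnorm s <= B.
Proof.
  intros H HB. destruct (Rle_lt_dec (Cnorm s) B) as [|L]; auto. exfalso.
  destruct (H (Cnorm s - B)) as [N1 H1]; [lra|].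
  specialize (H1 (max N N1) ltac:(lia)). specialize (HB (max N N1) ltac:(lia)).
  rewrite Cnorm_sub_sym in H1. pose proof (Cnorm_sub_ge s (Cpartial u (max N N1))). lra.
Qed.

Lemma Cpartial_add (u v : nat -> Cpx) (n : nat) :
  Cpartial (fun k => u k + v k)%cpx n = (Cpartial u n + Cpartial v n)%cpx.
Proof. induction n; simpl; [ring|rewrite IHn; ring]. Qed.

Lemma Cpartial_scal (c : Cpx) (u : nat -> Cpx) (n : nat) :
  Cpartial (fun k => c * u k)%cpx n = (c * Cpartial u n)%cpx.
Proof. induction n; simpl; [ring|rewrite IHn; ring]. Qed.

Lemma Cpartial_ext (u v : nat -> Cpx) (n : nat) : (forall k, u k = v k) -> Cpartial u n = Cpartial v n.
Proof. intros H; induction n; simpl; [auto|rewrite IHn, H; auto]. Qed.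

Lemma Cseries_cv_add (u v : nat -> Cpx) (s s' : Cpx) : Cseries_cv u s -> Cseries_cv v s' ->
  Cseries_cv (fun k => u k + v k)%cpx (s + s')%cpx.
Proof.
  intros H H' eps He.
  destruct (H (eps / 2)) as [N1 H1]; [lra|]. destruct (H' (eps / 2)) as [N2 H2]; [lra|].
  exists (max N1 N2). intros n Hn. specialize (H1 n ltac:(lia)). specialize (H2 n ltac:(lia)).
  rewrite Cpartial_add.
  replace (Cpartial u n + Cpartial v n - (s + s'))%cpx with ((Cpartial u n - s) + (Cpartial v n - s'))%cpx by ring.
  eapply Rle_lt_trans; [apply Cnorm_add|]. lra.
Qed.

Lemma Cseries_cv_scal (c : Cpx) (u : nat -> Cpx) (s : Cpx) : Cseries_cv u s ->
  Cseries_cv (fun k => c * u k)%cpx (c * s)%cpx.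
Proof.
  intros H eps He. pose proof (Cnorm_ge0 c) as Hc.
  destruct (H (eps / (Cnorm c + 1))) as [N H1]; [apply Rdiv_lt_0_compat; lra|].
  exists N. intros n Hn. specialize (H1 n Hn). rewrite Cpartial_scal.
  replace (c * Cpartial u n - c * s)%cpx with (c * (Cpartial u n - s))%cpx by ring. rewrite Cnorm_mul.
  apply Rle_lt_trans with (Cnorm c * (eps / (Cnorm c + 1))); [apply Rmult_le_compat_l; lra|].
  apply (Rmult_lt_reg_r (Cnorm c + 1)); [lra|]. replace (Cnorm c * (eps / (Cnorm c + 1)) * (Cnorm c + 1))
    with (Cnorm c * eps) by (field; lra). lra.
Qed.

Lemma Cseries_cv_ext (u v : nat -> Cpx) (s : Cpx) : (forall k, u k = v k) -> Cseries_cv u s -> Cseries_cv v s.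
Proof.
  intros E H eps He. destruct (H eps He) as [N H1]. exists N. intros n Hn.
  rewrite <- (Cpartial_ext u v) by auto. auto.
Qed.

(** * The Cauchy transform off its poles *)

Definition tends_to_infinity (t : nat -> Cpx) : Prop :=
  forall M, exists N, forall n, (N <= n)%nat -> M < Cnorm (t n).

(** The denominator [1 + |t_k|] is independent of [z], and away from the poles [|z - t_k|] is at
    least a multiple of it. *)
Definition pole_weight (t b : nat -> Cpx) (k : nat) : R := Cnorm (b k) / (1 + Cnorm (t k)).

Definition summable_weights (t b : nat -> Cpx) (W : R) : Prop := forall n, psum (pole_weight t b) n <= W.

(* Junk value where the series diverges. *)
Definition cauchy (t b : nat -> Cpx) (z : Cpx) : Cpx :=
  epsilon (inhabits C0) (fun s => Cseries_cv (fun k => b k / (z - t k))%cpx s).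

(** Poles with coefficient 0 do not count, so that after [drop_pole] the transform can be studied at
    the dropped pole itself. *)
Definition off_poles (t b : nat -> Cpx) (z : Cpx) : Prop := forall k, b k <> C0 -> z <> t k.

Lemma pole_weight_ge0 (t b : nat -> Cpx) (k : nat) : 0 <= pole_weight t b k.
Proof.
  unfold pole_weight. apply Rmult_le_pos; [apply Cnorm_ge0|]. left; apply Rinv_0_lt_compat.
  pose proof (Cnorm_ge0 (t k)); lra.
Qed.

(** Poles of modulus above [2 |z| + 1] allow the ratio [1 / 4]; a minimum takes care of the finitely
    many others. *)
Lemma pole_distance (t b : nat -> Cpx) (z : Cpx) : tends_to_infinity t -> off_poles t b z ->
  exists d, 0 < d /\ forall k, b k <> C0 -> d * (1 + Cnorm (t k)) <= Cnorm (z - t k).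
Proof.
  intros Ht Hz. destruct (Ht (2 * Cnorm z + 1)) as [N HN]. pose proof (Cnorm_ge0 z) as Hz0.
  assert (Fin : forall m, exists d, 0 < d /\ forall k, (k < m)%nat -> b k <> C0 -> d * (1 + Cnorm (t k)) <= Cnorm (z - t k)).
  { induction m as [|m [d [Hd IH]]]; [exists 1; split; [lra|lia]|].
    destruct (classic (b m = C0)) as [E|E].
    - exists d; split; auto. intros k Hk Hb. destruct (Nat.eq_dec k m) as [->|Hne]; [tauto|apply IH; auto; lia].
    - pose proof (Cnorm_ge0 (t m)) as Htm. pose proof (Cnorm_sub_gt0 _ _ (Hz m E)) as Hp.
      assert (Hd' : 0 < Cnorm (z - t m) / (1 + Cnorm (t m))) by (apply Rdiv_lt_0_compat; lra).
      exists (Rmin d (Cnorm (z - t m) / (1 + Cnorm (t m)))). split; [apply Rmin_glb_lt; auto|].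
      intros k Hk Hb. destruct (Nat.eq_dec k m) as [->|Hne].
      + apply Rle_trans with (Cnorm (z - t m) / (1 + Cnorm (t m)) * (1 + Cnorm (t m))).
        * apply Rmult_le_compat_r; [lra|apply Rmin_r]. * right; field; lra.
      + eapply Rle_trans; [|apply (IH k); auto; lia]. apply Rmult_le_compat_r; [pose proof (Cnorm_ge0 (t k)); lra|apply Rmin_l]. }
  destruct (Fin N) as [d [Hd H]]. exists (Rmin d (1 / 4)). split; [apply Rmin_glb_lt; lra|].
  intros k Hb. pose proof (Cnorm_ge0 (t k)).
  destruct (Nat.lt_ge_cases k N) as [L|L].
  - eapply Rle_trans; [|apply H; auto]. apply Rmult_le_compat_r; [lra|apply Rmin_l].
  - specialize (HN k L). rewrite Cnorm_sub_sym. pose proof (Cnorm_sub_ge (t k) z).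
    apply Rle_trans with (1 / 4 * (1 + Cnorm (t k))); [apply Rmult_le_compat_r; [lra|apply Rmin_r]|lra].
Qed.

Lemma cauchy_term_bound (t b : nat -> Cpx) (z : Cpx) (d : R) (k : nat) : 0 < d ->
  (b k <> C0 -> d * (1 + Cnorm (t k)) <= Cnorm (z - t k)) ->
  Cnorm (b k / (z - t k)) <= / d * pole_weight t b k.
Proof.
  intros Hd H. unfold pole_weight. pose proof (Cnorm_ge0 (t k)) as Ht.
  destruct (classic (b k = C0)) as [E|E].
  - rewrite E. unfold Cdiv. rewrite Cnorm_mul, Cnorm_C0. right; field; lra.
  - specialize (H E). assert (0 < d * (1 + Cnorm (t k))) by (apply Rmult_lt_0_compat; lra).
    rewrite Cnorm_div by (apply Cnorm_gt0_neq; lra).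
    replace (/ d * (Cnorm (b k) / (1 + Cnorm (t k)))) with (Cnorm (b k) / (d * (1 + Cnorm (t k)))) by (field; lra).
    apply Rmult_le_compat_l; [apply Cnorm_ge0|]. apply Rinv_le_contravar; auto.
Qed.

Lemma cauchy_spec (t b : nat -> Cpx) (W : R) (z : Cpx) : tends_to_infinity t -> summable_weights t b W ->
  off_poles t b z -> Cseries_cv (fun k => b k / (z - t k))%cpx (cauchy t b z).
Proof.
  intros Ht HW Hz. destruct (pole_distance t b z Ht Hz) as [d [Hd H]].
  apply (epsilon_spec (inhabits C0) (fun s => Cseries_cv (fun k => b k / (z - t k))%cpx s)).
  apply (Cseries_cv_abs _ (/ d * W)). intros n.
  apply Rle_trans with (psum (fun k => / d * pole_weight t b k) n).
  - apply psum_le. intros k _. apply cauchy_term_bound; auto.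
  - rewrite psum_scal. apply Rmult_le_compat_l; auto. left; apply Rinv_0_lt_compat; auto.
Qed.

(** Termwise differentiation is justified by the exact remainder
    [b_k (w - z)^2 / ((z - t_k)^2 (w - t_k))], which is dominated by [pole_weight] uniformly for
    [|w - z| < d / 2]. *)
Lemma cauchy_derivable (t b : nat -> Cpx) (W : R) (z : Cpx) : tends_to_infinity t -> summable_weights t b W ->
  off_poles t b z -> cderivable (cauchy t b) z.
Proof.
  intros Ht HW Hz. destruct (pole_distance t b z Ht Hz) as [d [Hd H]].
  assert (HW0 : 0 <= W) by (specialize (HW O); simpl in HW; lra).
  assert (Hdi : 0 < / d) by (apply Rinv_0_lt_compat; auto).
  set (v := fun k => (- (b k / ((z - t k) * (z - t k))))%cpx).
  assert (Ht1 : forall k, 1 <= 1 + Cnorm (t k)) by (intros k; pose proof (Cnorm_ge0 (t k)); lra).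
  destruct (Cseries_cv_abs v (/ d * / d * W)) as [D HD].
  { intros n. apply Rle_trans with (psum (fun k => / d * / d * pole_weight t b k) n).
    - apply psum_le. intros k _. unfold v. rewrite Cnorm_opp.
      pose proof (cauchy_term_bound t b z d k Hd (H k)) as B.
      destruct (classic (b k = C0)) as [E|E].
      + rewrite E. unfold Cdiv. rewrite Cnorm_mul, Cnorm_C0, Rmult_0_l.
        apply Rmult_le_pos; [apply Rmult_le_pos; lra|apply pole_weight_ge0].
      + specialize (H k E). specialize (Ht1 k).
        assert (Hdt : d <= Cnorm (z - t k)).
        { apply Rle_trans with (d * (1 + Cnorm (t k))); auto. rewrite <- (Rmult_1_r d) at 1. apply Rmult_le_compat_l; lra. }
        assert (H0 : (z - t k)%cpx <> C0) by (apply Cnorm_gt0_neq; lra).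
        replace (b k / ((z - t k) * (z - t k)))%cpx with (Cinv (z - t k) * (b k / (z - t k)))%cpx by (field; auto).
        rewrite Cnorm_mul, Rmult_assoc. apply Rmult_le_compat; auto; try apply Cnorm_ge0.
        rewrite Cnorm_inv by auto. apply Rinv_le_contravar; auto.
    - rewrite psum_scal. apply Rmult_le_compat_l; auto. apply Rmult_le_pos; lra. }
  set (K := / d * / d * (2 * / d) * W).
  assert (HK : 0 <= K) by (unfold K; repeat apply Rmult_le_pos; lra).
  exists D. apply cderiv_atI. intros eps He.
  exists (Rmin (d / 2) (eps / (K + 1))). split.
  { apply Rmin_glb_lt; [lra|apply Rdiv_lt_0_compat; lra]. }
  intros w Hw. min_bounds (d / 2) (eps / (K + 1)).
  assert (Hw2 : forall k, b k <> C0 -> (d / 2) * (1 + Cnorm (t k)) <= Cnorm (w - t k)).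
  { intros k E. specialize (H k E). specialize (Ht1 k).
    pose proof (Cnorm_tri z w (t k)) as T. rewrite (Cnorm_sub_sym z w) in T.
    assert (d / 2 * 1 <= d / 2 * (1 + Cnorm (t k))) by (apply Rmult_le_compat_l; lra). lra. }
  assert (Hwo : off_poles t b w).
  { intros k E ->. specialize (Hw2 k E). rewrite Cnorm_sub_diag in Hw2.
    specialize (Ht1 k). assert (0 < d / 2 * (1 + Cnorm (t k))) by (apply Rmult_lt_0_compat; lra). lra. }
  pose proof (cauchy_spec t b W w Ht HW Hwo) as Sw. pose proof (cauchy_spec t b W z Ht HW Hz) as Sz.
  assert (S3 : Cseries_cv (fun k => (b k / (w - t k) + (- C1) * (b k / (z - t k))) + (- (w - z)) * v k)%cpx
     (cauchy t b w + (- C1) * cauchy t b z + (- (w - z)) * D)%cpx).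
  { apply Cseries_cv_add; [apply (Cseries_cv_add (fun k => b k / (w - t k))%cpx); auto|]; apply Cseries_cv_scal; auto. }
  replace (cauchy t b w - cauchy t b z - D * (w - z))%cpx with
    (cauchy t b w + (- C1) * cauchy t b z + (- (w - z)) * D)%cpx by ring.
  apply Rle_trans with (K * (Cnorm (w - z) * Cnorm (w - z))).
  - apply (Cseries_cv_norm _ _ _ O S3). intros n _.
    eapply Rle_trans; [apply Cpartial_norm|].
    apply Rle_trans with (psum (fun k => (/ d * / d * (2 * / d) * (Cnorm (w - z) * Cnorm (w - z))) * pole_weight t b k) n).
    + apply psum_le. intros k _. destruct (classic (b k = C0)) as [E|E].
      * unfold v. rewrite E. replace (C0 / (w - t k) + - C1 * (C0 / (z - t k)) + - (w - z) * - (C0 / ((z - t k) * (z - t k))))%cpx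
          with C0 by (unfold Cdiv; ring). rewrite Cnorm_C0.
        apply Rmult_le_pos; [|apply pole_weight_ge0]. repeat apply Rmult_le_pos; try lra; apply Cnorm_ge0.
      * specialize (H k E). specialize (Hw2 k E). specialize (Ht1 k).
        assert (Hd1 : d <= Cnorm (z - t k)).
        { apply Rle_trans with (d * (1 + Cnorm (t k))); auto. rewrite <- (Rmult_1_r d) at 1. apply Rmult_le_compat_l; lra. }
        assert (Hd2 : d / 2 <= Cnorm (w - t k)).
        { apply Rle_trans with (d / 2 * (1 + Cnorm (t k))); auto. rewrite <- (Rmult_1_r (d / 2)) at 1. apply Rmult_le_compat_l; lra. }
        assert (N1 : (z - t k)%cpx <> C0) by (apply Cnorm_gt0_neq; lra).
        assert (N2 : (w - t k)%cpx <> C0) by (apply Cnorm_gt0_neq; lra).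
        unfold v.
        replace (b k / (w - t k) + - C1 * (b k / (z - t k)) + - (w - z) * - (b k / ((z - t k) * (z - t k))))%cpx
          with (Cinv (z - t k) * (b k / (z - t k)) * Cinv (w - t k) * ((w - z) * (w - z)))%cpx by (field; auto).
        rewrite !Cnorm_mul, !Cnorm_inv by auto.
        pose proof (cauchy_term_bound t b z d k Hd (fun _ => H)) as B.
        assert (I1 : / Cnorm (z - t k) <= / d) by (apply Rinv_le_contravar; auto).
        assert (I2 : / Cnorm (w - t k) <= 2 * / d).
        { replace (2 * / d) with (/ (d / 2)) by (field; lra). apply Rinv_le_contravar; lra. }
        assert (0 <= / Cnorm (z - t k)) by (left; apply Rinv_0_lt_compat; lra).
        assert (0 <= / Cnorm (w - t k)) by (left; apply Rinv_0_lt_compat; lra).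
        replace (/ d * / d * (2 * / d) * (Cnorm (w - z) * Cnorm (w - z)) * pole_weight t b k) with
          (/ d * (/ d * pole_weight t b k) * (2 * / d) * (Cnorm (w - z) * Cnorm (w - z))) by ring.
        pose proof (Cnorm_ge0 (w - z)). pose proof (Cnorm_ge0 (b k / (z - t k))).
        apply Rmult_le_compat_r; [apply Rmult_le_pos; auto|].
        apply Rmult_le_compat; auto; [apply Rmult_le_pos; auto|].
        apply Rmult_le_compat; auto.
    + rewrite psum_scal. unfold K.
      replace (/ d * / d * (2 * / d) * W * (Cnorm (w - z) * Cnorm (w - z))) with
        (/ d * / d * (2 * / d) * (Cnorm (w - z) * Cnorm (w - z)) * W) by ring.
      apply Rmult_le_compat_l; auto. repeat apply Rmult_le_pos; try lra; apply Cnorm_ge0.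
  - rewrite <- Rmult_assoc. apply Rmult_le_compat_r; [apply Cnorm_ge0|].
    apply Rle_trans with (K * (eps / (K + 1))); [apply Rmult_le_compat_l; lra|].
    apply (Rmult_le_reg_r (K + 1)); [lra|]. replace (K * (eps / (K + 1)) * (K + 1)) with (K * eps) by (field; lra). lra.
Qed.

Definition drop_pole (b : nat -> Cpx) (n k : nat) : Cpx := if Nat.eq_dec k n then C0 else b k.

Lemma drop_pole_summable (t b : nat -> Cpx) (W : R) (n : nat) :
  summable_weights t b W -> summable_weights t (drop_pole b n) W.
Proof.
  intros HW m. eapply Rle_trans; [|apply (HW m)]. apply psum_le. intros k _. unfold pole_weight, drop_pole.
  destruct (Nat.eq_dec k n); [|lra]. rewrite Cnorm_C0. unfold Rdiv. rewrite Rmult_0_l. apply (pole_weight_ge0 t b k).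
Qed.

Lemma drop_pole_off (t b : nat -> Cpx) (n : nat) : (forall m n, t m = t n -> m = n) ->
  off_poles t (drop_pole b n) (t n).
Proof. intros Hinj k Hk E. apply Hk. unfold drop_pole. destruct (Nat.eq_dec k n); auto. exfalso; auto. Qed.

Lemma cauchy_split (t b : nat -> Cpx) (W : R) (n : nat) (z : Cpx) : tends_to_infinity t -> summable_weights t b W ->
  off_poles t b z -> z <> t n -> cauchy t b z = (b n / (z - t n) + cauchy t (drop_pole b n) z)%cpx.
Proof.
  intros Ht HW Hz Hn. pose proof (drop_pole_summable t b W n HW) as HW'.
  assert (E0 : drop_pole b n n = C0) by (unfold drop_pole; destruct (Nat.eq_dec n n); tauto).
  assert (E1 : forall k, k <> n -> drop_pole b n k = b k) by (intros k Hk; unfold drop_pole; destruct (Nat.eq_dec k n); tauto).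
  set (b' := drop_pole b n) in *.
  assert (Hz' : off_poles t b' z).
  { intros k Hk. destruct (Nat.eq_dec k n) as [->|Hne]; auto. rewrite E1 in Hk; auto. }
  apply (Cseries_cv_unique (fun k => b k / (z - t k))%cpx).
  - apply (cauchy_spec t b W); auto.
  - apply (Cseries_cv_ext (fun k => (if Nat.eq_dec k n then b n / (z - t n) else C0) + b' k / (z - t k))%cpx).
    + intros k. destruct (Nat.eq_dec k n) as [->|Hne]; [rewrite E0|rewrite E1 by auto]; unfold Cdiv; ring.
    + apply Cseries_cv_add; [|apply (cauchy_spec t b' W); auto].
      intros eps He. exists (S n). intros m Hm.
      assert (E : forall m, Cpartial (fun k => if Nat.eq_dec k n then (b n / (z - t n))%cpx else C0) m =
        if Compare_dec.le_lt_dec m n then C0 else (b n / (z - t n))%cpx).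
      { clear m Hm. induction m; cbn [Cpartial].
        - destruct (Compare_dec.le_lt_dec 0 n); [auto|lia].
        - rewrite IHm. destruct (Nat.eq_dec m n) as [->|Hne];
          repeat destruct (Compare_dec.le_lt_dec _ _); try lia; try ring. }
      rewrite E. destruct (Compare_dec.le_lt_dec m n); [lia|].
      replace (b n / (z - t n) - b n / (z - t n))%cpx with C0 by ring. rewrite Cnorm_C0; auto.
Qed.

(** A pole of modulus at least [2 |z|] is at distance at least [(1 + |t_k|) / 4]. For any other,
    [1 + |t_k| <= 3 |z|], so the assumed gap [(1 + |t_k|)^-M] is at least
    [(1 + |t_k|) * (3 |z|)^-(M+1)]. *)
Lemma cauchy_bound_circle (t b : nat -> Cpx) (W : R) (M : nat) (z : Cpx) :
  tends_to_infinity t -> summable_weights t b W -> 1 <= Cnorm z ->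
  (forall k, / (1 + Cnorm (t k)) ^ M <= Rabs (Cnorm z - Cnorm (t k))) ->
  Cnorm (cauchy t b z) <= 4 * (3 * Cnorm z) ^ S M * W.
Proof.
  intros Ht HW Hz H. set (X := (3 * Cnorm z) ^ S M).
  assert (Dist : forall k, Rabs (Cnorm z - Cnorm (t k)) <= Cnorm (z - t k)).
  { intros k. apply Rabs_le_between. pose proof (Cnorm_sub_ge z (t k)). pose proof (Cnorm_sub_ge (t k) z) as H1.
    rewrite Cnorm_sub_sym in H1. lra. }
  assert (Pos : forall k, 0 < / (1 + Cnorm (t k)) ^ M).
  { intros k. apply Rinv_0_lt_compat, pow_lt. pose proof (Cnorm_ge0 (t k)); lra. }
  assert (HX : 1 <= X) by (apply pow_R1_Rle; lra).
  assert (Hoff : off_poles t b z).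
  { intros k _ ->. specialize (H k). rewrite Rminus_diag, Rabs_R0 in H. specialize (Pos k). lra. }
  assert (HXi : 0 < / (4 * X)) by (apply Rinv_0_lt_compat; lra).
  apply (Cseries_cv_norm _ _ _ O (cauchy_spec t b W z Ht HW Hoff)). intros n _.
  eapply Rle_trans; [apply Cpartial_norm|].
  apply Rle_trans with (psum (fun k => 4 * X * pole_weight t b k) n);
    [|rewrite psum_scal; apply Rmult_le_compat_l; [lra|auto]].
  apply psum_le. intros k _. rewrite <- (Rinv_inv (4 * X)). apply cauchy_term_bound; auto. intros _.
  specialize (H k). specialize (Dist k). specialize (Pos k). pose proof (Cnorm_ge0 (t k)) as Htk.
  destruct (Rle_lt_dec (2 * Cnorm z) (Cnorm (t k))) as [L|L].
  - apply Rle_trans with (/ 4 * (1 + Cnorm (t k))).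
    + apply Rmult_le_compat_r; [lra|]. apply Rinv_le_contravar; lra.
    + rewrite Cnorm_sub_sym. pose proof (Cnorm_sub_ge (t k) z). lra.
  - eapply Rle_trans; [|eapply Rle_trans; [exact H|exact Dist]].
    assert (P1 : 0 < (1 + Cnorm (t k)) ^ M) by (apply pow_lt; lra).
    assert (P2 : (1 + Cnorm (t k)) ^ M <= (3 * Cnorm z) ^ M) by (apply pow_incr; lra).
    apply (Rmult_le_reg_l (4 * X)); [lra|]. rewrite <- Rmult_assoc, Rinv_r, Rmult_1_l by lra.
    apply (Rmult_le_reg_r ((1 + Cnorm (t k)) ^ M)); auto.
    rewrite Rmult_assoc, Rinv_l, Rmult_1_r by lra.
    apply Rle_trans with ((3 * Cnorm z) * (3 * Cnorm z) ^ M).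
    + apply Rmult_le_compat; lra.
    + change ((3 * Cnorm z) * (3 * Cnorm z) ^ M) with X. lra.
Qed.

(** Poles of modulus above [2 * Rr] are left out: inside the disc of radius [Rr] each contributes at
    most 4 times its weight, which a tail of the weights controls. *)
Fixpoint near_poles (t b : nat -> Cpx) (Rr : R) (N j : nat) : list (R * Cpx) :=
  match j with
  | O => nil
  | S j' => if Rle_dec (Cnorm (t (N + j')%nat)) (2 * Rr)
            then (Cnorm (b (N + j')%nat), t (N + j')%nat) :: near_poles t b Rr N j'
            else near_poles t b Rr N j'
  end.

Lemma near_poles_in (t b : nat -> Cpx) (Rr : R) (N j : nat) (x : R * Cpx) : In x (near_poles t b Rr N j) ->
  0 <= fst x /\ Cnorm (snd x) <= 2 * Rr.
Proof.
  induction j; simpl; [tauto|]. destruct (Rle_dec _ _); auto.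
  intros [<-|H]; auto. simpl. split; [apply Cnorm_ge0|auto].
Qed.

Lemma near_poles_mem (t b : nat -> Cpx) (Rr : R) (N j k : nat) : (N <= k < N + j)%nat -> Cnorm (t k) <= 2 * Rr ->
  exists x, In x (near_poles t b Rr N j) /\ snd x = t k.
Proof.
  induction j; intros Hk Ht; simpl; [lia|].
  destruct (Nat.eq_dec k (N + j)) as [->|Hne].
  - destruct (Rle_dec _ _); [|tauto]. eexists; split; [left; reflexivity|auto].
  - destruct IHj as [x [Hx E]]; [lia|auto|]. exists x; split; auto.
    destruct (Rle_dec _ _); auto. right; auto.
Qed.

Lemma near_poles_weight (t b : nat -> Cpx) (Rr : R) (N j : nat) : 0 < Rr ->
  lsum fst (near_poles t b Rr N j) <= (1 + 2 * Rr) * (psum (pole_weight t b) (N + j) - psum (pole_weight t b) N).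
Proof.
  intros HR. induction j.
  - rewrite Nat.add_0_r. simpl. lra.
  - rewrite Nat.add_succ_r. cbn [psum near_poles].
    pose proof (pole_weight_ge0 t b (N + j)) as Hp. pose proof (Cnorm_ge0 (t (N + j)%nat)) as Ht.
    assert (0 <= (1 + 2 * Rr) * pole_weight t b (N + j)) by (apply Rmult_le_pos; lra).
    destruct (Rle_dec _ _) as [L|L]; [|lra]. cbn [lsum fst].
    assert (Cnorm (b (N + j)%nat) <= (1 + 2 * Rr) * pole_weight t b (N + j)); [|lra].
    replace (Cnorm (b (N + j)%nat)) with ((1 + Cnorm (t (N + j)%nat)) * pole_weight t b (N + j))
      by (unfold pole_weight; field; lra).
    apply Rmult_le_compat_r; lra.
Qed.

Lemma near_poles_potential (t b : nat -> Cpx) (Rr : R) (N j : nat) (z : Cpx) : 1 <= Rr -> Cnorm z < Rr ->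
  (forall k, z <> t k) ->
  psum (fun k => Cnorm (b k / (z - t k))) (N + j) <=
    psum (fun k => Cnorm (b k / (z - t k))) N + potential (near_poles t b Rr N j) z
    + 4 * (psum (pole_weight t b) (N + j) - psum (pole_weight t b) N).
Proof.
  intros HR Hz Hoff. induction j.
  - rewrite Nat.add_0_r. unfold potential; simpl. lra.
  - rewrite Nat.add_succ_r. cbn [psum near_poles]. pose proof (pole_weight_ge0 t b (N + j)) as Hp.
    set (k := (N + j)%nat) in *.
    destruct (Rle_dec _ _) as [L|L].
    + unfold potential in *. cbn [lsum fst snd]. rewrite <- Cnorm_div by (apply Csub_neq0; auto). lra.
    + assert (Cnorm (b k / (z - t k)) <= / (1 / 4) * pole_weight t b k); [|lra].
      apply cauchy_term_bound; [lra|]. intros _. rewrite Cnorm_sub_sym. pose proof (Cnorm_sub_ge (t k) z). lra.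
Qed.

(** Only finitely many poles are near, so one list serves all long partial sums of the transform. *)
Lemma near_poles_stable (t b : nat -> Cpx) (Rr : R) (N j i : nat) :
  (forall k, (N + j <= k)%nat -> 2 * Rr < Cnorm (t k)) -> near_poles t b Rr N (j + i) = near_poles t b Rr N j.
Proof.
  intros H. induction i; [rewrite Nat.add_0_r; auto|]. rewrite Nat.add_succ_r. simpl.
  destruct (Rle_dec _ _) as [L|L]; auto. specialize (H (N + (j + i))%nat ltac:(lia)). lra.
Qed.

Lemma summable_tail (f : nat -> R) (W : R) : (forall k, 0 <= f k) -> (forall n, psum f n <= W) ->
  forall eta, 0 < eta -> exists N, forall n, psum f n - psum f N <= eta.
Proof.
  intros Hf HW eta He. destruct (infinite_sum_bounded f W Hf HW) as [l [Hl _]].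
  destruct (proj1 (infinite_sum_psum f l) Hl eta He) as [N HN]. exists N. intros n.
  specialize (HN N ltac:(lia)). apply Rabs_lt_between in HN.
  pose proof (psum_le_sum f l n Hf Hl). lra.
Qed.

Lemma finite_max (f : nat -> R) (N : nat) : exists M, 0 <= M /\ forall k, (k < N)%nat -> f k <= M.
Proof.
  induction N as [|N [M [HM IH]]]; [exists 0; split; [lra|lia]|].
  exists (Rmax M (f N)). split; [eapply Rle_trans; [exact HM|apply Rmax_l]|].
  intros k Hk. destruct (Nat.eq_dec k N) as [->|Hne]; [apply Rmax_r|].
  eapply Rle_trans; [apply IH; lia|apply Rmax_l].
Qed.

(* Finitely many poles contribute o(1); the remaining ones carry total mass
   O([eta * Rr]) inside the disc of radius [2 * Rr]. *)
Lemma cauchy_large_set_cover (t b : nat -> Cpx) (W eps kap : R) :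
  tends_to_infinity t -> summable_weights t b W -> 0 < eps -> 0 < kap ->
  exists R1, forall Rr, R1 < Rr ->
    covered (fun z => Cnorm z < Rr /\ ((exists k, z = t k) \/ eps < Cnorm (cauchy t b z))) (kap * Rr ^ 2).
Proof.
  intros Ht HW He Hk.
  (* [eps] is shared equally by the first [N] poles, the near ones and the far ones. The far ones
     give at most [4 * eta], hence [eps / 12]; for the near ones,
     [432 * Rr * (3 * Rr * eta) / (eps / 3)] must not exceed [kap / 4 * Rr ^ 2], hence 15552. *)
  set (eta := Rmin (eps / 12) (kap * eps / 15552)).
  assert (Hke : 0 < kap * eps) by (apply Rmult_lt_0_compat; auto).
  assert (Heta : 0 < eta) by (apply Rmin_glb_lt; lra).
  assert (Heta1 : eta <= eps / 12) by apply Rmin_l. assert (Heta2 : eta <= kap * eps / 15552) by apply Rmin_r.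
  destruct (summable_tail _ W (pole_weight_ge0 t b) HW eta Heta) as [N HN].
  destruct (finite_max (fun k => Cnorm (t k)) N) as [T0 [HT0 HT]].
  set (B := psum (fun k => Cnorm (b k)) N).
  assert (HB : 0 <= B) by (apply psum_ge0; intros; apply Cnorm_ge0).
  assert (HBe : 0 <= 6 * B / eps) by (apply Rdiv_le_0_compat; [lra|auto]).
  (* For [|z| >= R'] the first [N] poles are at distance at least [|z| / 2], and their contribution
     [2 * B / |z|] is at most [eps / 3]. The smaller disc is covered separately. *)
  set (R' := 1 + 2 * T0 + 6 * B / eps).
  assert (HR' : 1 <= R') by (unfold R'; lra).
  assert (HRk : 0 <= 16 * (R' * R') / kap).
  { apply Rdiv_le_0_compat; [|auto].
    assert (0 <= R' * R') by (apply Rmult_le_pos; lra). lra. }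
  exists (R' + 16 * (R' * R') / kap). intros Rr HR.
  destruct (Ht (2 * Rr)) as [N1 HN1].
  set (L := near_poles t b Rr N N1).
  assert (HR2 : Rr <= Rr ^ 2).
  { simpl. rewrite Rmult_1_r. rewrite <- (Rmult_1_r Rr) at 1. apply Rmult_le_compat_l; lra. }
  assert (C1' := covered_disc R' ltac:(lra)).
  assert (C2 := potential_cover L Rr (eps / 3) (kap / 4 * Rr ^ 2) ltac:(lra) ltac:(lra)
    ltac:(apply Rmult_lt_0_compat; lra) (fun x => near_poles_in t b Rr N N1 x)).
  eapply covered_sub; [| |apply (covered_union _ _ _ _ C1' C2)].
  - intros z [Hz Hbad]. destruct (Rlt_le_dec (Cnorm z) R') as [Hs|Hs]; [left; auto|right].
    split; [eapply Rle_trans; [apply Cnorm_fst|lra]|]. split; [eapply Rle_trans; [apply Cnorm_snd|lra]|].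
    destruct (classic (exists k, z = t k)) as [[k Ek]|Hoff].
    + left. assert (Hk1 : (N <= k < N + N1)%nat).
      { split.
        - destruct (Nat.lt_ge_cases k N) as [G|G]; auto. exfalso. specialize (HT k G). rewrite <- Ek in HT. unfold R' in Hs. lra.
        - destruct (Nat.lt_ge_cases k N1) as [G|G]; [lia|]. exfalso. specialize (HN1 k G). rewrite <- Ek in HN1. lra. }
      destruct (near_poles_mem t b Rr N N1 k Hk1) as [x [Hx E]]; [rewrite <- Ek; lra|].
      exists x; split; auto. congruence.
    + destruct Hbad as [G|Hbad]; [tauto|]. right.
      assert (Hof : forall k, z <> t k) by (intros k E; apply Hoff; exists k; auto).
      apply Rnot_le_lt. intros Hpot. apply (Rlt_not_le _ _ Hbad).
      apply (Cseries_cv_norm _ _ _ (N + N1) (cauchy_spec t b W z Ht HW (fun k _ => Hof k))).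
      intros n Hn. eapply Rle_trans; [apply Cpartial_norm|].
      pose proof (near_poles_potential t b Rr N (n - N) z ltac:(lra) Hz Hof) as P.
      replace (N + (n - N))%nat with n in P by lia.
      replace (n - N)%nat with (N1 + (n - N - N1))%nat in P by lia.
      rewrite near_poles_stable in P by (intros k Hk0; apply HN1; lia).
      fold L in P. specialize (HN n).
      assert (P0 : psum (fun k => Cnorm (b k / (z - t k))) N <= eps / 3).
      { apply Rle_trans with (psum (fun k => 2 / Cnorm z * Cnorm (b k)) N).
        - apply psum_le. intros k Hk0. specialize (HT k Hk0). pose proof (Cnorm_sub_ge z (t k)).
          assert (Cnorm z / 2 <= Cnorm (z - t k)) by (unfold R' in *; lra).
          rewrite Cnorm_div by (apply Csub_neq0; auto). rewrite Rmult_comm. apply Rmult_le_compat_l; [apply Cnorm_ge0|].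
          replace (2 / Cnorm z) with (/ (Cnorm z / 2)) by (field; lra). apply Rinv_le_contravar; lra.
        - rewrite psum_scal. fold B. apply (Rmult_le_reg_r (Cnorm z)); [lra|].
          replace (2 / Cnorm z * B * Cnorm z) with (eps / 3 * (6 * B / eps)) by (field; lra).
          apply Rmult_le_compat_l; [lra|]. unfold R' in *. lra. }
      lra.
  - pose proof (near_poles_weight t b Rr N N1 ltac:(lra)) as Wt. fold L in Wt.
    specialize (HN (N + N1)%nat).
    assert (W1 : lsum fst L <= 3 * Rr * eta).
    { eapply Rle_trans; [exact Wt|]. apply Rle_trans with ((1 + 2 * Rr) * eta).
      - apply Rmult_le_compat_l; lra. - apply Rmult_le_compat_r; lra. }
    assert (W2 : 432 * Rr * lsum fst L / (eps / 3) <= kap / 4 * Rr ^ 2).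
    { apply Rle_trans with (432 * Rr * (3 * Rr * (kap * eps / 15552)) / (eps / 3)).
      - unfold Rdiv. apply Rmult_le_compat_r; [left; apply Rinv_0_lt_compat; lra|].
        apply Rmult_le_compat_l; [lra|]. eapply Rle_trans; [exact W1|]. apply Rmult_le_compat_l; lra.
      - right. field. lra. }
    assert (W3 : 4 * (R' * R') <= kap / 4 * Rr ^ 2).
    { apply Rle_trans with (kap / 4 * (16 * (R' * R') / kap)); [right; field; lra|].
      apply Rmult_le_compat_l; lra. }
    assert (0 <= kap * Rr ^ 2) by (apply Rmult_le_pos; lra).
    lra.
Qed.

(** * The characterisation of the space *)

Lemma Rpower_le_pow (x y : R) (n : nat) : 1 <= x -> y <= INR n -> Rpower x y <= x ^ n.
Proof. intros Hx Hy. rewrite <- Rpower_pow by lra. apply Rle_Rpower; auto. Qed.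

Lemma exp_INR_le_pow4 (n : nat) : exp (INR n) <= 4 ^ n.
Proof.
  induction n; [simpl; rewrite exp_0; lra|]. rewrite S_INR, exp_plus. simpl.
  pose proof exp_le_3. pose proof (exp_pos 1). pose proof (exp_pos (INR n)).
  rewrite Rmult_comm. apply Rmult_le_compat; lra.
Qed.

(** Duplicate-free lists of indices stand for the counting function, without any cardinality of
    sets. *)
Definition polynomial_counting (t : nat -> Cpx) (P : nat) (C R1 : R) : Prop :=
  forall r (l : list nat), R1 <= r -> NoDup l -> (forall k, In k l -> Cnorm (t k) <= r) ->
    INR (length l) <= C * r ^ P.

(** For an integer [P] above the order, [|A|] is at most [exp ((5 * r) ^ P)] on the circle of radius
    [5 * r]. Taking logarithms in [zero_count_bound] gives the count; [K] absorbs [ln (2 / |A 0|)]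
    because [r >= 1]. *)
Lemma finite_order_counting (t : nat -> Cpx) (A : Cpx -> Cpx) : entire A -> finite_order A -> A C0 <> C0 ->
  (forall n, A (t n) = C0) -> (forall m n, t m = t n -> m = n) ->
  exists P C R1, 0 <= C /\ 1 <= R1 /\ polynomial_counting t P C R1.
Proof.
  intros HA [rho [R0 [Hrho HO]]] H0 Ht Hinj.
  destruct (INR_unbounded rho) as [P HP].
  pose proof (Cnorm_gt0 _ H0) as Ha. set (c := Cnorm (A C0)) in *.
  set (K := Rabs (ln (2 / c))).
  exists P, (K + 5 ^ P), (Rmax 1 R0).
  assert (HK : 0 <= K) by apply Rabs_pos. assert (H5 : 0 < 5 ^ P) by (apply pow_lt; lra).
  split; [lra|]. split; [apply Rmax_l|]. intros r l Hr Hnd Hl.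
  max_bounds 1 R0.
  assert (Hcount : c * 4 ^ length (map t l) <= 2 * exp ((5 * r) ^ P)).
  { apply (zero_count_bound A (map t l) r); auto; [|lra| |].
    - apply FinFun.Injective_map_NoDup; auto.
    - intros s Hs. apply in_map_iff in Hs. destruct Hs as [k [<- Hk]].
      split; [apply Ht|split; [|apply Hl; auto]]. intros E. apply H0. specialize (Ht k). rewrite E in Ht. exact Ht.
    - intros z Hz. eapply Rle_trans; [apply HO; lra|]. apply exp_le_mono. rewrite Hz.
      apply Rpower_le_pow; lra. }
  rewrite length_map in Hcount. set (n := length l) in *.
  assert (Hexp : exp (INR n) <= exp (ln (2 / c) + (5 * r) ^ P)).
  { rewrite exp_plus, exp_ln by (apply Rdiv_lt_0_compat; lra).
    eapply Rle_trans; [apply exp_INR_le_pow4|]. apply (Rmult_le_reg_l c); auto.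
    replace (c * (2 / c * exp ((5 * r) ^ P))) with (2 * exp ((5 * r) ^ P)) by (field; lra). auto. }
  assert (Hn : INR n <= ln (2 / c) + (5 * r) ^ P).
  { apply Rnot_lt_le. intros L. apply exp_increasing in L. lra. }
  eapply Rle_trans; [exact Hn|]. rewrite Rpow_mult_distr, Rmult_plus_distr_r. apply Rplus_le_compat_r.
  apply Rle_trans with K; [apply Rle_abs|]. rewrite <- (Rmult_1_r K) at 1. apply Rmult_le_compat_l; auto.
  apply pow_R1_Rle; lra.
Qed.

(** Windows that shrink like a power of [|t_k|] can have small total length, yet outside them the
    Cauchy transform loses only a power of [|z|]. *)
Definition exceptional_radii (t : nat -> Cpx) (M : nat) (x : R) : Prop :=
  0 < x /\ exists k, Rabs (x - Cnorm (t k)) < / (1 + Cnorm (t k)) ^ M.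

(* For x < R, the poles of modulus below sqrt R are absorbed by the single interval
   (0, sqrt R + 1); the others have short intervals, and are polynomially many. *)
Lemma exceptional_radii_density (t : nat -> Cpx) (P : nat) (C R1 : R) : tends_to_infinity t -> 0 <= C ->
  polynomial_counting t P C R1 -> zero_linear_density (exceptional_radii t (2 * (P + 1))).
Proof.
  (* Poles that are counted have modulus at least [sqrt Rr], so the exponent [2 * (P + 1)] makes
     their windows at most [/ Rr ^ (P + 1)], one power more than their number can compensate. *)
  intros Ht HC Hcount eps He. set (M := (2 * (P + 1))%nat).
  (* The first interval has length [sqrt Rr + 2] and the others add up to at most [2 * C * 2 ^ P];
     [sqrt Rr] and [K] each receive half of [eps * Rr]. *)
  set (K := 2 + 2 * C * 2 ^ P).
  assert (H2P : 0 < 2 ^ P) by (apply pow_lt; lra).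
  assert (HC2 : 0 <= C * 2 ^ P) by (apply Rmult_le_pos; lra).
  assert (HK : 0 < K) by (unfold K; lra).
  exists (Rmax (Rmax 1 R1) (Rmax ((2 / eps) ^ 2) (2 * K / eps))). intros Rr HR.
  max_bounds (Rmax 1 R1) (Rmax ((2 / eps) ^ 2) (2 * K / eps)).
  max_bounds 1 R1.
  max_bounds ((2 / eps) ^ 2) (2 * K / eps).
  assert (HR1 : 1 < Rr) by lra.
  assert (Hsq : sqrt Rr * sqrt Rr = Rr) by (apply sqrt_sqrt; lra).
  assert (Hs0 : 0 < sqrt Rr) by (apply sqrt_lt_R0; lra).
  assert (Hs2 : sqrt Rr <= eps / 2 * Rr).
  { assert (2 / eps <= sqrt Rr).
    { rewrite <- (sqrt_pow2 (2 / eps)) by (left; apply Rdiv_lt_0_compat; lra). apply sqrt_le_1_alt. lra. }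
    rewrite <- Hsq at 2. apply Rle_trans with (eps / 2 * (2 / eps * sqrt Rr)); [right; field; lra|].
    apply Rmult_le_compat_l; [lra|]. apply Rmult_le_compat_r; lra. }
  assert (HKR : K <= eps / 2 * Rr).
  { apply Rle_trans with (eps / 2 * (2 * K / eps)); [right; field; lra|]. apply Rmult_le_compat_l; lra. }
  destruct (Ht (Rr + 1)) as [N HN].
  set (keep := fun k => if Rle_dec (sqrt Rr) (Cnorm (t k)) then if Rle_dec (Cnorm (t k)) (Rr + 1) then true else false else false).
  set (l := filter keep (seq 0 N)).
  set (del := fun k => / (1 + Cnorm (t k)) ^ M).
  assert (Hdel : forall k, 0 < del k <= 1).
  { intros k. pose proof (Cnorm_ge0 (t k)).
    assert (1 <= (1 + Cnorm (t k)) ^ M) by (apply pow_R1_Rle; lra).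
    split; [apply Rinv_0_lt_compat; lra|]. rewrite <- Rinv_1. apply Rinv_le_contravar; lra. }
  set (I := (-1, sqrt Rr + 1) :: map (fun k => (Cnorm (t k) - del k, Cnorm (t k) + del k)) l).
  set (len := fun v : R * R => snd v - fst v).
  exists (fun k => fst (nth k I (0, 0))), (fun k => snd (nth k I (0, 0))), (lsum len I).
  split; [|split; [|split]].
  - intros k. destruct (nth_in_or_default k I (0, 0)) as [H'| -> ]; [|simpl; lra].
    destruct H' as [<-|H']; [simpl; lra|]. apply in_map_iff in H'. destruct H' as [j [<- _]].
    specialize (Hdel j). simpl; lra.
  - intros x [_ [k Hk]] Hx. fold (del k) in Hk. specialize (Hdel k). apply Rabs_lt_between in Hk.
    destruct (Rlt_le_dec x (sqrt Rr + 1)) as [L|L].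
    + exists O. simpl. lra.
    + assert (Hin : In (Cnorm (t k) - del k, Cnorm (t k) + del k) I).
      { right. apply (in_map (fun k => (Cnorm (t k) - del k, Cnorm (t k) + del k))).
        apply filter_In. split.
        - apply in_seq. split; [lia|]. destruct (Nat.lt_ge_cases k N) as [G|G]; [lia|].
          specialize (HN k G). lra.
        - unfold keep. destruct (Rle_dec (sqrt Rr) (Cnorm (t k))); [|lra].
          destruct (Rle_dec (Cnorm (t k)) (Rr + 1)); auto; lra. }
      destruct (In_nth I _ (0, 0) Hin) as [j [_ Hj]]. exists j. rewrite Hj. simpl. lra.
  - apply (infinite_sum_list len (0, 0) I). unfold len; simpl; ring.
  - assert (Hlen : INR (length l) <= C * (Rr + 1) ^ P).
    { apply Hcount; [lra|apply NoDup_filter, seq_NoDup|].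
      intros k Hk. apply filter_In in Hk. destruct Hk as [_ Hk]. unfold keep in Hk.
      destruct (Rle_dec (sqrt Rr) (Cnorm (t k))); [|discriminate].
      destruct (Rle_dec (Cnorm (t k)) (Rr + 1)); [auto|discriminate]. }
    assert (HRP : 0 < Rr ^ (P + 1)) by (apply pow_lt; lra).
    assert (Hsum : lsum len (map (fun k => (Cnorm (t k) - del k, Cnorm (t k) + del k)) l)
       <= INR (length l) * (2 / Rr ^ (P + 1))).
    { assert (Hk : forall k, In k l -> del k <= / Rr ^ (P + 1)).
      { intros k Hk. apply filter_In in Hk. destruct Hk as [_ Hk]. unfold keep in Hk.
        destruct (Rle_dec (sqrt Rr) (Cnorm (t k))); [|discriminate].
        apply Rinv_le_contravar; auto. unfold M. rewrite pow_mult.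
        apply pow_incr. split; [lra|]. rewrite <- Hsq. simpl. rewrite Rmult_1_r. apply Rmult_le_compat; lra. }
      revert Hk. generalize l. induction l0 as [|k l0 IH]; intros Hk; [simpl; lra|].
      cbn [map lsum length]. rewrite S_INR. unfold len at 1; cbn [fst snd].
      specialize (IH (fun j Hj => Hk j (or_intror Hj))). specialize (Hk k (or_introl eq_refl)).
      unfold Rdiv in *. lra. }
    assert (Hbound : INR (length l) * (2 / Rr ^ (P + 1)) <= 2 * C * 2 ^ P).
    { apply Rle_trans with (C * (2 * Rr) ^ P * (2 / Rr ^ (P + 1))).
      - apply Rmult_le_compat_r; [left; apply Rdiv_lt_0_compat; lra|].
        eapply Rle_trans; [exact Hlen|]. apply Rmult_le_compat_l; auto. apply pow_incr; lra.
      - rewrite Rpow_mult_distr, pow_add, pow_1. assert (0 < Rr ^ P) by (apply pow_lt; lra).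
        replace (C * (2 ^ P * Rr ^ P) * (2 / (Rr ^ P * Rr))) with (2 * (C * 2 ^ P) * / Rr) by (field; lra).
        rewrite <- (Rmult_1_r (2 * C * 2 ^ P)). rewrite <- (Rmult_assoc 2).
        apply Rmult_le_compat_l; [lra|]. rewrite <- Rinv_1. apply Rinv_le_contravar; lra. }
    unfold I. cbn [lsum]. unfold len at 1; cbn [fst snd]. unfold K in HKR. lra.
Qed.

(** Termwise [x * y <= x^2 + y^2], with [x = |a_k|] and [y = sqrt (mu k) / (1 + |t_k|)]. This turns
    the summability of [|a_k|^2] and of [mu k / (|t_k|^2 + 1)] into absolute convergence. *)
Lemma coefficient_weights (t a : nat -> Cpx) (mu : nat -> R) : l2 a -> (forall n, 0 < mu n) ->
  (exists l, infinite_sum (fun n => mu n / (Cnorm (t n) ^ 2 + 1)) l) ->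
  exists W, summable_weights t (fun n => a n * RtoC (sqrt (mu n)))%cpx W.
Proof.
  intros [la Hla] Hmu [lm Hlm]. exists (la + lm). intros n.
  assert (Hp : forall k, 0 < Cnorm (t k) ^ 2 + 1) by (intros k; pose proof (pow2_ge_0 (Cnorm (t k))); lra).
  apply Rle_trans with (psum (fun k => Cnorm (a k) ^ 2 + mu k / (Cnorm (t k) ^ 2 + 1)) n).
  - apply psum_le. intros k _. unfold pole_weight. specialize (Hmu k). specialize (Hp k).
    pose proof (Cnorm_ge0 (t k)) as Htk. pose proof (sqrt_sqrt (mu k) ltac:(lra)) as Hs. pose proof (sqrt_pos (mu k)).
    rewrite Cnorm_mul, Cnorm_RtoC, Rabs_pos_eq by auto.
    set (x := Cnorm (a k)). set (y := sqrt (mu k) / (1 + Cnorm (t k))).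
    replace (x * sqrt (mu k) / (1 + Cnorm (t k))) with (x * y) by (unfold y; field; lra).
    assert (Hy : y ^ 2 <= mu k / (Cnorm (t k) ^ 2 + 1)).
    { replace (y ^ 2) with (mu k / (1 + Cnorm (t k)) ^ 2) by (unfold y; rewrite <- Hs at 1; field; lra).
      apply Rmult_le_compat_l; [lra|]. apply Rinv_le_contravar; auto. simpl. lra. }
    pose proof (pow2_ge_0 (x - y)) as Hxy. pose proof (pow2_ge_0 x). pose proof (pow2_ge_0 y).
    simpl in *. lra.
  - rewrite psum_plus. apply Rplus_le_compat; apply psum_le_sum; auto.
    + intros; apply pow2_ge_0.
    + intros k. apply Rdiv_le_0_compat; [left; auto|auto].
Qed.

(** Giving coefficient 0 to a pole at [z], if there is one, lets [pole_distance] apply at [z]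
    itself. *)
Lemma poles_isolated (t : nat -> Cpx) (z : Cpx) : tends_to_infinity t ->
  exists d, 0 < d /\ forall w, 0 < Cnorm (w - z) < d -> forall k, w <> t k.
Proof.
  intros Ht. set (b := fun k => if excluded_middle_informative (z = t k) then C0 else C1).
  destruct (pole_distance t b z Ht) as [d [Hd H]].
  { intros k Hk E. apply Hk. unfold b. destruct (excluded_middle_informative (z = t k)); tauto. }
  exists d; split; auto. intros w Hw k ->. destruct (classic (z = t k)) as [E|E].
  - rewrite E in Hw. rewrite Cnorm_sub_diag in Hw. lra.
  - assert (Hb : b k <> C0).
    { unfold b. destruct (excluded_middle_informative (z = t k)); [tauto|].
      apply Cnorm_gt0_neq. rewrite Cnorm_C1. lra. }
    specialize (H k Hb). rewrite Cnorm_sub_sym in H. pose proof (Cnorm_ge0 (t k)).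
    assert (d * 1 <= d * (1 + Cnorm (t k))) by (apply Rmult_le_compat_l; lra). lra.
Qed.

Lemma poles_discrete_moduli (t : nat -> Cpx) : tends_to_infinity t -> discrete_moduli (fun z => exists n, z = t n).
Proof.
  intros Ht r Hr. destruct (Ht (r + 1)) as [N HN].
  assert (Fin : forall m, exists d, 0 < d /\ forall k, (k < m)%nat -> Rabs (Cnorm (t k) - r) < d -> Cnorm (t k) = r).
  { induction m as [|m [d [Hd IH]]]; [exists 1; split; [lra|lia]|].
    destruct (discrete_moduli_point (t m) r Hr) as [e [He H]].
    exists (Rmin d e); split; [apply Rmin_glb_lt; auto|]. min_bounds d e.
    intros k Hk Hkr. destruct (Nat.eq_dec k m) as [->|Hne]; [apply H; auto; lra|apply IH; [lia|lra]]. }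
  destruct (Fin N) as [d [Hd H]]. exists (Rmin d 1); split; [apply Rmin_glb_lt; lra|].
  min_bounds d 1.
  intros z [k ->] Hk. destruct (Nat.lt_ge_cases k N) as [L|L]; [apply H; auto; lra|].
  specialize (HN k L). apply Rabs_lt_between in Hk. lra.
Qed.

(** * Residues and continuous extension across the poles *)

Lemma Ccont_eq_punctured (f g : Cpx -> Cpx) (z : Cpx) (d : R) : 0 < d ->
  (forall w, 0 < Cnorm (w - z) < d -> f w = g w) -> Ccont f z -> Ccont g z -> f z = g z.
Proof.
  intros Hd E Hf Hg. apply Cpx_eq_eps. intros eps He.
  destruct (Hf (eps / 2)) as [d1 [Hd1 H1]]; [lra|]. destruct (Hg (eps / 2)) as [d2 [Hd2 H2]]; [lra|].
  set (h := Rmin d (Rmin d1 d2) / 2).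
  min_bounds d (Rmin d1 d2).
  min_bounds d1 d2. pose proof (Rmin3_gt0 d d1 d2 Hd Hd1 Hd2).
  assert (Hn : Cnorm (z + RtoC h - z) = h).
  { replace (z + RtoC h - z)%cpx with (RtoC h) by ring. rewrite Cnorm_RtoC, Rabs_pos_eq; unfold h; lra. }
  specialize (E (z + RtoC h)%cpx ltac:(rewrite Hn; unfold h; lra)).
  specialize (H1 (z + RtoC h)%cpx ltac:(rewrite Hn; unfold h; lra)).
  specialize (H2 (z + RtoC h)%cpx ltac:(rewrite Hn; unfold h; lra)).
  rewrite E in H1. rewrite Cnorm_sub_sym in H1. pose proof (Cnorm_tri (f z) (g (z + RtoC h)%cpx) (g z)). lra.
Qed.

(** Each point of [T] has its own local extension [g], so the values on [T] are chosen as limits of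
    [S]. By isolation, [F] agrees with [S] near any point, except possibly at the point itself. *)
Lemma extend_continuously (S : Cpx -> Cpx) (T : Cpx -> Prop) :
  (forall z, exists d, 0 < d /\ forall w, 0 < Cnorm (w - z) < d -> ~ T w) ->
  (forall z, ~ T z -> cderivable S z) ->
  (forall z, T z -> exists g d, 0 < d /\ Ccont g z /\ forall w, 0 < Cnorm (w - z) < d -> S w = g w) ->
  exists F, holo_off F T /\ forall z, ~ T z -> F z = S z.
Proof.
  intros Hiso HD HT.
  assert (HL : forall z, T z -> exists v, forall eps, 0 < eps -> exists d, 0 < d /\
     forall w, 0 < Cnorm (w - z) < d -> Cnorm (S w - v) < eps).
  { intros z Hz. destruct (HT z Hz) as [g [d [Hd [Hg E]]]]. exists (g z). intros eps He.
    destruct (Hg eps He) as [d1 [Hd1 H1]]. exists (Rmin d d1); split; [apply Rmin_glb_lt; auto|].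
    min_bounds d d1. intros w Hw. rewrite E by lra. apply H1; lra. }
  set (lim := fun z => epsilon (inhabits C0) (fun v => forall eps, 0 < eps -> exists d, 0 < d /\
     forall w, 0 < Cnorm (w - z) < d -> Cnorm (S w - v) < eps)).
  assert (Hlim : forall z, T z -> forall eps, 0 < eps -> exists d, 0 < d /\
     forall w, 0 < Cnorm (w - z) < d -> Cnorm (S w - lim z) < eps).
  { intros z Hz. apply (epsilon_spec (inhabits C0) (fun v => forall eps, 0 < eps -> exists d, 0 < d /\
     forall w, 0 < Cnorm (w - z) < d -> Cnorm (S w - v) < eps)). auto. }
  set (F := fun z => if excluded_middle_informative (T z) then lim z else S z).
  assert (FT : forall z, T z -> F z = lim z) by (intros z Hz; unfold F; destruct (excluded_middle_informative (T z)); tauto).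
  assert (FS : forall z, ~ T z -> F z = S z) by (intros z Hz; unfold F; destruct (excluded_middle_informative (T z)); tauto).
  exists F. split; auto.
  assert (FD : forall z, ~ T z -> cderivable F z).
  { intros z Hz. destruct (Hiso z) as [d [Hd H]]. apply (cderivable_local S F z d Hd); auto.
    intros w Hw. symmetry; apply FS. destruct (classic (w = z)) as [->|Hne]; auto.
    apply H. split; auto. apply Cnorm_sub_gt0; auto. }
  split; auto. intros z. destruct (classic (T z)) as [Hz|Hz]; [|apply cderivable_cont; auto].
  intros eps He. destruct (Hlim z Hz eps He) as [d [Hd H]]. destruct (Hiso z) as [d1 [Hd1 H1]].
  exists (Rmin d d1); split; [apply Rmin_glb_lt; auto|]. min_bounds d d1.
  intros w Hw. rewrite (FT z Hz). destruct (classic (w = z)) as [->|Hne].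
  - rewrite (FT z Hz). rewrite Cnorm_sub_diag; auto.
  - pose proof (Cnorm_sub_gt0 w z Hne). rewrite FS by (apply H1; lra). apply H; lra.
Qed.

(** Writing [A z = (z - t n) * G z] and separating the pole at [t n] gives
    [f z = G z * b n + (z - t n) * (...)] with continuous right side, so the identity passes to
    [z = t n], where [G] is the derivative of [A]. The norm formula follows from this. *)
Lemma representation_residue (t b : nat -> Cpx) (A f : Cpx -> Cpx) (W : R) (n : nat) (l : Cpx) :
  tends_to_infinity t -> (forall m n, t m = t n -> m = n) -> summable_weights t b W ->
  entire A -> A (t n) = C0 -> has_cderiv A (t n) l -> Ccont f (t n) ->
  (forall z, (forall k, z <> t k) -> f z = (A z * cauchy t b z)%cpx) -> f (t n) = (l * b n)%cpx.
Proof.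
  intros Ht Hinj HW HA HAn Hl Hf Hrep.
  destruct (poles_isolated t (t n) Ht) as [d [Hd Hiso]].
  destruct (divided_difference A (fun _ => False) (t n) l (holo_off_entire _ _ HA) Hl) as [G [[HG _] [EG Gn]]].
  assert (Hb' : forall z, off_poles t b z -> z <> t n -> cauchy t b z = (b n / (z - t n) + cauchy t (drop_pole b n) z)%cpx).
  { intros z Hz Hzn. apply (cauchy_split t b W); auto. }
  pose proof (drop_pole_summable t b W n HW) as HW'. pose proof (drop_pole_off t b n Hinj) as Hoff'.
  set (b' := drop_pole b n) in *.
  assert (E : f (t n) = (G (t n) * b n + (t n - t n) * (G (t n) * cauchy t b' (t n)))%cpx).
  { apply (Ccont_eq_punctured f (fun z => G z * b n + (z - t n) * (G z * cauchy t b' z))%cpx (t n) d Hd); auto.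
    - intros w Hw. assert (Hwn : w <> t n) by (apply Hiso; auto).
      rewrite Hrep by (apply Hiso; auto). rewrite Hb' by (auto; intros k _; apply Hiso; auto).
      rewrite (EG w), HAn. field. apply Csub_neq0; auto.
    - apply Ccont_add; apply Ccont_mul; auto; try apply Ccont_const.
      + apply Ccont_sub; [apply Ccont_id|apply Ccont_const].
      + apply Ccont_mul; auto. apply cderivable_cont, (cauchy_derivable t b' W); auto. }
  rewrite E, Gn. ring.
Qed.

(** With [A = (z - t n) * A1], the value prescribed for [f] at [t n] makes [f - b n * A1] vanish
    there, say equal to [(z - t n) * G]. Then [f / A - b n / (z - t n) = G / A1], which is
    continuous. *)
Lemma quotient_minus_cauchy_extends (t b : nat -> Cpx) (A f : Cpx -> Cpx) (W : R) (n : nat) (l : Cpx) :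
  tends_to_infinity t -> (forall m n, t m = t n -> m = n) -> summable_weights t b W ->
  entire A -> (forall z, A z = C0 -> exists k, z = t k) -> A (t n) = C0 -> has_cderiv A (t n) l -> l <> C0 ->
  entire f -> f (t n) = (l * b n)%cpx ->
  exists g d, 0 < d /\ Ccont g (t n) /\
    forall w, 0 < Cnorm (w - t n) < d -> (f w / A w - cauchy t b w)%cpx = g w.
Proof.
  intros Ht Hinj HW HA HA0 HAn Hl Hl0 Hf Hfn.
  destruct (poles_isolated t (t n) Ht) as [d [Hd Hiso]].
  destruct (divided_difference A (fun _ => False) (t n) l (holo_off_entire _ _ HA) Hl) as [A1 [HA1 [EA1 A1n]]].
  (* Removability is essential here: [f - b n * A1] is divided by [z - t n] in turn, so [A1] must be
     differentiable at [t n]. *)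
  assert (HA1e : entire A1).
  { apply (removable_singularity A1 (t n)). eapply holo_off_sub; [|exact HA1]. simpl; tauto. }
  set (g := fun z => (f z - b n * A1 z)%cpx).
  assert (Hg : entire g).
  { intros z. apply cderivable_sub; [apply Hf|]. apply cderivable_mul; [apply cderivable_const|apply HA1e]. }
  destruct (Hg (t n)) as [m Hm].
  destruct (divided_difference g (fun _ => False) (t n) m (holo_off_entire _ _ Hg) Hm) as [G [[HG _] [EG _]]].
  assert (Hgn : g (t n) = C0) by (unfold g; rewrite Hfn, A1n; ring).
  pose proof (drop_pole_summable t b W n HW) as HW'. pose proof (drop_pole_off t b n Hinj) as Hoff'.
  exists (fun z => G z / A1 z - cauchy t (drop_pole b n) z)%cpx, d. split; auto. split.
  - apply Ccont_sub.
    + apply Ccont_div; auto; [apply HA1|]. rewrite A1n; auto.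
    + apply cderivable_cont, (cauchy_derivable t (drop_pole b n) W); auto.
  - intros w Hw. pose proof (Hiso w Hw) as Hwk.
    rewrite (cauchy_split t b W n w Ht HW (fun k _ => Hwk k) (Hwk n)).
    assert (HAw : A w <> C0) by (intros Ew; destruct (HA0 w Ew) as [k Hk]; apply (Hwk k); auto).
    assert (Hwn : (w - t n)%cpx <> C0) by (apply Csub_neq0; auto).
    assert (HEw : A w = ((w - t n) * A1 w)%cpx) by (rewrite (EA1 w), HAn; ring).
    assert (HA1w : A1 w <> C0) by (intros Ew; apply HAw; rewrite HEw, Ew; ring).
    assert (HGw : f w = ((w - t n) * G w + b n * A1 w)%cpx).
    { specialize (EG w). rewrite Hgn in EG. unfold g in EG.
      replace (f w) with ((f w - b n * A1 w) + b n * A1 w)%cpx by ring. rewrite EG. ring. }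
    rewrite HEw, HGw. field. auto.
Qed.

(** A diagonal construction: level [/ INR (S k)] is imposed only beyond [rad k], chosen so that its
    bad set inside the disc of radius [rad k] is small. A point of that disc can violate only levels
    of index [j < k], which are weaker, so every violation lies in the bad set of [k]. The demand
    [INR k <= r] makes the radii unbounded. *)
Lemma sublevel_set_density (t b : nat -> Cpx) (W : R) : tends_to_infinity t -> summable_weights t b W ->
  exists Om, positive_upper_area_density Om /\ (forall z, Om z -> forall k, z <> t k) /\
    forall eps, 0 < eps -> exists R0, forall z, Om z -> R0 < Cnorm z -> Cnorm (cauchy t b z) <= eps.
Proof.
  intros Ht HW.
  set (bad := fun k r z => Cnorm z < r /\ ((exists j, z = t j) \/ / INR (S k) < Cnorm (cauchy t b z))).
  assert (HI : forall k, 0 < / INR (S k)) by (intros; apply Rinv_0_lt_compat, lt_0_INR; lia).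
  assert (Pick : forall k r0, exists r, r0 < r /\ 1 <= r /\ INR k <= r /\ covered (bad k r) (1 / 9 * r ^ 2)).
  { intros k r0. destruct (cauchy_large_set_cover t b W (/ INR (S k)) (1 / 9) Ht HW (HI k) ltac:(lra)) as [R1 H].
    exists (Rmax (Rmax r0 R1) (Rmax 1 (INR k)) + 1).
    max_bounds (Rmax r0 R1) (Rmax 1 (INR k)).
    max_bounds r0 R1. max_bounds 1 (INR k).
    repeat split; try lra. apply H; lra. }
  destruct (Pick O 0) as [r0 [_ H0]].
  destruct (dependent_choice (fun k r => 1 <= r /\ INR k <= r /\ covered (bad k r) (1 / 9 * r ^ 2))
    (fun _ r r' => r < r') r0) as [rad [_ Hrad]].
  { exact H0. }
  { intros n r _. destruct (Pick (S n) r) as [r' Hr']. exists r'. tauto. }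
  assert (Mono : forall i j, (i <= j)%nat -> rad i <= rad j).
  { intros i j L. induction L; [lra|]. destruct (Hrad m) as [_ H]. lra. }
  exists (fun z => (forall k, z <> t k) /\ forall k, rad k <= Cnorm z -> Cnorm (cauchy t b z) <= / INR (S k)).
  split; [|split].
  (* The square of half side [rad k / 3] lies in the disc and has area [4 / 9 * rad k ^ 2]; the bad
     set takes at most [1 / 9] of [rad k ^ 2]. *)
  - exists (1 / 3). split; [lra|]. intros R0. destruct (INR_unbounded R0) as [k Hk].
    destruct (Hrad k) as [[H1 [H2 H3]] _]. exists (rad k). split; [lra|]. split; [lra|].
    replace (1 / 3 * rad k ^ 2) with ((rad k / 3 - - (rad k / 3)) * (rad k / 3 - - (rad k / 3)) - 1 / 9 * rad k ^ 2) by field.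
    apply (area_outer_ge_complement _ (bad k (rad k))); auto; try lra.
    intros z Hx Hy.
    assert (Hz : Cnorm z < rad k).
    { eapply Rle_lt_trans; [apply Cnorm_le_abs|].
      assert (Rabs (fst z) <= rad k / 3) by (apply Rabs_le_between; lra).
      assert (Rabs (snd z) <= rad k / 3) by (apply Rabs_le_between; lra). lra. }
    apply NNPP. intros Hn. apply not_or_and in Hn. destruct Hn as [N1 N2]. apply N1. split; auto. split.
    + intros j E. apply N2. split; auto. left; exists j; auto.
    + intros j Hj. apply Rnot_lt_le. intros L. apply N2. split; auto. right.
      eapply Rle_lt_trans; [|exact L]. apply Rinv_le_contravar; [apply lt_0_INR; lia|].
      apply le_INR. destruct (Nat.le_gt_cases k j) as [G|G]; [|lia].
      specialize (Mono k j G). lra.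
  - intros z [H _]; auto.
  - intros eps He. destruct (INR_unbounded (/ eps)) as [k Hk]. exists (rad k).
    intros z [_ Hz] HR. eapply Rle_trans; [apply (Hz k); lra|].
    pose proof (Rinv_0_lt_compat _ He).
    rewrite <- (Rinv_inv eps). apply Rinv_le_contravar; auto. rewrite S_INR; lra.
Qed.

(** Otherwise the part of [Om] in a large disc would be covered by a fixed small disc and the bad
    set, of total area at most [c / 2 * Rr ^ 2], against its outer area of at least [c * Rr ^ 2]. *)
Lemma dense_set_meets_sublevel (t b : nat -> Cpx) (W : R) (Om : Cpx -> Prop) : tends_to_infinity t ->
  summable_weights t b W -> positive_upper_area_density Om ->
  forall eps rho, 0 < eps -> exists z, Om z /\ rho < Cnorm z /\ (forall k, z <> t k) /\ Cnorm (cauchy t b z) <= eps.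
Proof.
  intros Ht HW [c [Hc HOm]] eps rho He.
  destruct (cauchy_large_set_cover t b W eps (c / 4) Ht HW He ltac:(lra)) as [R1 H].
  set (q := Rabs rho + 1). assert (Hq : rho < q) by (unfold q; pose proof (Rle_abs rho); lra).
  assert (Hq1 : 1 <= q) by (unfold q; pose proof (Rabs_pos rho); lra).
  assert (Hqc : 0 <= 16 * (q * q) / c).
  { apply Rdiv_le_0_compat; [assert (0 <= q * q) by (apply Rmult_le_pos; lra); lra|auto]. }
  destruct (HOm (Rmax R1 (1 + 16 * (q * q) / c))) as [Rr [HR [HR0 Harea]]].
  max_bounds R1 (1 + 16 * (q * q) / c).
  specialize (H Rr ltac:(lra)).
  assert (Cq := covered_disc q ltac:(lra)).
  apply NNPP. intros Hn.
  assert (Hfin : c * Rr ^ 2 <= 4 * (q * q) + c / 4 * Rr ^ 2).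
  { apply (area_outer_ge_covered _ _ _ _ Harea) with (2 := covered_union _ _ _ _ Cq H).
    intros z [Hz Hzr]. apply NNPP. intros Hno. apply not_or_and in Hno. destruct Hno as [G1 G2].
    apply Hn. exists z. split; auto. split; [lra|]. split.
    - intros k E. apply G2. split; auto. left; exists k; auto.
    - apply Rnot_lt_le. intros L. apply G2; auto. }
  assert (Rr <= Rr ^ 2).
  { simpl. rewrite Rmult_1_r. rewrite <- (Rmult_1_r Rr) at 1. apply Rmult_le_compat_l; lra. }
  assert (4 * (q * q) <= c / 4 * Rr ^ 2).
  { apply Rle_trans with (c / 4 * (16 * (q * q) / c)); [right; field; lra|]. apply Rmult_le_compat_l; lra. }
  assert (0 < c * Rr ^ 2) by (apply Rmult_lt_0_compat; lra). lra.
Qed.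

Lemma infinite_sum_ext (f g : nat -> R) (l : R) : (forall n, f n = g n) -> infinite_sum f l -> infinite_sum g l.
Proof.
  intros E H. apply infinite_sum_psum. intros eps He.
  destruct (proj1 (infinite_sum_psum f l) H eps He) as [N HN]. exists N. intros n Hn.
  rewrite <- (psum_ext f g) by auto. auto.
Qed.

Lemma quotient_minus_cauchy_vanishes (t b : nat -> Cpx) (A dA f : Cpx -> Cpx) (W C R1 : R) (P : nat)
  (E : R -> Prop) (Om : Cpx -> Prop) (N R0 : R) :
  tends_to_infinity t -> (forall m n, t m = t n -> m = n) -> summable_weights t b W ->
  0 <= C -> polynomial_counting t P C R1 ->
  (forall z, has_cderiv A z (dA z)) -> (forall z, A z = C0 <-> exists n, z = t n) ->
  (forall n, dA (t n) <> C0) -> entire f -> (forall n, f (t n) = (dA (t n) * b n)%cpx) ->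
  zero_linear_density E ->
  (forall z, R0 < Cnorm z -> ~ E (Cnorm z) -> Cnorm (f z) <= Rpower (Cnorm z) N * Cnorm (A z)) ->
  positive_upper_area_density Om ->
  (forall eps, 0 < eps -> exists R0, forall z, Om z -> R0 < Cnorm z -> Cnorm (f z) <= eps * Cnorm (A z)) ->
  forall z, (forall n, z <> t n) -> f z = (A z * cauchy t b z)%cpx.
Proof.
  intros Ht Hinj HW HC Hcount HA HA0 HdA Hf Hft HE Hgrowth HOm Hsmall.
  assert (HAe : entire A) by (intros z; exists (dA z); auto).
  assert (HAt : forall n, A (t n) = C0) by (intros n; apply HA0; exists n; auto).
  set (T := fun z => exists n, z = t n).
  assert (HAT : forall z, ~ T z -> A z <> C0) by (intros z Hz Ez; apply Hz, HA0, Ez).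
  assert (Hoff : forall z, ~ T z -> off_poles t b z) by (intros z Hz k _ Ez; apply Hz; exists k; auto).
  assert (HW0 : 0 <= W) by (specialize (HW O); simpl in HW; lra).
  destruct (extend_continuously (fun z => f z / A z - cauchy t b z)%cpx T) as [F [HF EF]].
  { intros z. destruct (poles_isolated t z Ht) as [d [Hd H]]. exists d; split; auto.
    intros w Hw [k Hk]. apply (H w Hw k Hk). }
  { intros z Hz. apply cderivable_sub; [apply cderivable_div; [apply Hf|apply HAe|auto]|].
    apply (cauchy_derivable t b W); auto. }
  { intros z [n ->]. apply (quotient_minus_cauchy_extends t b A f W n (dA (t n))); auto.
    intros z Hz; apply HA0; auto. }
  assert (Hnorm : forall z, ~ T z -> Cnorm (F z) <= Cnorm (f z) / Cnorm (A z) + Cnorm (cauchy t b z)).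
  { intros z Hz. rewrite EF by auto. eapply Rle_trans; [apply Cnorm_sub|].
    rewrite Cnorm_div by auto. lra. }
  destruct (INR_unbounded N) as [N1 HN1].
  (* [D] dominates both the exponent [N] of the quotient and the exponent [S M] of the transform; it
     is used as [S D] because of the extra factor [r] in the growth hypothesis. *)
  set (M := (2 * (P + 1))%nat). set (D := (N1 + S M)%nat).
  assert (HF0 : forall z, ~ T z -> F z = C0).
  { apply (polynomial_growth_small_values (S D) F T (1 + 4 * 3 ^ S M * W) HF).
    - apply poles_discrete_moduli; auto.
    - intros rho.
      destruct (zero_density_union_escape E (exceptional_radii t M) HE
        (exceptional_radii_density t P C R1 Ht HC Hcount) (Rmax rho (Rmax R0 1))) as [r [Hr [Hr0 [HrE Hrt]]]].
      max_bounds rho (Rmax R0 1).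
      max_bounds R0 1.
      assert (Hdist : forall k, / (1 + Cnorm (t k)) ^ M <= Rabs (r - Cnorm (t k))).
      { intros k. apply Rnot_lt_le. intros L. apply Hrt. split; auto. exists k; auto. }
      exists r; split; [lra|]. intros z Hz.
      assert (HzT : ~ T z).
      { intros [k ->]. specialize (Hdist k). rewrite Hz, Rminus_diag, Rabs_R0 in Hdist.
        assert (0 < / (1 + r) ^ M); [|lra]. apply Rinv_0_lt_compat, pow_lt; lra. }
      pose proof (Cnorm_gt0 _ (HAT z HzT)) as HAz.
      assert (HM : forall i, (i <= D)%nat -> r ^ i <= r ^ D) by (intros; apply Rle_pow; [lra|auto]).
      assert (B1 : Cnorm (f z) / Cnorm (A z) <= r ^ D).
      { apply Rle_div_l; auto.
        eapply Rle_trans; [apply Hgrowth; rewrite Hz; auto; lra|]. apply Rmult_le_compat_r; [lra|].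
        rewrite Hz. eapply Rle_trans; [apply (Rpower_le_pow _ _ N1); lra|]. apply HM. unfold D; lia. }
      assert (B2 : Cnorm (cauchy t b z) <= 4 * 3 ^ S M * W * r ^ D).
      { eapply Rle_trans; [apply (cauchy_bound_circle t b W M z Ht HW); [lra|rewrite Hz; auto]|].
        rewrite Hz, Rpow_mult_distr.
        replace (4 * (3 ^ S M * r ^ S M) * W) with (4 * 3 ^ S M * W * r ^ S M) by ring.
        apply Rmult_le_compat_l; [|apply HM; unfold D; lia].
        assert (0 < 3 ^ S M) by (apply pow_lt; lra). apply Rmult_le_pos; lra. }
      specialize (Hnorm z HzT). change (r ^ S D) with (r * r ^ D).
      rewrite (Rmult_comm r), <- Rmult_assoc. apply Rmult_le_compat_r; lra.
    - intros eps rho He. destruct (Hsmall (eps / 2)) as [R2 HR2]; [lra|].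
      destruct (dense_set_meets_sublevel t b W Om Ht HW HOm (eps / 2) (Rmax rho R2)) as [z [Hz [Hr [HzT Hc]]]]; [lra|].
      max_bounds rho R2.
      assert (HnT : ~ T z) by (intros [k Hk]; apply (HzT k Hk)).
      exists z. split; [lra|]. split; auto. eapply Rle_trans; [apply Hnorm; auto|].
      pose proof (Cnorm_gt0 _ (HAT z HnT)) as HAz.
      assert (Cnorm (f z) / Cnorm (A z) <= eps / 2); [|lra].
      apply Rle_div_l; auto.
      apply HR2; auto; lra. }
  intros z Hz. assert (HnT : ~ T z) by (intros [k Hk]; apply (Hz k Hk)).
  specialize (HF0 z HnT). rewrite EF in HF0 by auto. apply Csub_eq0 in HF0. rewrite <- HF0.
  field. auto.
Qed.

Theorem theorem2p6 (t : nat -> Cpx) (A dA : Cpx -> Cpx) (mu : nat -> R)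
  (Ht_inj : forall m n, t m = t n -> m = n)
  (Ht0 : forall n, t n <> C0)
  (Ht_inf : forall M, exists N, forall n, (N <= n)%nat -> M < Cnorm (t n))
  (HA_der : forall z, has_cderiv A z (dA z))
  (HA_zero : forall z, A z = C0 <-> exists n, z = t n)
  (HA_simple : forall n, dA (t n) <> C0)
  (Hmu : forall n, 0 < mu n)
  (Hmu_sum : exists l, infinite_sum (fun n => mu n / (Cnorm (t n) ^ 2 + 1)) l)
  (HA_order : finite_order A) :
  (forall f : Cpx -> Cpx, entire f ->
     (in_H t A mu f <->
      ((exists l, infinite_sum (weight_sum_term t dA mu f) l) /\
       (exists (E : R -> Prop) (N R0 : R),
          (forall x, E x -> 0 < x) /\ zero_linear_density E /\ 0 < N /\
          forall z, R0 < Cnorm z -> ~ E (Cnorm z) ->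
            Cnorm (f z) <= Rpower (Cnorm z) N * Cnorm (A z)) /\
       (exists Om : Cpx -> Prop, positive_upper_area_density Om /\
          forall eps, 0 < eps -> exists R0, forall z, Om z -> R0 < Cnorm z ->
            Cnorm (f z) <= eps * Cnorm (A z)))))
  /\
  (forall (f : Cpx -> Cpx) (a : nat -> Cpx), H_rep t A mu f a ->
     forall l, infinite_sum (fun n => Cnorm (a n) ^ 2) l ->
       infinite_sum (weight_sum_term t dA mu f) l).
Proof.
  assert (HAe : entire A) by (intros z; exists (dA z); auto).
  assert (HAt : forall n, A (t n) = C0) by (intros n; apply HA_zero; exists n; auto).
  assert (HAO : A C0 <> C0) by (intros E; apply HA_zero in E; destruct E as [n E]; apply (Ht0 n); auto).
  destruct (finite_order_counting t A HAe HA_order HAO HAt Ht_inj) as [P [C [R1 [HC [_ Hcount]]]]].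
  assert (Hsq : forall n, 0 < sqrt (mu n)) by (intros; apply sqrt_lt_R0; auto).
  assert (HnA : forall n, 0 < Cnorm (dA (t n))) by (intros; apply Cnorm_gt0; auto).
  (* Common to the necessity of the conditions and to the norm formula, where the terms of both
     series agree one by one. *)
  assert (Rep : forall f a, H_rep t A mu f a -> exists W,
    summable_weights t (fun n => a n * RtoC (sqrt (mu n)))%cpx W /\
    (forall z, (forall n, z <> t n) -> f z = (A z * cauchy t (fun n => a n * RtoC (sqrt (mu n))) z)%cpx) /\
    forall n, weight_sum_term t dA mu f n = Cnorm (a n) ^ 2).
  { intros f a [Hf [Ha Hrep]].
    destruct (coefficient_weights t a mu Ha Hmu Hmu_sum) as [W HW]. exists W.
    assert (Hfz : forall z, (forall n, z <> t n) -> f z = (A z * cauchy t (fun n => a n * RtoC (sqrt (mu n))) z)%cpx).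
    { intros z Hz. destruct (Hrep z Hz) as [s [Hs ->]]. f_equal.
      apply (Cseries_cv_unique _ _ _ Hs). apply (cauchy_spec t _ W); auto. intros k _; auto. }
    split; auto. split; auto. intros n.
    pose proof (representation_residue t _ A f W n (dA (t n)) Ht_inf Ht_inj HW HAe (HAt n) (HA_der _)
      (cderivable_cont f _ (Hf _)) Hfz) as Hres.
    unfold weight_sum_term. rewrite Hres, !Cnorm_mul, Cnorm_RtoC, Rabs_pos_eq by (left; auto).
    replace ((Cnorm (dA (t n)) * (Cnorm (a n) * sqrt (mu n))) ^ 2) with
      (Cnorm (dA (t n)) ^ 2 * Cnorm (a n) ^ 2 * (sqrt (mu n) * sqrt (mu n))) by ring.
    rewrite sqrt_sqrt by (left; auto). specialize (HnA n). specialize (Hmu n). field. split; lra. }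
  split.
  - intros f Hf. split.
    + intros [a Hfa]. destruct (Rep f a Hfa) as [W [HW [Hfz Hterm]]]. destruct Hfa as [_ [[l Hl] _]].
      set (b := fun n => (a n * RtoC (sqrt (mu n)))%cpx) in *.
      assert (HW0 : 0 <= W) by (specialize (HW O); simpl in HW; lra).
      split; [|split].
      * exists l. apply (infinite_sum_ext (fun n => Cnorm (a n) ^ 2)); auto.
      * set (M := (2 * (P + 1))%nat).
        (* The bound on the circle has exponent [S M]; one more power absorbs its constant
           [4 * 3 ^ S M * W] once [|z|] exceeds that constant. *)
        exists (exceptional_radii t M), (INR (S (S M))), (Rmax 1 (4 * 3 ^ S M * W)).
        split; [intros x [Hx _]; auto|]. split; [apply (exceptional_radii_density t P C R1); auto|].
        split; [apply lt_0_INR; lia|]. intros z Hz HE.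
        max_bounds 1 (4 * 3 ^ S M * W).
        assert (Hdist : forall k, / (1 + Cnorm (t k)) ^ M <= Rabs (Cnorm z - Cnorm (t k))).
        { intros k. apply Rnot_lt_le. intros L. apply HE. split; [lra|]. exists k; auto. }
        assert (HzT : forall n, z <> t n).
        { intros k ->. specialize (Hdist k). rewrite Rminus_diag, Rabs_R0 in Hdist.
          assert (0 < / (1 + Cnorm (t k)) ^ M); [|lra]. apply Rinv_0_lt_compat, pow_lt; lra. }
        rewrite Hfz by auto. rewrite Cnorm_mul, Rmult_comm. apply Rmult_le_compat_r; [apply Cnorm_ge0|].
        eapply Rle_trans; [apply (cauchy_bound_circle t b W M z); auto; lra|].
        rewrite Rpower_pow, Rpow_mult_distr by lra.
        replace (4 * (3 ^ S M * Cnorm z ^ S M) * W) with (4 * 3 ^ S M * W * Cnorm z ^ S M) by ring.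
        change (Cnorm z ^ S (S M)) with (Cnorm z * Cnorm z ^ S M).
        apply Rmult_le_compat_r; [apply pow_le; lra|lra].
      * destruct (sublevel_set_density t b W Ht_inf HW) as [Om [HOm [HOT Hsmall]]].
        exists Om. split; auto. intros eps He. destruct (Hsmall eps He) as [R0 H]. exists R0.
        intros z Hz HR. rewrite Hfz by (apply HOT; auto). rewrite Cnorm_mul, Rmult_comm.
        apply Rmult_le_compat_r; [apply Cnorm_ge0|auto].
    + intros [[l Hl] [[E [N [R0 [_ [HE [_ Hgrowth]]]]]] [Om [HOm Hsmall]]]].
      assert (Hd0 : forall n, (dA (t n) * RtoC (sqrt (mu n)))%cpx <> C0).
      { intros n. apply Cmul_neq0; auto. apply Cnorm_gt0_neq. rewrite Cnorm_RtoC, Rabs_pos_eq; auto. left; auto. }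
      (* By [representation_residue], no other coefficients can represent [f]. *)
      set (a := fun n => (f (t n) / (dA (t n) * RtoC (sqrt (mu n))))%cpx).
      assert (Ha : l2 a).
      { exists l. apply (infinite_sum_ext (weight_sum_term t dA mu f)); auto. intros n.
        unfold a, weight_sum_term. rewrite Cnorm_div, Cnorm_mul, Cnorm_RtoC, Rabs_pos_eq by (auto; left; auto).
        specialize (HnA n). specialize (Hsq n). specialize (Hmu n).
        rewrite <- (sqrt_sqrt (mu n)) at 1 by lra. field. split; lra. }
      destruct (coefficient_weights t a mu Ha Hmu Hmu_sum) as [W HW].
      assert (Hft : forall n, f (t n) = (dA (t n) * (a n * RtoC (sqrt (mu n))))%cpx).
      { intros n. unfold a. field. split; auto.
        apply Cnorm_gt0_neq. rewrite Cnorm_RtoC, Rabs_pos_eq; auto. left; auto. }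
      exists a. split; auto. split; auto. intros z Hz.
      exists (cauchy t (fun n => a n * RtoC (sqrt (mu n)))%cpx z). split.
      * apply (cauchy_spec t (fun n => a n * RtoC (sqrt (mu n)))%cpx W); auto. intros k _; auto.
      * apply (quotient_minus_cauchy_vanishes t _ A dA f W C R1 P E Om N R0); auto.
  - intros f a Hfa l Hl. destruct (Rep f a Hfa) as [W [_ [_ Hterm]]].
    apply (infinite_sum_ext (fun n => Cnorm (a n) ^ 2)); auto.
Qed.
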